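(* Let $\Omega\subset\Phi(\mathbf M)$ be a diffiety of codimension $n\ge1$ and let $\Omega_*:\Omega_0\subset\Omega_1\subset\cdots\subset\Omega$ be a good filtration of $\Omega$. Then the $c$-lift $\Omega_{*+c}:\Omega_c\subset\Omega_{c+1}\subset\cdots\subset\Omega$ is an involutive filtration for all sufficiently large $c$.
   Context: Everything is local and $C^\infty$. $\mathbf M$ is a manifold modelled on $\mathbb R^\infty$, with local coordinates $h^1,h^2,\ldots$; $\mathcal F=\mathcal F(\mathbf M)$ is the ring of smooth functions each depending on finitely many coordinates; $\Phi=\Phi(\mathbf M)$ is the $\mathcal F$-module of 1-forms $\sum f^i\,dg^i$ (finite sums, $f^i,g^i\in\mathcal F$); $\mathcal T=\mathcal T(\mathbf M)$ is the $\mathcal F$-module of vector fields $\sum z^i\partial/\partial h^i$ (infinite sums, $z^i\in\mathcal F$ arbitrary); $\mathcal L_Z$ is the Lie derivative. For a submodule $\Omega\subset\Phi$, $\Omega^\perp=\{Z\in\mathcal T:\omega(Z)=0\text{ for all }\omega\in\Omega\}$. For a submodule $\Theta\subset\Phi$, $\mathcal L_{\mathcal H}\Theta$ is the submodule generated by all $\mathcal L_Z\vartheta$ ($Z\in\mathcal H$, $\vartheta\in\Theta$). A diffiety is a submodule $\Omega\subset\Phi$ of finite codimension $n$ which, with $\mathcal H=\Omega^\perp$, admits a good filtration $\Omega_*:\Omega_0\subset\Omega_1\subset\cdots\subset\Omega=\bigcup_l\Omega_l$ by finite-dimensional (finite rank) submodules, i.e. $\mathcal L_{\mathcal H}\Omega_l\subset\Omega_{l+1}$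 for all $l$ and $\Omega_l+\mathcal L_{\mathcal H}\Omega_l=\Omega_{l+1}$ for all large $l$. Then $[\mathcal H,\mathcal H]\subset\mathcal H$ and $\mathcal H$ has rank $n$. For a good filtration put $\mathcal M=\mathcal M_0\oplus\mathcal M_1\oplus\cdots$, $\mathcal M_l=\Omega_l/\Omega_{l-1}$, $\Omega_{-1}=0$. Each $Z\in\mathcal H$ acts $\mathcal F$-linearly by $Z[\omega]=[\mathcal L_Z\omega]\in\mathcal M_{l+1}$ for $[\omega]\in\mathcal M_l$; these actions commute, so $\mathcal M$ is a graded module over the symmetric (polynomial) $\mathcal F$-algebra $\mathcal A=\mathcal F\oplus\mathcal H\oplus(\mathcal H\odot\mathcal H)\oplus\cdots$. For a basis $Z_1,\ldots,Z_n$ of $\mathcal H$ let $\mathcal A(i)\subset\mathcal A$ be the ideal generated by $Z_1,\ldots,Z_i$ ($\mathcal A(0)=0$) and $\mathcal M(i)=\mathcal M/\mathcal A(i)\mathcal M$, with graded components $\mathcal M(i)_l=\mathcal M_l/(\mathcal A(i)\mathcal M\cap\mathcal M_l)$. The basis is called quasiregular (for the given filtration) if the multiplications $Z_{i+1}:\mathcal M(i)_l\to\mathcal M(i)_{l+1}$ are injective for all $l\ge1$ and $i=0,\ldots,n-1$. The filtration is called involutive if a quasiregular basis exists and moreover $\Omega_l+\mathcal L_{\mathcal H}\Omega_l=\Omega_{l+1}$ for all $l\ge0$. The $c$-lift ($c=0,1,\ldots$) of $\Omega_*$ is the filtration $\bar\Omega_*$ with $\bar\Omega_l=\Omega_{l+c}$,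 $l\ge0$; its graded module is formed with $\bar\Omega_{-1}=0$, so its zeroth component is $\Omega_c$. Standing postulate: all $\mathcal F$-modules and $\mathcal A$-modules under consideration are assumed (locally) to possess bases (finite $\mathcal A$-generation in the $\mathcal A$-case), so that results of commutative algebra over the field $\mathbb R$, valid at a fixed point $\mathbf P\in\mathbf M$ (where $\mathcal F$ is replaced by $\mathbb R$), extend locally. *)

(* Defs.v *)
From mathcomp Require Import all_boot all_order all_algebra.
From mathcomp Require Import all_classical all_reals all_analysis.
Import Order.TTheory GRing.Theory Num.Theory.
Import numFieldNormedType.Exports.

Set Implicit Arguments.
Unset Strict Implicit.
Unset Printing Implicit Defensive.

Local Open Scope classical_set_scope.
Local Open Scope ring_scope.

(* The manifold is an open subset U of R^oo (all real sequences, product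
   topology), with h^i the i-th coordinate (numbered from 0).  A function on U
   is represented by the total function extending it by 0 outside U, so that
   Leibniz equality of representatives is equality of functions on U. *)

Definition pt (R : realType) := prod_topology (fun _ : nat => R).

Definition fn (R : realType) := pt R -> R.

(* Coefficient families: the 1-form \sum_i w i dh^i or the vector field
   \sum_i w i d/dh^i. *)
Definition coefs (R : realType) := nat -> fn R.

Section Calculus.
Context {R : realType}.
Implicit Types (U V : set (pt R)) (f : fn R) (w Z : coefs R).

Definition upd (x : pt R) (i : nat) (t : R) : pt R :=
  @dfwith nat (fun=> R) x i t.

Definition pderivable (i : nat) f (x : pt R) : Prop :=
  derivable (fun t : R => f (upd x i t)) (x i) 1.

Definition pd (i : nat) f : fn R :=
  fun x => derive1 (fun t : R => f (upd x i t)) (x i).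

Definition finite_dep U f : Prop :=
  exists m : nat, forall x y, U x -> U y ->
    (forall i, (i < m)%N -> x i = y i) -> f x = f y.

(* C^oo: all iterated partial derivatives exist and are continuous on U. *)
Definition smooth U f : Prop :=
  finite_dep U f /\
  forall (s : seq nat) (x : pt R), U x ->
    {for x, continuous (foldr pd f s)} /\
    forall i, pderivable i (foldr pd f s) x.

Definition zero_ext U f : fn R := patch (fun=> 0) U f.

Definition functions_on U : set (fn R) :=
  [set f | smooth U f /\ zero_ext U f = f].

(* Finite sums \sum f dg are exactly the finite sums \sum w i dh^i, because
   dg is a finite sum for each g depending on finitely many coordinates. *)
Definition forms U : set (coefs R) :=
  [set w | (forall i, functions_on U (w i)) /\
           exists N : nat, forall i, (N <= i)%N -> w i = 0].

Definition vfields U : set (coefs R) :=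
  [set Z | forall i, functions_on U (Z i)].

(* The sums over nat below have finite support at each point. *)
Definition pairing w Z : fn R :=
  fun x => \sum_(j \in [set: nat]) (w j x * Z j x).

(* From L_Z (w_j dh^j) = Z(w_j) dh^j + w_j dZ^j: the coefficient of dh^i. *)
Definition lie U Z w : coefs R := fun i =>
  zero_ext U (fun x => \sum_(j \in [set: nat])
    (Z j x * pd j (w i) x + w j x * pd i (Z j) x)).

Definition restr V w : coefs R := fun i => zero_ext V (w i).

End Calculus.

Section Modules.
Context {R : realType}.
Implicit Types (U V : set (pt R)) (a : fn R) (w Z : coefs R).
Implicit Types (W Theta Omega H : set (coefs R)).

Definition fscale a w : coefs R := fun i => a * w i.

Definition submodule U W : Prop :=
  [/\ W `<=` forms U, W 0,
      forall w w', W w -> W w' -> W (w + w') &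
      forall a w, functions_on U a -> W w -> W (fscale a w)].

Definition Fspan U (S : set (coefs R)) : set (coefs R) :=
  smallest (submodule U) S.

Definition sum_modules W W' : set (coefs R) :=
  [set w + w' | w in W & w' in W'].

(* The classes of e form a basis of the quotient module W / W'. *)
Definition basis_mod U W W' (k : nat) (e : 'I_k -> coefs R) : Prop :=
  [/\ forall i, W (e i),
      forall w, W w -> exists2 a : 'I_k -> fn R,
        forall i, functions_on U (a i) & W' (w - \sum_i fscale (a i) (e i)) &
      forall a : 'I_k -> fn R, (forall i, functions_on U (a i)) ->
        W' (\sum_i fscale (a i) (e i)) -> forall i, a i = 0].

Definition is_basis U W (k : nat) (e : 'I_k -> coefs R) : Prop :=
  basis_mod U W [set 0] e.

Definition finite_rank_mod U W W' : Prop :=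
  exists (k : nat) (e : 'I_k -> coefs R), basis_mod U W W' e.

Definition finite_rank U W : Prop := finite_rank_mod U W [set 0].

Definition codim U Omega (n : nat) : Prop :=
  exists e : 'I_n -> coefs R, basis_mod U (forms U) Omega e.

Definition perp U Omega : set (coefs R) :=
  [set Z | vfields U Z /\ forall w, Omega w -> pairing w Z = 0].

Definition lie_module U H Theta : set (coefs R) :=
  Fspan U [set lie U Z w | Z in H & w in Theta].

(* The submodule over V generated by the restrictions of the elements of W. *)
Definition restr_module V W : set (coefs R) := Fspan V [set restr V w | w in W].

End Modules.

Section Filtrations.
Context {R : realType}.
Implicit Types (U : set (pt R)) (Omega : set (coefs R)).
Implicit Types (Om : nat -> set (coefs R)).

(* Om (l - 1), with Om (-1) = 0. *)
Definition pred_filt Om (l : nat) : set (coefs R) :=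
  if l is l'.+1 then Om l' else [set 0].

Definition good_filtration U Omega Om : Prop :=
  let H := perp U Omega in
  [/\ forall l, submodule U (Om l) /\ finite_rank U (Om l),
      forall l, Om l `<=` Om l.+1,
      Omega = \bigcup_l Om l,
      forall l, lie_module U H (Om l) `<=` Om l.+1 &
      exists l0 : nat, forall l, (l0 <= l)%N ->
        sum_modules (Om l) (lie_module U H (Om l)) = Om l.+1].

Definition diffiety U (n : nat) Omega : Prop :=
  [/\ submodule U Omega, codim U Omega n & exists Om, good_filtration U Omega Om].

Definition clift (c : nat) Om : nat -> set (coefs R) := fun l => Om (l + c)%N.

End Filtrations.

(* The graded module M = \bigoplus_l M_l, M_l = Om l / Om (l - 1).  An element
   of M is represented by a finitely supported sequence m with m l \in Om l;
   m and m' represent the same element when m l - m' l \in Om (l - 1) for all l.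
   Submodules of M are represented by saturated sets of representatives. *)
Section GradedModule.
Context {R : realType}.
Variables (U : set (pt R)) (Omega : set (coefs R)).
Variable Om : nat -> set (coefs R).
Local Notation H := (perp U Omega).
Local Notation graded := (nat -> coefs R).
Implicit Types (m : graded) (Y : coefs R) (N : set graded).

Definition gr_module : set graded :=
  [set m | (forall l, Om l (m l)) /\
           exists L : nat, forall l, (L <= l)%N -> m l = 0].

Definition gr_eq m m' : Prop := forall l, pred_filt Om l (m l - m' l).

Definition gr_scale (a : fn R) m : graded := fun l => fscale a (m l).

(* Multiplication by Y, raising degrees by 1. *)
Definition gr_mul Y m : graded :=
  fun l => if l is l'.+1 then lie U Y (m l') else 0.

Definition gr_hom (l : nat) (w : coefs R) : graded :=
  fun k => if k == l then w else 0.

(* As A is generated by H over F, an A-submodule of M is an F-submodule of M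
   stable under multiplication by the elements of H. *)
Definition A_submodule N : Prop :=
  [/\ N `<=` gr_module,
      forall m m', N m -> gr_module m' -> gr_eq m m' -> N m',
      N 0 /\ (forall m m', N m -> N m' -> N (m + m')),
      forall a m, functions_on U a -> N m -> N (gr_scale a m) &
      forall Y m, H Y -> N m -> N (gr_mul Y m)].

(* A(i) M for the ideal A(i) generated by Z_0, ..., Z_{i-1}: the A-submodule
   of M generated by all products Z_j m with j < i and m \in M. *)
Definition ideal_mul (n : nat) (Z : 'I_n -> coefs R) (i : nat) : set graded :=
  smallest A_submodule
    [set m' | exists j : 'I_n, exists m,
      [/\ (j < i)%N, gr_module m & m' = gr_mul (Z j) m]].

(* Equality in M(i)_l = M_l / (A(i) M `&` M_l) of the classes of w and w'. *)
Definition quot_eq (n : nat) (Z : 'I_n -> coefs R) (i l : nat)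
    (w w' : coefs R) : Prop :=
  ideal_mul Z i (gr_hom l (w - w')).

(* Injectivity of Z_i : M(i)_l -> M(i)_{l+1}, for all l >= 1 and 0 <= i < n
   (the basis being numbered from 0). *)
Definition quasiregular (n : nat) (Z : 'I_n -> coefs R) : Prop :=
  forall (l : nat) (i : 'I_n), (1 <= l)%N ->
    forall w w', Om l w -> Om l w' ->
      quot_eq Z i l.+1 (lie U (Z i) w) (lie U (Z i) w') ->
      quot_eq Z i l w w'.

Definition involutive_filtration (n : nat) : Prop :=
  [/\ good_filtration U Omega Om,
      exists2 Z : 'I_n -> coefs R, is_basis U H Z & quasiregular Z &
      forall l, sum_modules (Om l) (lie_module U H (Om l)) = Om l.+1].

End GradedModule.

(* Main.v *)
From HB Require Import structures.
Require Import Defs.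
From mathcomp Require Import all_boot all_order all_algebra.
From mathcomp Require Import all_classical all_reals all_analysis.
Import Order.TTheory GRing.Theory Num.Theory.
Import numFieldNormedType.Exports.
Set Implicit Arguments.
Unset Strict Implicit.
Unset Printing Implicit Defensive.
Local Open Scope classical_set_scope.
Local Open Scope ring_scope.

(** Multiplication by the fields of H makes the graded module M a module over a
    polynomial ring, finitely generated in high degrees.  Over a field, a generic
    sequence of linear forms is quasiregular on such a module in all sufficiently
    high degrees.  This applies at the point P; as the ranks of the M_l are
    constant, quasiregularity in all these degrees spreads to one neighbourhood
    of P.

    Coordinates.  Bases of the M_l and of the forms modulo Omega lift to a basis
    f l k of all 1-forms, with a dual family of vector fields g l k
    ([adapted_frame]).  Omega and the Om l are then given by the vanishing of
    coordinates, a description that restricts to smaller open sets; H is spanned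
    by the duals of a complement of Omega; and the multiplication by Z in H
    becomes a sequence of matrices, linear in Z, which commute because the Lie
    derivative along a bracket is the commutator of the Lie derivatives
    ([symbol_lie], [mult_mxC]).  What remains is a statement on commuting matrices
    over the ring of functions.

    At the point P.  The forms y_t = z_0 + t z_1 + ... + t^(n-1) z_(n-1) lie on the
    moment curve, so that any n of them are independent.  For every graded
    submodule J and all large t, y_t is injective on M/J in high degrees: y_t fails
    to be so only if it lies in one of the associated primes other than the
    irrelevant one, which are finitely many and contain fewer than n of the y_t
    each.  [generic_injective] obtains this from the ascending chain condition,
    which is Hilbert's basis theorem [noetherian_adjoin].  Choosing the forms one
    after the other, modulo the ideal of the preceding ones, gives a sequence that
    is quasiregular in degrees above some c ([quasiregular_curve]).

    Near P.  Quasiregularity comprises one condition in every degree, and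
    infinitely many open conditions need not hold on a common neighbourhood.  But at
    P it determines the ranks of all quotients Q of M by the ideals of forms
    ([dims_rank]), and lifts of bases of these quotients in the single degree c + 1
    still generate them on the open set where finitely many determinants do not
    vanish.  On this set the products of the lifts by the appropriate forms
    generate M in every higher degree; their number is the rank of M in this
    degree, so they are a basis, and a nontrivial kernel of a form on a quotient Q
    would produce a relation between them ([quasiregular_propagation],
    [quasiregular_ring]).  The forms, read as vector fields, are a basis of H on
    this set ([curve_is_basis]) that is quasiregular for the c'-lift for every
    c' >= c ([quasiregular_curve_basis]); the condition
    Om l + L_H (Om l) = Om (l + 1) holds from a fixed degree on, and the lift makes
    it hold from degree 0 on ([filt_set_gen]). *)

(** * Smooth functions *)

Section Smooth.
Context {R : realType}.
Implicit Types (U V : set (pt R)) (f g : fn R) (x y : pt R).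

Lemma upd_same x i t : upd x i t i = t. Proof. exact: dfwithin. Qed.
Lemma upd_other x i t j : i != j -> upd x i t j = x j.
Proof. exact: dfwithout. Qed.
Lemma upd_id x i : upd x i (x i) = x.
Proof.
apply/funext => j; have [<-|ij] := eqVneq i j; first exact: upd_same.
exact: upd_other.
Qed.
Lemma updK x i s t : upd (upd x i s) i t = upd x i t.
Proof.
apply/funext => j; have [<-|ij] := eqVneq i j; first by rewrite !upd_same.
by rewrite !upd_other.
Qed.
Lemma updC x i j s t : i != j -> upd (upd x i s) j t = upd (upd x j t) i s.
Proof.
move=> ij; apply/funext => k; have [<-|ik] := eqVneq i k.
  by rewrite upd_same upd_other 1?eq_sym // upd_same.
have [<-|jk] := eqVneq j k; first by rewrite upd_same upd_other // upd_same.
by rewrite !upd_other.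
Qed.

(** The topology of pt R is the product topology. *)
Lemma continuous_pt (T : topologicalType) (h : T -> pt R) (t : T) :
  (forall k, {for t, continuous (fun s => h s k)}) -> {for t, continuous h}.
Proof.
move=> hk; apply/cvg_sup => i A; rewrite nbhsE => -[B [[W Wo <-] Bt] sBA].
by apply: filterS sBA _; apply: (hk i); apply: open_nbhs_nbhs.
Qed.

Lemma continuous_upd x i : continuous (upd x i).
Proof.
move=> t; apply: continuous_pt => k; have [<-|ik] := eqVneq i k.
  rewrite (_ : (fun s => _) = id); first exact: cvg_id.
  by apply/funext => s; rewrite upd_same.
rewrite (_ : (fun s => _) = cst (x k)); first exact: cvg_cst.
by apply/funext => s; rewrite upd_other.
Qed.

Lemma near_upd U x i : open U -> U x -> \forall t \near x i, U (upd x i t).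
Proof.
move=> Uo Ux; apply: (@continuous_upd x i (x i)).
by rewrite upd_id; apply: open_nbhs_nbhs.
Qed.

Lemma pdE i f x : pd i f x = 'D_1 (fun t => f (upd x i t)) (x i).
Proof. by rewrite /pd derive1E. Qed.

Definition eq_on U f g := forall x, U x -> f x = g x.

Section OpenSet.
Variable U : set (pt R).
Hypothesis Uo : open U.

Lemma near_eq_on f g x i : eq_on U f g -> U x ->
  {near x i, (fun t => f (upd x i t)) =1 (fun t => g (upd x i t))}.
Proof. by move=> efg Ux; apply: filterS (near_upd i Uo Ux) => t; apply: efg. Qed.

Lemma pd_eq_on f g i : eq_on U f g -> eq_on U (pd i f) (pd i g).
Proof. by move=> e x Ux; rewrite !pdE; apply/near_eq_derive/near_eq_on. Qed.

Lemma pderivable_eq_on f g i x : eq_on U f g -> U x ->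
  pderivable i f x -> pderivable i g x.
Proof. by move=> e Ux; apply/near_eq_derivable/near_eq_on. Qed.

Lemma continuous_eq_on f g x : eq_on U f g -> U x ->
  {for x, continuous f} -> {for x, continuous g}.
Proof.
move=> e Ux cf A; rewrite /= -(e x Ux) => /cf nA.
have nU : nbhs x U by apply: open_nbhs_nbhs.
by apply: filterS (filterI nU nA) => y [Uy]; rewrite /preimage /= e.
Qed.

(** Recursion on the order makes closure under products provable by induction:
    the Leibniz formula for a first derivative involves products of functions of
    lower order only. *)
Fixpoint Ck k f : Prop :=
  (forall x, U x -> {for x, continuous f}) /\
  (if k is k'.+1 then forall i, (forall x, U x -> pderivable i f x) /\ Ck k' (pd i f)
   else True).

Lemma smoothP f : smooth U f <-> finite_dep U f /\ forall k, Ck k f.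
Proof.
split=> -[fd sm]; split=> //.
  move=> k; elim: k f {fd} sm => [|k IHk] f sm; split=> //.
  - by move=> x /(sm [::])[].
  - by move=> x /(sm [::])[].
  move=> i; split=> [x /(sm [::])[] //|].
  by apply: IHk => s; have := sm (rcons s i); rewrite foldr_rcons.
move=> s; elim/last_ind: s f {fd} sm => [|s i IHs] f sm x Ux.
  split; first exact: (sm 0%N).1.
  by move=> i; apply: ((sm 1%N).2 i).1.
by rewrite foldr_rcons; apply: IHs => // k; apply: ((sm k.+1).2 i).2.
Qed.

Lemma Ck_eq_on k f g : eq_on U f g -> Ck k f -> Ck k g.
Proof.
elim: k f g => [|k IHk] f g e [cf df]; split=> //.
- by move=> x Ux; apply: continuous_eq_on (cf x Ux).
- by move=> x Ux; apply: continuous_eq_on (cf x Ux).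
move=> i; split=> [x Ux|].
  by apply: (pderivable_eq_on e Ux); apply: (df i).1.
by apply: IHk (df i).2; apply: pd_eq_on.
Qed.

Lemma CkW k f : Ck k.+1 f -> Ck k f.
Proof.
elim: k f => [|k IHk] f [cf df]; split=> // i; have [fi di] := df i.
by split=> //; apply: IHk.
Qed.

Lemma pd_cst c i x : pd i (fun=> c) x = 0.
Proof. by rewrite pdE derive_cst. Qed.

Lemma Ck_cst c k : Ck k (fun=> c).
Proof.
elim: k c => [|k IHk] c; split=> //.
- by move=> x _; apply: cst_continuous.
- by move=> x _; apply: cst_continuous.
move=> i; split=> [x _|]; first exact: derivable_cst.
by apply: Ck_eq_on (IHk 0) => x _; rewrite pd_cst.
Qed.

Lemma pdD f g i x : pderivable i f x -> pderivable i g x ->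
  pd i (fun y => f y + g y) x = pd i f x + pd i g x.
Proof. by move=> df dg; rewrite !pdE -deriveD. Qed.

Lemma CkD k f g : Ck k f -> Ck k g -> Ck k (fun x => f x + g x).
Proof.
elim: k f g => [|k IHk] f g [cf df] [cg dg]; split=> //.
- by move=> x Ux; apply: continuousD; [apply: cf|apply: cg].
- by move=> x Ux; apply: continuousD; [apply: cf|apply: cg].
move=> i; have [[fi Cf] [gi Cg]] := (df i, dg i); split=> [x Ux|].
  by apply: derivableD; [apply: fi|apply: gi].
by apply: Ck_eq_on (IHk _ _ Cf Cg) => x Ux; rewrite pdD //; [apply: fi|apply: gi].
Qed.

Lemma pdM f g i x : pderivable i f x -> pderivable i g x ->
  pd i (fun y => f y * g y) x = f x * pd i g x + pd i f x * g x.
Proof.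
move=> df dg; rewrite !pdE; rewrite [LHS](deriveM df dg) /=.
by rewrite upd_id; congr (_ + _); apply: mulrC.
Qed.

Lemma CkM k f g : Ck k f -> Ck k g -> Ck k (fun x => f x * g x).
Proof.
elim: k f g => [|k IHk] f g Ckf Ckg; have [[cf df] [cg dg]] := (Ckf, Ckg); split=> //.
- by move=> x Ux; apply: continuousM; [apply: cf|apply: cg].
- by move=> x Ux; apply: continuousM; [apply: cf|apply: cg].
move=> i; have [[fi Cf] [gi Cg]] := (df i, dg i); split=> [x Ux|].
  by apply: derivableM; [apply: fi|apply: gi].
have := CkD (IHk _ _ (CkW Ckf) Cg) (IHk _ _ Cf (CkW Ckg)).
by apply: Ck_eq_on => x Ux; rewrite pdM //; [apply: fi|apply: gi].
Qed.

Lemma pdV f i x : f x != 0 -> pderivable i f x ->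
  pd i (fun y => (f y)^-1) x = - (pd i f x * ((f x)^-1 * (f x)^-1)).
Proof.
move=> fx0 df; rewrite !pdE [LHS](deriveV _ df) ?upd_id //.
by rewrite scaleNr -exprVn expr2; congr (- _); apply: mulrC.
Qed.

Lemma CkV k f : (forall x, U x -> f x != 0) -> Ck k f -> Ck k (fun x => (f x)^-1).
Proof.
move=> f0; elim: k => [|k IHk] Ckf; have [cf df] := Ckf; split=> //.
- by move=> x Ux; apply: continuousV; [apply: f0|apply: cf].
- by move=> x Ux; apply: continuousV; [apply: f0|apply: cf].
move=> i; have [fi Cf] := df i; split=> [x Ux|].
  by apply: (@derivableV _ _ (fun t => f (upd x i t))); rewrite ?upd_id; [apply: f0|apply: fi].
have CV := IHk (CkW Ckf).
have := CkM (Ck_cst (-1) k) (CkM Cf (CkM CV CV)).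
by apply: Ck_eq_on => x Ux; rewrite pdV ?f0 ?mulN1r //; apply: fi.
Qed.

Lemma finite_dep_op2 (op : R -> R -> R) f g :
  finite_dep U f -> finite_dep U g -> finite_dep U (fun x => op (f x) (g x)).
Proof.
move=> [a fa] [b gb]; exists (maxn a b) => x y Ux Uy exy.
rewrite (fa x y) ?(gb x y) // => i lt_i; apply: exy; rewrite leq_max lt_i ?orbT //.
Qed.

Lemma finite_dep_pd f i : finite_dep U f -> finite_dep U (pd i f).
Proof.
move=> [a fa]; exists a => x y Ux Uy exy; rewrite !pdE.
have [lt_ia|le_ai] := ltnP i a.
  rewrite -(exy i lt_ia); apply: near_eq_derive.
  have Uxi := near_upd i Uo Ux; have := near_upd i Uo Uy; rewrite -(exy i lt_ia) => Uyi.
  near=> t; apply: fa; [near: t; exact: Uxi|near: t; exact: Uyi|].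
  move=> j lt_ja; have [<-|ij] := eqVneq i j; first by rewrite !upd_same.
  by rewrite !upd_other // exy.
have const z : U z -> 'D_1 (fun t => f (upd z i t)) (z i) = 0.
  move=> Uz; rewrite (@near_eq_derive _ _ _ _ (cst (f z))) ?derive_cst //.
  apply: filterS (near_upd i Uo Uz) => t Ut; apply: fa => // j lt_ja.
  by rewrite upd_other // gtn_eqF // (leq_trans lt_ja).
by rewrite !const.
Unshelve. all: by end_near.
Qed.

(** A function of the first m coordinates has no other partial derivatives;
    this is what makes the differential of a function a finite sum. *)
Lemma pd_out f m i x : (forall x y, U x -> U y ->
    (forall i, (i < m)%N -> x i = y i) -> f x = f y) ->
  (m <= i)%N -> U x -> pd i f x = 0.
Proof.
move=> fm le_mi Ux; rewrite pdE (@near_eq_derive _ _ _ _ (cst (f x))) ?derive_cst //.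
apply: filterS (near_upd i Uo Ux) => t Ut; apply: fm => // j lt_jm.
by rewrite upd_other // gtn_eqF // (leq_trans lt_jm).
Qed.
End OpenSet.
End Smooth.

(** * Symmetry of second derivatives *)

Section Schwarz.
Context {R : realType}.
Implicit Types (U : set (pt R)) (f g : fn R) (x : pt R).

Lemma MVT_derivable (phi : R -> R) (a b : R) : a < b ->
  {in `[a, b], forall t, derivable phi t 1} ->
  exists2 c, c \in `]a, b[ & phi b - phi a = 'D_1 phi c * (b - a).
Proof.
move=> ab dphi; apply: MVT => // [t tab|].
  apply/derivableP/dphi; exact: subset_itv_oo_cc.
exact: derivable_within_continuous.
Qed.

Lemma MVT_pd g i x (b : R) : x i < b ->
  {in `[x i, b], forall t, pderivable i g (upd x i t)} ->
  exists2 c, c \in `]x i, b[ &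
    g (upd x i b) - g x = pd i g (upd x i c) * (b - x i).
Proof.
move=> ab dg; have [|c cab E] := @MVT_derivable (fun t => g (upd x i t)) _ _ ab.
  move=> t /dg; rewrite /pderivable upd_same.
  by under eq_fun do rewrite updK.
exists c => //; rewrite upd_id in E; rewrite E pdE upd_same.
by under [in RHS]eq_fun do rewrite updK.
Qed.

(** The mean value theorem is applied twice to the second difference of f over
    the square with lower corner x and side h: along coordinate i to the
    difference of f between the two sides parallel to i, then along coordinate j. *)
Lemma mixed_MVT U f i j x (h : R) : open U -> i != j -> 0 < h ->
  (forall s t, s \in `[x i, x i + h] -> t \in `[x j, x j + h] ->
     U (upd (upd x i s) j t)) ->
  (forall y, U y -> pderivable i f y) ->
  (forall y, U y -> pderivable j (pd i f) y) ->
  exists s t, [/\ s \in `[x i, x i + h], t \in `[x j, x j + h] &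
    f (upd (upd x i (x i + h)) j (x j + h)) - f (upd x i (x i + h))
      - (f (upd x j (x j + h)) - f x)
    = pd j (pd i f) (upd (upd x i s) j t) * h * h].
Proof.
move=> Uo ij h0 box fi fij; set a := x i; set b := x j.
have ab k : x k < x k + h by rewrite ltrDl.
have memb k : x k \in `[x k, x k + h] by rewrite in_itv /= lexx lerDl ltW.
have membh k : x k + h \in `[x k, x k + h] by rewrite in_itv /= lexx lerDl ltW.
pose phi s := f (upd (upd x i s) j (b + h)) - f (upd (upd x i s) j b).
have der s t : s \in `[a, a + h] -> t \in `[b, b + h] ->
    is_derive s 1 (fun s' => f (upd (upd x i s') j t)) (pd i f (upd (upd x i s) j t)).
  move=> sa tb; have := fi _ (box s t sa tb); rewrite /pderivable pdE.
  have -> : upd (upd x i s) j t i = s by rewrite updC // upd_same.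
  have -> : (fun t0 => f (upd (upd (upd x i s) j t) i t0))
          = (fun s' => f (upd (upd x i s') j t)).
    by apply/funext => s'; rewrite [in LHS]updC 1?eq_sym // updK.
  by move=> dF; apply: derivableP.
have dphi s : s \in `[a, a + h] -> is_derive s 1 phi
    (pd i f (upd (upd x i s) j (b + h)) - pd i f (upd (upd x i s) j b)).
  by move=> sa; apply: is_deriveB; apply: der; rewrite /b.
have [|s sa Es] := @MVT_derivable phi a (a + h) (ab i).
  by move=> s /dphi[].
have sa' : s \in `[a, a + h] by apply: subset_itv_oo_cc.
have E1 := dphi s sa'; move: Es; rewrite (@derive_val _ _ _ _ _ _ _ E1).
have yj : upd x i s j = b by rewrite upd_other.
have [||t tb Et] := @MVT_pd (pd i f) j (upd x i s) (b + h).
- by rewrite yj; apply: (ab j).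
- move=> t; rewrite yj => tb; apply: fij; exact: box.
have Pb s0 : upd (upd x i s0) j b = upd x i s0.
  by rewrite -[b](upd_other x s0 ij) upd_id.
rewrite yj in tb Et; rewrite Pb Et /phi !Pb => Es.
exists s, t; split=> //; first exact: subset_itv_oo_cc.
have hE c : c + h - c = h by rewrite addrAC subrr add0r.
by rewrite !hE in Es; rewrite -Es upd_id.
Qed.

Lemma continuous_upd2 x i j (p : R * R) : i != j ->
  {for p, continuous (fun p : R * R => upd (upd x i p.1) j p.2)}.
Proof.
move=> ij; apply: continuous_pt => k; have [<-|jk] := eqVneq j k.
  rewrite (_ : (fun s => _) = snd); first exact: cvg_snd.
  by apply/funext => s; rewrite upd_same.
have [<-|ik] := eqVneq i k.
  rewrite (_ : (fun s => _) = fst); first exact: cvg_fst.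
  by apply/funext => s; rewrite upd_other ?upd_same // eq_sym.
rewrite (_ : (fun s => _) = cst (x k)); first exact: cst_continuous.
by apply/funext => s; rewrite !upd_other.
Qed.

Lemma nbhs_box x i j (B : set (pt R)) : i != j -> nbhs x B ->
  exists2 d : R, 0 < d & forall s t : R, ball (x i : R) d s -> ball (x j : R) d t ->
    B (upd (upd x i s) j t).
Proof.
move=> ij nB; pose p : R * R := (x i, x j).
have nB' : nbhs (upd (upd x i p.1) j p.2) B by rewrite upd_id upd_id.
have nP : nbhs p (fun q : R * R => B (upd (upd x i q.1) j q.2)).
  exact: (@continuous_upd2 x i j p ij B nB').
have [d /= d0 Bd] := (@nbhs_ballP R (R * R)%type _ _).1 nP.
by exists d => // s t si tj; apply: (Bd (s, t)).
Qed.

Lemma close_of_eq (a b p q e : R) : `|a - p| < e / 2 -> `|b - q| < e / 2 ->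
  p = q -> `|b - a| <= e.
Proof.
move=> ap bq pq; have -> : b - a = (b - q) - (a - p) by rewrite pq opprB addrA subrK.
have le2 : `|b - q| + `|a - p| <= e by rewrite [leRHS]splitr; apply: lerD; apply: ltW.
exact: le_trans (ler_normB _ _) le2.
Qed.

(** The second difference is symmetric in i and j, so that [mixed_MVT] read in
    both orders gives equal values of the two mixed derivatives at two points
    of an arbitrarily small square; continuity at x does the rest. *)
Theorem pd_comm U f i j x : open U -> Ck U 2 f -> U x ->
  pd i (pd j f) x = pd j (pd i f) x.
Proof.
move=> Uo [_ C2] Ux; have [->//|ij] := eqVneq i j.
have [fi [_ Ci]] := C2 i; have [fj [_ Cj]] := C2 j.
have [[fij [cij _]] [fji [cji _]]] := (Ci j, Cj i).
apply/eqP; rewrite -subr_eq0 -normr_eq0 eq_le normr_ge0 andbT.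
apply/ler_addgt0Pr => e e0; rewrite add0r.
pose D1 := pd j (pd i f); pose D2 := pd i (pd j f).
have e2 : 0 < e / 2 by rewrite divr_gt0.
pose B := [set y | U y /\ (`|D1 x - D1 y| < e / 2 /\ `|D2 x - D2 y| < e / 2)].
have nB : nbhs x B.
  apply: filterI; first exact: open_nbhs_nbhs.
  apply: filterI.
    by move: (cij x Ux) => /cvgrPdist_lt; apply.
  by move: (cji x Ux) => /cvgrPdist_lt; apply.
have [d d0 Bd] := nbhs_box ij nB.
pose h := d / 2; have h0 : 0 < h by rewrite divr_gt0.
have near_ball k s : s \in `[x k, x k + h] -> ball (x k) d s.
  rewrite in_itv /= => /andP[le1 le2]; rewrite /ball /= distrC ger0_norm ?subr_ge0 //.
  rewrite ltrBlDl (le_lt_trans le2) // ltrD2l /h ltr_pdivrMr // ltr_pMr // ltr1n //.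
have box s t : s \in `[x i, x i + h] -> t \in `[x j, x j + h] ->
    B (upd (upd x i s) j t).
  by move=> si tj; apply: Bd; apply: near_ball.
have [s [t [si tj E]]] := mixed_MVT Uo ij h0 (fun s t si tj => (box s t si tj).1) fi fij.
have ji : j != i by rewrite eq_sym.
have [|t' [s' [tj' si' E']]] := @mixed_MVT U f j i x h Uo ji h0 _ fj fji.
  by move=> t' s' tj' si'; rewrite updC //; apply: (box s' t' si' tj').1.
move: E'; rewrite updC // (updC _ t' s' ji) => E'.
have ED : D1 (upd (upd x i s) j t) = D2 (upd (upd x i s') j t').
  have h_neq0 : h != 0 by rewrite gt_eqF.
  have EE : D1 (upd (upd x i s) j t) * h * h = D2 (upd (upd x i s') j t') * h * h.
    rewrite -[LHS]E -[RHS]E'.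
    by rewrite !opprB addrACA [RHS]addrACA; congr (_ + _); apply: addrC.
  exact: (mulIf h_neq0 (mulIf h_neq0 EE)).
have [_ [b1 _]] := box s t si tj; have [_ [_ b2]] := box s' t' si' tj'.
exact: (close_of_eq b1 b2 ED).
Qed.
End Schwarz.

(** * The ring of functions on an open set *)

Section FunctionsOn.
Context {R : realType}.
Implicit Types (U V : set (pt R)) (f g : fn R) (x : pt R).

Lemma zero_ext_in U f x : U x -> zero_ext U f x = f x.
Proof. by move=> Ux; rewrite /zero_ext patchT ?inE. Qed.
Lemma zero_ext_out U f x : ~ U x -> zero_ext U f x = 0.
Proof. by move=> Ux; rewrite /zero_ext patchN // notin_setE. Qed.

Lemma fn_ext U f g : (forall x, ~ U x -> f x = 0) -> (forall x, ~ U x -> g x = 0) ->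
  eq_on U f g -> f = g.
Proof.
move=> f0 g0 e; apply/funext => x; have [/e //|Ux] := pselect (U x).
by rewrite f0 // g0.
Qed.

Lemma zero_ext_idem U f : zero_ext U (zero_ext U f) = zero_ext U f.
Proof.
apply: (@fn_ext U) => x Ux; rewrite ?(zero_ext_in _ Ux) //; exact: zero_ext_out.
Qed.

Lemma zero_ext_id U f : (forall x, ~ U x -> f x = 0) -> zero_ext U f = f.
Proof.
move=> f0; apply: (@fn_ext U) => x Ux; [exact: zero_ext_out|exact: f0|exact: zero_ext_in].
Qed.

Lemma functions_on_out U f x : functions_on U f -> ~ U x -> f x = 0.
Proof. by move=> [_ <-]; apply: zero_ext_out. Qed.

Lemma functions_on_ext U f g : functions_on U f -> functions_on U g ->
  eq_on U f g -> f = g.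
Proof. by move=> Uf Ug; apply: fn_ext => x; apply: functions_on_out. Qed.

Section OpenSet.
Variable U : set (pt R).
Hypothesis Uo : open U.

Lemma smooth_eq_on f g : eq_on U f g -> smooth U f -> smooth U g.
Proof.
move=> e /(smoothP _ _)[[m fd] C]; apply/(smoothP _ _); split.
  by exists m => x y Ux Uy exy; rewrite -!e //; apply: fd.
by move=> k; apply: Ck_eq_on (C k).
Qed.

Lemma functions_on_zero_ext f : smooth U f -> functions_on U (zero_ext U f).
Proof.
move=> sf; split; first by apply: smooth_eq_on sf => x Ux; rewrite zero_ext_in.
exact: zero_ext_idem.
Qed.

Lemma functions_onP f : functions_on U f <->
  [/\ finite_dep U f, forall k, Ck U k f & forall x, ~ U x -> f x = 0].
Proof.
split=> [Uf|[fd C f0]].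
  by have [/(smoothP _ _)[fd C] _] := Uf; split=> // x; apply: functions_on_out.
split; first exact/(smoothP _ _).
exact: zero_ext_id.
Qed.

Lemma functions_on_cst c : functions_on U (zero_ext U (fun=> c)).
Proof.
apply/functions_on_zero_ext/(smoothP _ _); split; first by exists 0%N.
by move=> k; apply: Ck_cst.
Qed.

Lemma functions_on0 : functions_on U 0.
Proof.
apply/functions_onP; split=> //; first by exists 0%N.
by move=> k; apply: (Ck_cst Uo 0).
Qed.

Lemma functions_onD f g : functions_on U f -> functions_on U g -> functions_on U (f + g).
Proof.
move=> /functions_onP[ff Cf f0] /functions_onP[fg Cg g0]; apply/functions_onP; split.
- exact: (finite_dep_op2 +%R).
- by move=> k; apply: CkD.
- by move=> x Ux; rewrite !fctE f0 // g0 // addr0.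
Qed.

Lemma functions_onM f g : functions_on U f -> functions_on U g -> functions_on U (f * g).
Proof.
move=> /functions_onP[ff Cf f0] /functions_onP[fg Cg g0]; apply/functions_onP; split.
- exact: (finite_dep_op2 *%R).
- by move=> k; apply: CkM.
- by move=> x Ux; rewrite !fctE f0 // mul0r.
Qed.

Lemma functions_onN f : functions_on U f -> functions_on U (- f).
Proof.
move=> Uf; have := functions_onM (functions_on_cst (-1)) Uf.
congr functions_on; apply/funext => x; rewrite !fctE.
have [Ux|Ux] := pselect (U x); first by rewrite zero_ext_in // mulN1r.
by rewrite (functions_on_out Uf Ux) mulr0 oppr0.
Qed.

Lemma functions_on_pd f i : functions_on U f -> functions_on U (zero_ext U (pd i f)).
Proof.
move=> /functions_onP[ff Cf f0]; apply/functions_on_zero_ext/(smoothP _ _).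
split; first exact: finite_dep_pd.
by move=> k; have [_ /(_ i)[]] := Cf k.+1.
Qed.

Lemma functions_on_inv f : functions_on U f -> (forall x, U x -> f x != 0) ->
  functions_on U (fun x => (f x)^-1).
Proof.
move=> /functions_onP[[m fd] Cf f0] fn0; apply/functions_onP; split.
- by exists m => x y Ux Uy exy; rewrite (fd x y).
- by move=> k; apply: CkV.
- by move=> x Ux; rewrite f0 // invr0.
Qed.

Lemma functions_on_pderivable f i x : functions_on U f -> U x -> pderivable i f x.
Proof. by move=> /functions_onP[_ Cf _] Ux; have [_ /(_ i)[fi _]] := Cf 1%N; apply: fi. Qed.
End OpenSet.

Lemma functions_on_restr U V f : open V -> V `<=` U -> functions_on U f ->
  functions_on V (zero_ext V f).
Proof.
move=> Vo VU [[[m fd] sm] _]; apply: functions_on_zero_ext => //.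
by split=> [|s x /VU]; [exists m => x y /VU Ux /VU Uy; apply: fd|apply: sm].
Qed.
End FunctionsOn.

Section FunctionRing.
Variable R : realType.

(** Openness is bundled with the set, because it is needed to define the ring of
    functions on it. *)
Record open_set := OpenSet { carrier :> set (pt R); carrier_open : open carrier }.

Variable V : open_set.

(** Functions vanish outside V, so that the unit of this ring is the indicator
    function of V.  The ring is trivial when V is empty, which is why the
    algebra over it is done for rings in which 1 = 0 is possible. *)
Definition smoothfn := {f : fn R | `[< functions_on V f >]}.
HB.instance Definition _ := [isSub of smoothfn for @proj1_sig _ _].
HB.instance Definition _ := [Choice of smoothfn by <:].

Lemma smoothfnP (f : smoothfn) : functions_on V (val f).
Proof. exact/asboolP/(valP f). Qed.

Definition mk_smoothfn (f : fn R) (Vf : functions_on V f) : smoothfn :=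
  exist _ f (introT (asboolP _) Vf).

Let Vo := carrier_open V.
Definition smoothfn_zero := mk_smoothfn (functions_on0 Vo).
Definition smoothfn_one := mk_smoothfn (functions_on_cst Vo 1).
Definition smoothfn_opp f := mk_smoothfn (functions_onN Vo (smoothfnP f)).
Definition smoothfn_add f g := mk_smoothfn (functions_onD Vo (smoothfnP f) (smoothfnP g)).
Definition smoothfn_mul f g := mk_smoothfn (functions_onM Vo (smoothfnP f) (smoothfnP g)).

Fact smoothfn_addA : associative smoothfn_add.
Proof. by move=> f g h; apply: val_inj; apply: addrA. Qed.
Fact smoothfn_addC : commutative smoothfn_add.
Proof. by move=> f g; apply: val_inj; apply: addrC. Qed.
Fact smoothfn_add0 : left_id smoothfn_zero smoothfn_add.
Proof. by move=> f; apply: val_inj; apply: add0r. Qed.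
Fact smoothfn_addN : left_inverse smoothfn_zero smoothfn_opp smoothfn_add.
Proof. by move=> f; apply: val_inj; apply: addNr. Qed.
HB.instance Definition _ :=
  GRing.isZmodule.Build smoothfn smoothfn_addA smoothfn_addC smoothfn_add0 smoothfn_addN.

Fact smoothfn_mulA : associative smoothfn_mul.
Proof. by move=> f g h; apply: val_inj; apply: mulrA. Qed.
Fact smoothfn_mulC : commutative smoothfn_mul.
Proof. by move=> f g; apply: val_inj; apply: mulrC. Qed.
Fact smoothfn_mul1 : left_id smoothfn_one smoothfn_mul.
Proof.
move=> f; apply: val_inj.
apply: (functions_on_ext (smoothfnP (smoothfn_mul smoothfn_one f)) (smoothfnP f)) => x Vx.
by rewrite /= fctE zero_ext_in // mul1r.
Qed.
Fact smoothfn_mulD : left_distributive smoothfn_mul smoothfn_add.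
Proof. by move=> f g h; apply: val_inj; apply: mulrDl. Qed.
HB.instance Definition _ := GRing.Zmodule_isComPzRing.Build smoothfn
  smoothfn_mulA smoothfn_mulC smoothfn_mul1 smoothfn_mulD.

Definition ev (x : pt R) (f : smoothfn) : R := val f x.
Lemma ev1 x : carrier V x -> ev x 1 = 1. Proof. exact: zero_ext_in. Qed.

Lemma val_sum I (r : seq I) (P : pred I) (F : I -> smoothfn) :
  val (\sum_(i <- r | P i) F i) = \sum_(i <- r | P i) val (F i).
Proof. exact: (big_morph val (id1 := 0) (op1 := +%R)). Qed.

Lemma smoothfn_unit (f : smoothfn) : (forall x, carrier V x -> ev x f != 0) -> exists g, g * f = 1.
Proof.
move=> f0; exists (mk_smoothfn (functions_on_inv Vo (smoothfnP f) f0)).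
apply: val_inj; apply: (functions_on_ext (smoothfnP _) (smoothfnP 1)) => x Vx.
by rewrite /= fctE zero_ext_in // mulVf // f0.
Qed.
End FunctionRing.

(** * Differential forms and vector fields over a ring with commuting derivations *)

Section FiniteSums.
Variable F : comPzRingType.
Local Notation vec := (nat -> F^o).
Implicit Types (u v w : vec) (a b : F).

Definition vanishes_from u N : Prop := forall j, (N <= j)%N -> u j = 0.
Definition fin u : Prop := exists N, vanishes_from u N.
(** Infinite vector fields are paired with finite forms, so sums over all indices
    occur whose number of terms depends on the form; choosing a bound once and
    for all makes the sum a total operation. *)
Definition fsum u : F := \sum_(j < get (vanishes_from u)) u j.

Lemma sum_vanishes u N N' : vanishes_from u N -> (N <= N')%N ->
  \sum_(j < N') u j = \sum_(j < N) u j.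
Proof.
move=> u0 le_NN; rewrite -!(big_mkord xpredT u) (@big_cat_nat _ _ _ N) //=.
by rewrite [X in _ + X]big1_seq ?addr0 // => j /andP[_]; rewrite mem_index_iota => /andP[/u0].
Qed.

Lemma fsumE u N : vanishes_from u N -> fsum u = \sum_(j < N) u j.
Proof.
move=> u0; have g0 : vanishes_from u (get (vanishes_from u)).
  by apply: (@getPex _ (vanishes_from u)); exists N.
rewrite /fsum -(sum_vanishes g0 (leq_maxl _ N)).
by rewrite (sum_vanishes u0) // leq_maxr.
Qed.

Lemma vanishesW u N N' : (N <= N')%N -> vanishes_from u N -> vanishes_from u N'.
Proof. by move=> le_NN u0 j /(leq_trans le_NN)/u0. Qed.

Lemma fin2 u v : fin u -> fin v -> exists N, vanishes_from u N /\ vanishes_from v N.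
Proof.
move=> [N u0] [M v0]; exists (maxn N M); split.
  by apply: vanishesW u0; rewrite leq_maxl.
by apply: vanishesW v0; rewrite leq_maxr.
Qed.

Lemma fin0 : fin 0. Proof. by exists 0%N. Qed.
Lemma finD u v : fin u -> fin v -> fin (u + v).
Proof.
by move=> /fin2 h /h[N [u0 v0]]; exists N => j le_j; rewrite !fctE u0 // v0 // addr0.
Qed.
Lemma finZ a u : fin u -> fin (a *: u).
Proof. by move=> [N u0]; exists N => j le_j; rewrite !fctE u0 // scaler0. Qed.
Lemma finN u : fin u -> fin (- u).
Proof. by rewrite -scaleN1r; apply: finZ. Qed.
Lemma finB u v : fin u -> fin v -> fin (u - v).
Proof. by move=> fu fv; apply: finD => //; apply: finN. Qed.
Lemma fin_sum (I : Type) (r : seq I) (P : pred I) (G : I -> vec) :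
  (forall i, P i -> fin (G i)) -> fin (\sum_(i <- r | P i) G i).
Proof. by move=> fG; elim/big_ind: _ => //; [apply: fin0|apply: finD]. Qed.
Lemma finMr u v : fin u -> fin (fun j => u j * v j).
Proof. by move=> [N u0]; exists N => j le_j; rewrite u0 // mul0r. Qed.

Lemma fsum0 u : (forall j, u j = 0) -> fsum u = 0.
Proof. by move=> u0; rewrite (@fsumE u 0) ?big_ord0. Qed.
Lemma fsumD u v : fin u -> fin v -> fsum (fun j => u j + v j) = fsum u + fsum v.
Proof.
move=> /fin2 h /h[N [u0 v0]]; rewrite (fsumE u0) (fsumE v0) -big_split.
by apply: fsumE => j le_j; rewrite u0 // v0 // addr0.
Qed.
Lemma fsumZ a u : fin u -> fsum (fun j => a * u j) = a * fsum u.
Proof.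
move=> [N u0]; rewrite (fsumE u0) mulr_sumr.
by apply: fsumE => j le_j; rewrite u0 // mulr0.
Qed.
Lemma eq_fsum u v : u =1 v -> fsum u = fsum v.
Proof. by move=> e; congr fsum; apply/funext. Qed.
End FiniteSums.

(** These are the only properties of the partial derivatives that the Lie
    calculus uses; the last field says that functions depend on finitely many
    coordinates. *)
Record derivations (F : comPzRingType) := Derivations {
  partial :> nat -> F -> F;
  dD : forall i a b, partial i (a + b) = partial i a + partial i b;
  dM : forall i a b, partial i (a * b) = a * partial i b + partial i a * b;
  dC : forall i j a, partial i (partial j a) = partial j (partial i a);
  d_fin : forall a, exists N, forall i, (N <= i)%N -> partial i a = 0 }.
Arguments dD {F d} i a b : rename.
Arguments dM {F d} i a b : rename.
Arguments dC {F d} i j a : rename.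
Arguments d_fin {F} d a : rename.

Section Calculus.
Variables (F : comPzRingType) (d : derivations F).
Local Notation vec := (nat -> F^o).
Implicit Types (u v w Y Z : vec) (a b : F).

Lemma d0 i : d i 0 = 0.
Proof. by apply: (addIr (d i 0)); rewrite add0r -dD addr0. Qed.
Lemma dN i a : d i (- a) = - d i a.
Proof. by apply: (addIr (d i a)); rewrite -dD !addNr d0. Qed.
Lemma d1 i : d i 1 = 0.
Proof.
have e : d i (1 * 1) = 1 * d i 1 + d i 1 * 1 by apply: dM.
by apply: (addIr (d i 1)); rewrite add0r -{3}[1]mulr1 e mul1r mulr1.
Qed.
Lemma d_nat i k : d i k%:R = 0.
Proof. by elim: k => [|k IHk]; rewrite ?d0 // mulrS dD d1 IHk addr0. Qed.
Lemma d_sum i (I : Type) (r : seq I) (G : I -> F) :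
  d i (\sum_(k <- r) G k) = \sum_(k <- r) d i (G k).
Proof. exact: (big_morph (d i) (dD (d := d) i) (d0 i)). Qed.

Definition pair w Z : F := fsum (fun j => w j * Z j).
Definition grad a : vec := fun i => d i a.
Definition act Z a : F := fsum (fun j => Z j * d j a).
Definition lieF Z w : vec := fun i => act Z (w i) + fsum (fun j => w j * d i (Z j)).
Definition bracket Y Z : vec := fun k => act Y (Z k) - act Z (Y k).
Definition unit_form (j : nat) : vec := fun i => (i == j)%:R.

Lemma grad_fin a : fin (grad a). Proof. exact: (d_fin d a). Qed.
Lemma act_fin Z a : fin (fun j => Z j * d j a).
Proof. by have [N d0] := d_fin d a; exists N => j le_j; rewrite d0 // mulr0. Qed.

Lemma pairDl v w Z : fin v -> fin w -> pair (v + w) Z = pair v Z + pair w Z.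
Proof.
move=> fv fw; rewrite -fsumD; try exact: finMr.
by apply: eq_fsum => j; rewrite mulrDl.
Qed.
Lemma pairZl a w Z : fin w -> pair (a *: w) Z = a * pair w Z.
Proof.
move=> fw; rewrite -fsumZ; last exact: finMr.
by apply: eq_fsum => j; rewrite mulrA.
Qed.
Lemma pair0l Z : pair 0 Z = 0.
Proof. by apply: fsum0 => j; rewrite mul0r. Qed.
Lemma pair_suml (I : Type) (r : seq I) (P : pred I) (G : I -> vec) Z :
  (forall i, P i -> fin (G i)) ->
  pair (\sum_(i <- r | P i) G i) Z = \sum_(i <- r | P i) pair (G i) Z.
Proof.
move=> fG; have [//] : fin (\sum_(i <- r | P i) G i) /\
    pair (\sum_(i <- r | P i) G i) Z = \sum_(i <- r | P i) pair (G i) Z.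
elim/big_rec2: _ => [|i x v Pi [fv <-]]; first by split; [apply: fin0|apply: pair0l].
by split; [apply: finD => //; apply: fG|rewrite pairDl //; apply: fG].
Qed.
Lemma pairDr w Y Z : fin w -> pair w (Y + Z) = pair w Y + pair w Z.
Proof.
move=> fw; rewrite -fsumD; try exact: finMr.
by apply: eq_fsum => j; rewrite mulrDr.
Qed.
Lemma pairZr w a Z : fin w -> pair w (a *: Z) = a * pair w Z.
Proof.
move=> fw; rewrite -fsumZ; last exact: finMr.
by apply: eq_fsum => j; rewrite mulrCA.
Qed.
Lemma pair0r w : pair w 0 = 0.
Proof. by apply: fsum0 => j; rewrite mulr0. Qed.
Lemma pair_sumr (I : Type) (r : seq I) (P : pred I) (G : I -> vec) w : fin w ->
  pair w (\sum_(i <- r | P i) G i) = \sum_(i <- r | P i) pair w (G i).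
Proof.
move=> fw; apply: (big_morph (pair w)); last exact: pair0r.
by move=> Y Z; apply: pairDr.
Qed.
Lemma pair_unit j Z : pair (unit_form j) Z = Z j.
Proof.
rewrite /pair (@fsumE _ _ j.+1) => [|k le_k]; last by rewrite /unit_form gtn_eqF ?mul0r.
rewrite big_ord_recr /= /unit_form eqxx mul1r big1 ?add0r // => i _.
by rewrite ltn_eqF ?mul0r.
Qed.
Lemma fin_unit j : fin (unit_form j).
Proof. by exists j.+1 => k le_k; rewrite /unit_form gtn_eqF. Qed.
Lemma unit_decomp w N : vanishes_from w N -> w = \sum_(j < N) w j *: unit_form j.
Proof.
move=> w0; apply/funext => i; rewrite fct_sumE.
rewrite (eq_bigr (fun j : 'I_N => w j * (i == j :> nat)%:R)) //.
have [le_Ni|lt_iN] := leqP N i.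
  by rewrite w0 // big1 // => j _; rewrite gtn_eqF ?mulr0 // (leq_trans (ltn_ord j)).
rewrite (bigD1 (Ordinal lt_iN)) //= eqxx mulr1 big1 ?addr0 // => j.
by rewrite -val_eqE /= eq_sym => /negPf->; rewrite mulr0.
Qed.

Lemma actD Z a b : act Z (a + b) = act Z a + act Z b.
Proof.
rewrite -fsumD; try exact: act_fin.
by apply: eq_fsum => j; rewrite dD mulrDr.
Qed.
Lemma act0 Z : act Z 0 = 0.
Proof. by apply: fsum0 => j; rewrite d0 mulr0. Qed.
Lemma act_nat Z k : act Z k%:R = 0.
Proof. by apply: fsum0 => j; rewrite d_nat mulr0. Qed.
Lemma actM Z a b : act Z (a * b) = a * act Z b + act Z a * b.
Proof.
rewrite [X in _ + X]mulrC -!fsumZ; try exact: act_fin.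
rewrite -fsumD.
- by apply: eq_fsum => j; rewrite dM mulrDr mulrCA; congr (_ + _); rewrite mulrA mulrC.
- by have [N u0] := act_fin Z b; exists N => j /u0 ->; rewrite mulr0.
- by have [N u0] := act_fin Z a; exists N => j /u0 ->; rewrite mulr0.
Qed.
Lemma act_sum Z (I : Type) (r : seq I) (G : I -> F) :
  act Z (\sum_(k <- r) G k) = \sum_(k <- r) act Z (G k).
Proof. exact: (big_morph (act Z) (actD Z) (act0 Z)). Qed.
Lemma act_scale a Z b : act (a *: Z) b = a * act Z b.
Proof.
rewrite -fsumZ; last exact: act_fin.
by apply: eq_fsum => j; rewrite mulrA.
Qed.
Lemma act_add Y Z b : act (Y + Z) b = act Y b + act Z b.
Proof.
rewrite -fsumD; try exact: act_fin.
by apply: eq_fsum => j; rewrite mulrDl.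
Qed.
Lemma actE Z a N : (forall i, (N <= i)%N -> d i a = 0) ->
  act Z a = \sum_(j < N) Z j * d j a.
Proof. by move=> d0; apply: fsumE => j le_j; rewrite d0 // mulr0. Qed.

Lemma lieFD Z v w : fin v -> fin w -> lieF Z (v + w) = lieF Z v + lieF Z w.
Proof.
move=> fv fw; apply/funext => i; rewrite /lieF !fctE actD -addrACA; congr (_ + _).
rewrite -fsumD; try exact: finMr.
by apply: eq_fsum => j; rewrite mulrDl.
Qed.
Lemma lieF0 Z : lieF Z 0 = 0.
Proof.
by apply/funext => i; rewrite /lieF act0 fsum0 ?addr0 // => j; rewrite mul0r.
Qed.
Lemma lieF_scale Z a w : fin w -> lieF Z (a *: w) = a *: lieF Z w + act Z a *: w.
Proof.
move=> fw; apply/funext => i.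
have -> : lieF Z (a *: w) i = act Z (a * w i) + fsum (fun j => a * (w j * d i (Z j))).
  by congr (_ + _); apply: eq_fsum => j; rewrite mulrA.
have -> : (a *: lieF Z w + act Z a *: w) i = a * lieF Z w i + act Z a * w i by [].
rewrite actM fsumZ; last exact: finMr.
by rewrite /lieF mulrDr addrAC.
Qed.

Lemma lieF_comb Z (I : Type) (r : seq I) (a : I -> F) (G : I -> vec) :
  (forall k, fin (G k)) -> lieF Z (\sum_(k <- r) a k *: G k) =
  \sum_(k <- r) (a k *: lieF Z (G k) + act Z (a k) *: G k).
Proof.
move=> fG; have [//] : fin (\sum_(k <- r) a k *: G k) /\ lieF Z (\sum_(k <- r) a k *: G k) =
  \sum_(k <- r) (a k *: lieF Z (G k) + act Z (a k) *: G k).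
elim/big_rec2: _ => [|k x v _ [fv <-]]; first by split; [apply: fin0|apply: lieF0].
split; first by apply: finD => //; apply/finZ/fG.
by rewrite lieFD ?lieF_scale //; apply/finZ/fG.
Qed.

Lemma lieF_N Z w : fin w -> lieF Z (- w) = - lieF Z w.
Proof.
move=> fw; apply: (addIr (lieF Z w)); rewrite addNr -lieFD //; last exact: finN.
by rewrite addNr lieF0.
Qed.

Lemma lieF_unit Z j : lieF Z (unit_form j) = grad (Z j).
Proof.
apply/funext => i; rewrite /lieF /unit_form act_nat add0r.
exact: (pair_unit j (fun k => d i (Z k))).
Qed.

Lemma fin_lieF Z w : fin w -> fin (lieF Z w).
Proof.
move=> [N w0]; rewrite (unit_decomp w0) lieF_comb; last by move=> k; apply: fin_unit.
apply: fin_sum => j _; apply: finD; last exact/finZ/fin_unit.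
by rewrite lieF_unit; apply/finZ/grad_fin.
Qed.

Lemma lieF_addl Y Z w : fin w -> lieF (Y + Z) w = lieF Y w + lieF Z w.
Proof.
move=> fw; apply/funext => i.
have -> : lieF (Y + Z) w i =
    act (Y + Z) (w i) + fsum (fun j => w j * d i (Y j) + w j * d i (Z j)).
  by congr (_ + _); apply: eq_fsum => j; rewrite -mulrDr -(dD (d := d)).
rewrite act_add (fsumD (finMr _ fw) (finMr _ fw)); exact: addrACA.
Qed.

(** On forms that annihilate Z, the Lie derivative is thus linear over functions
    in Z; this is what makes the action on the graded module one of the symmetric
    algebra over the functions. *)
Lemma lieF_scalel a Z w : fin w ->
  lieF (a *: Z) w = a *: lieF Z w + pair w Z *: grad a.
Proof.
move=> fw; apply/funext => i.
have -> : lieF (a *: Z) w i =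
    act (a *: Z) (w i) + fsum (fun j => a * (w j * d i (Z j)) + d i a * (w j * Z j)).
  congr (_ + _); apply: eq_fsum => j.
  rewrite [d i _](dM i a (Z j)) mulrDr mulrCA; congr (_ + _); exact: mulrCA.
have -> : (a *: lieF Z w + pair w Z *: grad a) i = a * lieF Z w i + pair w Z * d i a by [].
have [fw1 fw2] : fin (fun j => w j * d i (Z j)) /\ fin (fun j => w j * Z j).
  by split; apply: finMr.
have h b u : fin u -> fin (fun j => b * u j) by apply: finZ.
rewrite fsumD; try exact: h.
rewrite !fsumZ // act_scale mulrDr addrA; congr (_ + _ + _); exact: mulrC.
Qed.

Lemma lieF_suml (I : Type) (r : seq I) (G : I -> vec) w : fin w ->
  lieF (\sum_(k <- r) G k) w = \sum_(k <- r) lieF (G k) w.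
Proof.
move=> fw; apply: (big_morph (lieF^~ w)) => [Y Z|]; first exact: lieF_addl.
have := lieF_addl 0 0 fw; rewrite addr0 => e.
by apply: (addIr (lieF 0 w)); rewrite add0r -e.
Qed.

(** The Leibniz rule for the pairing, which makes the fields that annihilate a
    stable module of forms closed under brackets. *)
Lemma act_pair Y w Z : fin w ->
  act Y (pair w Z) = pair (lieF Y w) Z + pair w (bracket Y Z).
Proof.
move=> [N w0].
have unitE j : act Y (Z j) = pair (lieF Y (unit_form j)) Z + bracket Y Z j.
  by rewrite lieF_unit /bracket addrC /pair (eq_fsum (v := fun k => Z k * d k (Y j))) ?subrK // => k; rewrite mulrC.
have fu j : fin (unit_form j) by apply: fin_unit.
have fl j : fin (lieF Y (unit_form j)) by apply: fin_lieF.
rewrite (unit_decomp w0) !pair_suml; try by move=> j _; apply: finZ.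
rewrite lieF_comb // pair_suml => [|j _]; last by apply: finD; apply: finZ.
rewrite act_sum -big_split; apply: eq_bigr => j _ /=.
rewrite pairDl; try exact: finZ.
by rewrite !pairZl // !pair_unit actM unitE mulrDr addrAC.
Qed.

Lemma lieF_grad Y a : lieF Y (grad a) = grad (act Y a).
Proof.
apply/funext => i; have [N dN0] := d_fin d a.
rewrite /lieF (@fsumE _ _ N) => [|j le_j]; last by rewrite /grad dN0 // mul0r.
rewrite (@actE Y (grad a i) N) => [|j le_j]; last by rewrite /grad dC dN0 // d0.
rewrite -big_split /grad (actE Y dN0) d_sum; apply: eq_bigr => j _ /=.
by rewrite dM dC; congr (_ + _); rewrite mulrC.
Qed.

Lemma act_bracket Y Z a : act (bracket Y Z) a = act Y (act Z a) - act Z (act Y a).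
Proof.
have key X W : act X (act W a) = fsum (fun j => act X (W j) * d j a)
     + fsum (fun j => W j * act X (d j a)).
  have [N dN0] := d_fin d a.
  rewrite (actE W dN0) act_sum !(@fsumE _ _ N) => [|j le_j|j le_j]; last first.
  - by rewrite dN0 // mulr0.
  - by rewrite dN0 // act0 mulr0.
  by rewrite -big_split; apply: eq_bigr => j _; rewrite actM addrC.
have sym : fsum (fun j => Z j * act Y (d j a)) = fsum (fun j => Y j * act Z (d j a)).
  have [N dN0] := d_fin d a.
  rewrite !(@fsumE _ _ N) => [|j le_j|j le_j]; try by rewrite dN0 // act0 mulr0.
  have inner X j : act X (d j a) = \sum_(k < N) X k * d k (d j a).
    by apply: actE => k le_k; rewrite dC dN0 // d0.
  under eq_bigr do rewrite inner; under [RHS]eq_bigr do rewrite inner.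
  under eq_bigr do rewrite mulr_sumr; under [RHS]eq_bigr do rewrite mulr_sumr.
  rewrite exchange_big; apply: eq_bigr => j _; apply: eq_bigr => k _.
  by rewrite mulrCA dC.
rewrite !key sym opprD addrACA subrr addr0.
have [N dN0] := d_fin d a.
rewrite (actE _ dN0) !(@fsumE _ _ N) => [|j le_j|j le_j]; try by rewrite dN0 // mulr0.
by rewrite -sumrB; apply: eq_bigr => j _; rewrite mulrBl.
Qed.

(** Both sides are determined by their values on functions and on the forms
    dh^j; on the latter the identity is the differential of [act_bracket]. *)
Lemma lieF_bracket Y Z w : fin w ->
  lieF (bracket Y Z) w = lieF Y (lieF Z w) - lieF Z (lieF Y w).
Proof.
move=> [N w0].
have fu j : fin (unit_form j) by apply: fin_unit.
have twice X W : lieF X (lieF W w) = \sum_(j < N) (w j *: lieF X (lieF W (unit_form j))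
    + act X (act W (w j)) *: unit_form j
    + (act X (w j) *: lieF W (unit_form j) + act W (w j) *: lieF X (unit_form j))).
  rewrite {1}(unit_decomp w0) lieF_comb // big_split /=.
  have fl j : fin (lieF W (unit_form j)) by apply: fin_lieF.
  rewrite lieFD; try by apply: fin_sum => j _; apply: finZ.
  rewrite !lieF_comb // -big_split; apply: eq_bigr => j _ /=.
  by rewrite [X in _ + X]addrC addrACA.
rewrite !twice -sumrB {1}(unit_decomp w0) lieF_comb //; apply: eq_bigr => j _.
have cancel (P Q S : vec) : P + S - (Q + S) = P - Q.
  by rewrite opprD addrACA subrr addr0.
rewrite [X in _ - (_ + X)]addrC cancel.
rewrite opprD addrACA -scalerBr -scalerBl -act_bracket; congr (_ *: _ + _).
rewrite !lieF_unit !lieF_grad; apply/funext => i.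
by rewrite !fctE /grad /bracket dD dN.
Qed.
End Calculus.

(** * Forms and fields with coefficients in the ring of functions *)

Section Bridge.
Context {R : realType}.
Variable V : open_set R.
Let Vo := carrier_open V.
Local Notation F := (smoothfn V).
Local Notation vec := (nat -> F^o).

Definition der (i : nat) (f : F) : F := mk_smoothfn (functions_on_pd Vo i (smoothfnP f)).

Lemma smoothfn_ext (f g : F) : (forall x, carrier V x -> val f x = val g x) -> f = g.
Proof. by move=> e; apply/val_inj/(functions_on_ext (smoothfnP f) (smoothfnP g)). Qed.

Lemma derE i f x : carrier V x -> val (der i f) x = pd i (val f) x.
Proof. by move=> Vx; rewrite /= zero_ext_in. Qed.

Lemma der_eq_on i f : eq_on V (val (der i f)) (pd i (val f)).
Proof. by move=> x; apply: derE. Qed.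

Lemma smoothfn_pderivable i (f : F) x : carrier V x -> pderivable i (val f) x.
Proof. exact: (functions_on_pderivable (smoothfnP f)). Qed.

Lemma derD i f g : der i (f + g) = der i f + der i g.
Proof.
apply: smoothfn_ext => x Vx; rewrite derE //.
have -> : val (der i f + der i g) x = val (der i f) x + val (der i g) x by [].
by rewrite !derE // -(pdD (@smoothfn_pderivable i f x Vx) (@smoothfn_pderivable i g x Vx)).
Qed.

Lemma derM i f g : der i (f * g) = f * der i g + der i f * g.
Proof.
apply: smoothfn_ext => x Vx; rewrite derE //.
have -> : val (f * der i g + der i f * g) x =
  val f x * val (der i g) x + val (der i f) x * val g x by [].
by rewrite !derE // -(pdM (@smoothfn_pderivable i f x Vx) (@smoothfn_pderivable i g x Vx)).
Qed.

Lemma derC i j f : der i (der j f) = der j (der i f).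
Proof.
apply: smoothfn_ext => x Vx.
rewrite (derE i (der j f) Vx) (derE j (der i f) Vx).
rewrite (pd_eq_on Vo i (der_eq_on j f) Vx) (pd_eq_on Vo j (der_eq_on i f) Vx).
have [_ Cf _] := (functions_onP _ _).1 (smoothfnP f).
exact: (pd_comm i j Vo (Cf 2%N) Vx).
Qed.

Lemma der_fin f : exists N, forall i, (N <= i)%N -> der i f = 0.
Proof.
have [[[m fm] _] _] := smoothfnP f; exists m => i le_mi.
by apply: smoothfn_ext => x Vx; rewrite derE // (pd_out Vo fm le_mi Vx).
Qed.

Definition partials : derivations F := Derivations derD derM derC der_fin.

Definition ofF (w : vec) : coefs R := fun i => val (w i).
Definition toF (W : coefs R) : vec := fun i =>
  if pselect (functions_on V (W i)) is left VW then mk_smoothfn VW else 0.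

Lemma ofF_inj : injective ofF.
Proof.
move=> w w' e; apply/funext => i; apply: val_inj.
exact: (congr1 (fun W : coefs R => W i) e).
Qed.
Lemma ofFK (W : coefs R) : (forall i, functions_on V (W i)) -> ofF (toF W) = W.
Proof. by move=> WV; apply/funext => i; rewrite /ofF /toF; case: pselect. Qed.
Lemma ofF0 : ofF 0 = 0. Proof. by []. Qed.
Lemma ofFD w w' : ofF (w + w') = ofF w + ofF w'. Proof. by []. Qed.
Lemma ofFB w w' : ofF (w - w') = ofF w - ofF w'. Proof. by []. Qed.
Lemma ofFZ a w : ofF (a *: w) = fscale (val a) (ofF w). Proof. by []. Qed.
Lemma ofF_sum I (r : seq I) (P : pred I) (G : I -> vec) :
  ofF (\sum_(i <- r | P i) G i) = \sum_(i <- r | P i) ofF (G i).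
Proof. exact: (big_morph ofF ofFD ofF0). Qed.

Lemma smoothfn_of (a : fn R) : functions_on V a -> exists b : F, a = val b.
Proof. by move=> Va; exists (mk_smoothfn Va). Qed.

Lemma formsP W : forms V W <-> exists2 w, fin w & W = ofF w.
Proof.
split=> [[WV [N W0]]|[w [N w0] ->]].
  exists (toF W); last by rewrite ofFK.
  exists N => i le_Ni; apply: val_inj.
  by rewrite -[LHS]/(ofF (toF W) i) ofFK // W0.
split=> [i|]; first exact: smoothfnP.
by exists N => i le_Ni; rewrite /ofF w0.
Qed.

Lemma vfieldsP W : vfields V W <-> exists Z, W = ofF Z.
Proof.
split=> [WV|[Z ->] i]; last exact: smoothfnP.
by exists (toF W); rewrite ofFK.
Qed.

Lemma fsbig_nat (u : nat -> R) N : (forall j, (N <= j)%N -> u j = 0) ->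
  \sum_(j \in [set: nat]) u j = \sum_(j < N) u j.
Proof.
move=> u0; apply/esym; rewrite (fsbig_ord _ _ u).
apply: fsbig_widen => // j [_ /=].
by move=> /negP; rewrite -leqNgt => /u0.
Qed.

Lemma val_fsum (u : nat -> F) N x : (forall j, (N <= j)%N -> u j = 0) ->
  val (fsum u) x = \sum_(j < N) val (u j) x.
Proof. by move=> u0; rewrite (fsumE (N := N)) // val_sum fct_sumE. Qed.

Lemma pairing_ofF w Z : fin w -> pairing (ofF w) (ofF Z) = val (pair w Z).
Proof.
move=> [N w0]; apply/funext => x; rewrite /pairing (@fsbig_nat _ N); last first.
  by move=> j /w0 wj; rewrite /ofF wj mul0r.
by rewrite (@val_fsum _ N) // => j /w0 ->; rewrite mul0r.
Qed.

Lemma lie_ofF Z w : fin w -> lie V (ofF Z) (ofF w) = ofF (lieF partials Z w).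
Proof.
move=> [N w0]; apply/funext => i; apply: (@fn_ext _ V) => x Vx.
- exact: zero_ext_out.
- exact: functions_on_out (smoothfnP _) Vx.
rewrite /lie zero_ext_in //.
have [M dM0] := der_fin (w i).
rewrite (@fsbig_nat _ (maxn N M)) => [|j]; last first.
  rewrite geq_max => /andP[/w0 wj /dM0 dj]; rewrite /ofF wj mul0r addr0.
  have -> : pd j (val (w i)) x = 0 by rewrite -(derE j (w i) Vx) (dj : der j (w i) = 0).
  by rewrite mulr0.
rewrite big_split /=; rewrite /ofF /lieF.
have -> : val (act partials Z (w i) + fsum (fun j => w j * der i (Z j))) x =
  val (fsum (fun j => Z j * der j (w i))) x + val (fsum (fun j => w j * der i (Z j))) x
    by [].
rewrite (@val_fsum _ (maxn N M)) => [|j]; last first.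
  by rewrite geq_max => /andP[_ /dM0 ->]; rewrite mulr0.
rewrite (@val_fsum _ (maxn N M)) => [|j]; last first.
  by rewrite geq_max => /andP[/w0 -> _]; rewrite mul0r.
by congr (_ + _); apply: eq_bigr => j _; rewrite -derE.
Qed.
End Bridge.

(** * Filtrations adapted to a frame *)

Lemma common_bound (Q : nat -> nat -> Prop) r :
  (forall i a b, (a <= b)%N -> Q i a -> Q i b) ->
  (forall i, (i < r)%N -> exists a, Q i a) -> exists a, forall i, (i < r)%N -> Q i a.
Proof.
move=> Q_le; elim: r => [|r IHr] Qr; first by exists 0.
have [a Ha] := IHr (fun i lt_ir => Qr i (ltnW lt_ir)).
have [b Hb] := Qr r (ltnSn r); exists (maxn a b) => i.
rewrite ltnS leq_eqVlt => /predU1P[->|/Ha]; last exact/Q_le/leq_maxl.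
by apply: Q_le Hb; apply: leq_maxr.
Qed.

Section Frame.
Variables (F : comPzRingType) (d : derivations F).
Local Notation vec := (nat -> F^o).
Local Notation lie := (lieF d).
Implicit Types (u v w Y Z : vec) (a b : F).
Variables (m : nat -> nat) (f g : nat -> nat -> vec).

(** A basis f l k (k < m l) of the 1-forms, graded by l, with its dual family of
    vector fields g l k; the last field says that the dh^i have finite
    expansions in it.  The intended indexing is that level 0 spans a complement
    of Omega and level l + 1 lifts a basis of M_l = Om l / Om (l - 1), so that
    m l.+1 is the rank of M_l. *)
Record frame : Prop := Frame {
  frame_fin : forall l k, fin (f l k);
  frame_dual : forall l k l' k', (k < m l)%N -> (k' < m l')%N ->
    pair (f l k) (g l' k') = ((l == l') && (k == k'))%:R;
  frame_full : forall i, exists L,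
    unit_form F i = \sum_(l < L) \sum_(k < m l) g l k i *: f l k }.

(** The span of the levels 1, ..., l + 1, that is Om l.  Describing it by the
    vanishing of coordinates, and not by generators, makes membership stable under
    ring morphisms. *)
Definition filt l w : Prop := [/\ fin w,
  forall k, (k < m 0)%N -> pair w (g 0 k) = 0 &
  forall l' k, (l.+1 < l')%N -> (k < m l')%N -> pair w (g l' k) = 0].

Definition filt_pred l w : Prop := if l is l'.+1 then filt l' w else w = 0.

Definition contact w : Prop := fin w /\ forall k, (k < m 0)%N -> pair w (g 0 k) = 0.

Definition annih Z : Prop := forall l k, (k < m l.+1)%N -> pair (f l.+1 k) Z = 0.

Hypothesis Fr : frame.

Lemma fin_lcomb l (c : nat -> F) : fin (\sum_(k < m l) c k *: f l k).
Proof. by apply: fin_sum => k _; apply/finZ/(frame_fin Fr). Qed.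

Lemma pair_comb l (c : nat -> F) l' k' : (k' < m l')%N ->
  pair (\sum_(k < m l) c k *: f l k) (g l' k') = if l == l' then c k' else 0.
Proof.
move=> lt_k'; have ff k : fin (f l k) by apply: (frame_fin Fr).
rewrite pair_suml => [|k _]; last exact: finZ.
have E (k : 'I_(m l)) : pair (c k *: f l k) (g l' k') = c k * ((l == l') && (k == k' :> nat))%:R.
  by rewrite pairZl // (frame_dual Fr).
rewrite (eq_bigr _ (fun k _ => E k)).
case: eqP => [el|_]; last by rewrite big1 // => k _; rewrite mulr0.
have lt_k'' : (k' < m l)%N by rewrite el.
rewrite (bigD1 (Ordinal lt_k'')) //= eqxx mulr1 big1 ?addr0 // => k.
by rewrite -val_eqE /= => /negPf->; rewrite mulr0.
Qed.

Lemma dual_out i : exists L, forall L' l k, (L <= L')%N ->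
  ((L' <= l)%N -> (k < m l)%N -> g l k i = 0) /\
  unit_form F i = \sum_(l < L') \sum_(k < m l) g l k i *: f l k.
Proof.
have [L EL] := frame_full Fr i.
have g0 l k : (L <= l)%N -> (k < m l)%N -> g l k i = 0.
  move=> le_Ll lt_k; rewrite -(pair_unit i (g l k)) EL pair_suml => [|l' _].
    rewrite big1 // => l' _; rewrite (pair_comb l' (fun k => g l' k i)) //.
    by rewrite ltn_eqF // (leq_trans (ltn_ord l')).
  exact: (fin_lcomb l' (fun k => g l' k i)).
exists L => L' l k le_LL'; split=> [le_l lt_k|]; first by rewrite g0 // (leq_trans le_LL').
rewrite EL; apply: esym; rewrite -!(big_mkord xpredT (fun l => \sum_(k < m l) g l k i *: f l k)).
rewrite (@big_cat_nat _ _ _ L) //= [X in _ + X]big1_seq ?addr0 // => l' /andP[_].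
rewrite mem_index_iota => /andP[le_l' _]; rewrite big1 // => k' _.
by rewrite g0 ?scale0r.
Qed.

(** A finite form is a combination of finitely many dh^i, for which a common
    bound on the levels can be chosen. *)
Lemma frame_decomp w : fin w -> exists L,
  (forall l k, (L <= l)%N -> (k < m l)%N -> pair w (g l k) = 0) /\
  w = \sum_(l < L) \sum_(k < m l) pair w (g l k) *: f l k.
Proof.
move=> [N w0].
pose Q i L := forall L' l k, (L <= L')%N -> ((L' <= l)%N -> (k < m l)%N -> g l k i = 0) /\
  unit_form F i = \sum_(l < L') \sum_(k < m l) g l k i *: f l k.
have Q_le (i n1 n2 : nat) : (n1 <= n2)%N -> Q i n1 -> Q i n2.
  by move=> le12 Q1 L' l k le2; apply: Q1; apply: leq_trans le2.
have [L HL] := common_bound Q_le (fun i (_ : (i < N)%N) => dual_out i).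
have fu j : fin (unit_form F j) by apply: fin_unit.
have pwE Z : pair w Z = \sum_(i < N) w i * Z i.
  rewrite {1}(unit_decomp w0) pair_suml => [|j _]; last exact: finZ.
  by apply: eq_bigr => j _; rewrite pairZl // pair_unit.
exists L; split=> [l k le_l lt_k|].
  by rewrite pwE big1 // => i _; rewrite (HL i (ltn_ord i) L l k (leqnn L)).1 // mulr0.
rewrite {1}(unit_decomp w0).
under eq_bigr => i _ do rewrite (HL i (ltn_ord i) L 0%N 0%N (leqnn L)).2 scaler_sumr.
rewrite exchange_big; apply: eq_bigr => l _ /=.
under eq_bigr do rewrite scaler_sumr; rewrite exchange_big; apply: eq_bigr => k _ /=.
rewrite pwE scaler_suml; apply: eq_bigr => i _; exact: scalerA.
Qed.

Lemma filt_fin l w : filt l w -> fin w. Proof. by case. Qed.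
Lemma filt_contact l w : filt l w -> contact w. Proof. by case. Qed.
Lemma filt_leW l l' w : (l <= l')%N -> filt l w -> filt l' w.
Proof.
move=> le_ll [fw w0 wl]; split=> // l1 k lt_l1; apply: wl; exact: leq_trans lt_l1.
Qed.
Lemma filt0 l : filt l 0.
Proof. by split=> *; rewrite ?pair0l //; apply: fin0. Qed.
Lemma filtD l v w : filt l v -> filt l w -> filt l (v + w).
Proof.
move=> [fv v0 vl] [fw w0 wl]; split=> [|k lt_k|l' k lt_l lt_k]; first exact: finD.
  by rewrite pairDl // v0 // w0 // addr0.
by rewrite pairDl // vl // wl // addr0.
Qed.
Lemma filtZ l a w : filt l w -> filt l (a *: w).
Proof.
move=> [fw w0 wl]; split=> [|k lt_k|l' k lt_l lt_k]; first exact: finZ.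
  by rewrite pairZl // w0 // mulr0.
by rewrite pairZl // wl // mulr0.
Qed.
Lemma filtN l w : filt l w -> filt l (- w).
Proof. by rewrite -scaleN1r; apply: filtZ. Qed.
Lemma filtB l v w : filt l v -> filt l w -> filt l (v - w).
Proof. by move=> fv fw; apply: filtD => //; apply: filtN. Qed.
Lemma filt_sum l (I : Type) (r : seq I) (P : pred I) (G : I -> vec) :
  (forall i, P i -> filt l (G i)) -> filt l (\sum_(i <- r | P i) G i).
Proof. by move=> fG; elim/big_ind: _ => //; [apply: filt0|apply: filtD]. Qed.

Lemma filt_frame l k : (k < m l.+1)%N -> filt l (f l.+1 k).
Proof.
move=> lt_k; split=> [|k' lt_k'|l' k' lt_l lt_k']; first exact: (frame_fin Fr).
  by rewrite (frame_dual Fr).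
by rewrite (frame_dual Fr) // ltn_eqF.
Qed.

(** The symbol is the class in M_l, in the coordinates given by the frame; it is
    computed by the duals of level l + 1. *)
Definition symbol l w : 'rV[F]_(m l.+1) := \row_k pair w (g l.+1 k).
Definition unsymbol l (r : 'rV[F]_(m l.+1)) : vec := \sum_k r 0 k *: f l.+1 k.

Lemma filt_unsymbol l r : filt l (@unsymbol l r).
Proof. by apply: filt_sum => k _; apply/filtZ/filt_frame. Qed.

Lemma symbolD l v w : fin v -> fin w -> symbol l (v + w) = symbol l v + symbol l w.
Proof. by move=> fv fw; apply/rowP => k; rewrite !mxE pairDl. Qed.
Lemma symbolZ l a w : fin w -> symbol l (a *: w) = a *: symbol l w.
Proof. by move=> fw; apply/rowP => k; rewrite !mxE pairZl. Qed.
Lemma symbol0 l : symbol l 0 = 0.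
Proof. by apply/rowP => k; rewrite !mxE pair0l. Qed.
Lemma symbolB l v w : fin v -> fin w -> symbol l (v - w) = symbol l v - symbol l w.
Proof.
move=> fv fw; rewrite symbolD //; last exact: finN.
by rewrite -scaleN1r symbolZ // scaleN1r.
Qed.
Lemma symbol_sum l (I : Type) (r : seq I) (P : pred I) (G : I -> vec) :
  (forall i, P i -> fin (G i)) ->
  symbol l (\sum_(i <- r | P i) G i) = \sum_(i <- r | P i) symbol l (G i).
Proof.
by move=> fG; apply/rowP => k; rewrite !mxE pair_suml // summxE; apply: eq_bigr => i _; rewrite mxE.
Qed.

Lemma unsymbolK l r : symbol l (@unsymbol l r) = r.
Proof.
apply/rowP => k; rewrite mxE.
have -> : unsymbol r = \sum_(j < m l.+1) (if insub (j : nat) is Some i then r 0 i else 0) *: f l.+1 j.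
  by apply: eq_bigr => j _; rewrite valK.
rewrite (pair_comb l.+1 (fun j => if insub j is Some i then r 0 i else 0)) //.
by rewrite eqxx valK.
Qed.

Lemma symbol_out l w : filt l w -> symbol l.+1 w = 0.
Proof. by move=> [_ _ wl]; apply/rowP => k; rewrite !mxE wl. Qed.

Lemma filt_predP l w : filt l w -> symbol l w = 0 -> filt_pred l w.
Proof.
move=> [fw w0 wl] s0; have top k : (k < m l.+1)%N -> pair w (g l.+1 k) = 0.
  by move=> lt_k; have /rowP/(_ (Ordinal lt_k)) := s0; rewrite !mxE.
case: l wl s0 top => [|l] wl _ top; last first.
  split=> // l' k; rewrite leq_eqVlt => /predU1P[<-|]; first exact: top.
  exact: wl.
have [L [_ ->]] := frame_decomp fw; rewrite big1 // => l _; rewrite big1 // => k _.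
have -> : pair w (g l k) = 0; last exact: scale0r.
by case: l k => -[|[|l]] /= _ k; [apply: w0|apply: top|apply: wl].
Qed.

Lemma filt_pred_sub l w : filt_pred l w -> filt l w.
Proof. by case: l => [->|l]; [apply: filt0|apply: filt_leW]. Qed.

Lemma symbol_pred l w : filt_pred l w -> symbol l w = 0.
Proof. by case: l => [->|l /symbol_out]; [apply: symbol0|]. Qed.

Lemma filt_rest l w : filt l w -> filt_pred l (w - unsymbol (symbol l w)).
Proof.
move=> wl; apply: filt_predP; first exact/filtB/filt_unsymbol.
rewrite symbolB ?unsymbolK ?subrr //; [exact: filt_fin wl|exact/filt_fin/filt_unsymbol].
Qed.

(** Induction on forms of the filtration: peeling off symbols reduces a property
    to the multiples of the elements of the frame. *)
Lemma filt_ind (P : vec -> Prop) :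
  P 0 -> (forall v w, fin v -> fin w -> P v -> P w -> P (v + w)) ->
  (forall l a k, (k < m l.+1)%N -> P (a *: f l.+1 k)) ->
  forall l w, filt l w -> P w.
Proof.
move=> P0 PD Pf; have top l r : P (@unsymbol l r).
  have : fin (unsymbol r) /\ P (unsymbol r); last by case.
  rewrite /unsymbol; elim/big_ind: _ => [|v w [fv Pv] [fw Pw]|k _].
  - by split; first exact: fin0.
  - by split; [apply: finD|apply: PD].
  - by split; [apply/finZ/(frame_fin Fr)|apply: Pf].
have step l w : filt l w -> P (w - unsymbol (symbol l w)) -> P w.
  move=> fw Pw; rewrite -(subrK (unsymbol (symbol l w)) w); apply: PD => //.
    by apply: finB; [apply: filt_fin fw|apply/filt_fin/filt_unsymbol].
  exact/filt_fin/filt_unsymbol.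
elim=> [|l IHl] w fw; apply: (step _ _ fw); have := filt_rest fw; first by move=> /= ->.
exact: IHl.
Qed.

Lemma contact_filt w : contact w -> exists l, filt l w.
Proof.
move=> [fw w0]; have [L [wL _]] := frame_decomp fw.
by exists L; split=> // l k lt_l; apply: wL; apply: ltnW; apply: ltnW.
Qed.

Lemma annih_contact Z w : annih Z -> contact w -> pair w Z = 0.
Proof.
move=> aZ /contact_filt[l]; apply: (filt_ind (P := fun w => pair w Z = 0)) => {w l}.
- exact: pair0l.
- by move=> v w fv fw v0 w0; rewrite pairDl // v0 w0 addr0.
- by move=> l a k lt_k; rewrite pairZl ?aZ ?mulr0 //; apply: (frame_fin Fr).
Qed.

(** The annihilator of Omega is the span of the duals of a complement: a field
    that vanishes on all levels but 0 is determined by its values on level 0,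
    infinite sums being harmless because each dh^i has a finite expansion. *)
Lemma annih_decomp Z : annih Z -> Z = \sum_(j < m 0) pair (f 0 j) Z *: g 0 j.
Proof.
move=> aZ; apply/funext => i; rewrite fct_sumE.
rewrite -{1}(pair_unit i Z).
have [L HL] := dual_out i; have [_ ->] := HL L.+1 0%N 0%N (leqnSn L).
have fs l : fin (\sum_(k < m l) g l k i *: f l k) := fin_lcomb l (fun k => g l k i).
have ff l k := frame_fin Fr l k.
rewrite pair_suml => [|l _]; last exact: fs.
rewrite big_ord_recl [X in _ + X]big1 ?addr0 => [|l _].
  rewrite pair_suml => [|k _]; last exact: finZ.
  by apply: eq_bigr => k _; rewrite pairZl // mulrC.
rewrite pair_suml => [|k _]; last exact: finZ.
by rewrite big1 // => k _; rewrite pairZl // aZ ?mulr0.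
Qed.

Lemma annih_dual j : (j < m 0)%N -> annih (g 0 j).
Proof. by move=> lt_j l k lt_k; rewrite (frame_dual Fr). Qed.
Lemma annih0 : annih 0.
Proof. by move=> l k _; apply: pair0r. Qed.
Lemma annihD Y Z : annih Y -> annih Z -> annih (Y + Z).
Proof. by move=> aY aZ l k lt_k; rewrite pairDr ?aY ?aZ ?addr0 //; apply: (frame_fin Fr). Qed.
Lemma annihZ a Z : annih Z -> annih (a *: Z).
Proof. by move=> aZ l k lt_k; rewrite pairZr ?aZ ?mulr0 //; apply: (frame_fin Fr). Qed.

(** The basis of the annihilator, extended by 0 to all indices so that families
    of matrices can be indexed by natural numbers. *)
Definition base_field j : vec := if (j < m 0)%N then g 0 j else 0.
Lemma annih_base j : annih (base_field j).
Proof. by rewrite /base_field; case: ifP => [/annih_dual|_]; last exact: annih0. Qed.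

Hypothesis lie_frame : forall l j k, (j < m 0)%N -> (k < m l.+1)%N ->
  filt l.+1 (lie (g 0 j) (f l.+1 k)).

(** The inclusion is only assumed on the frame and the dual fields.  It extends
    to all forms because the error terms act Z a *: f of the Leibniz rule stay
    in the filtration, and to all fields by [lieF_scalel]. *)
Lemma lie_filt l Z w : annih Z -> filt l w -> filt l.+1 (lie Z w).
Proof.
move=> aZ; have lie_f l' k : (k < m l'.+1)%N -> filt l'.+1 (lie Z (f l'.+1 k)).
  move=> lt_k; have ff := frame_fin Fr l'.+1 k.
  rewrite (annih_decomp aZ) lieF_suml //; apply: filt_sum => j _.
  rewrite lieF_scalel // annih_dual // scale0r addr0.
  exact/filtZ/lie_frame.
have lie_top l' r : filt l'.+1 (lie Z (@unsymbol l' r)).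
  rewrite /unsymbol (lieF_comb d Z _ (fun k : 'I__ => r 0 k)); last first.
    by move=> k; apply: (frame_fin Fr).
  apply: filt_sum => k _; apply: filtD; first exact/filtZ/lie_f.
  by apply/filtZ/(filt_leW (leqnSn _))/filt_frame.
have step l' v : filt l' v -> filt l'.+1 (lie Z (v - unsymbol (symbol l' v))) ->
    filt l'.+1 (lie Z v).
  move=> fv fl; rewrite -(subrK (unsymbol (symbol l' v)) v).
  rewrite lieFD; [exact: filtD|apply: finB|]; last exact/filt_fin/filt_unsymbol.
    exact: filt_fin fv.
  exact/filt_fin/filt_unsymbol.
elim: l w => [|l IHl] w fw; apply: (step _ _ fw).
  by rewrite (filt_rest fw : _ = 0) lieF0; apply: filt0.
by apply: (filt_leW (leqnSn _)); apply/IHl/(filt_rest fw).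
Qed.

Lemma lie_contact Z w : annih Z -> contact w -> contact (lie Z w).
Proof. by move=> aZ /contact_filt[l /(lie_filt aZ)/filt_contact]. Qed.

(** Involutivity of the annihilator: Omega is stable under Lie derivatives along
    it, and the Leibniz rule [act_pair] transfers this to brackets. *)
Lemma annih_bracket Y Z : annih Y -> annih Z -> annih (bracket d Y Z).
Proof.
move=> aY aZ l k lt_k; have ff := frame_fin Fr l.+1 k.
have tf := filt_contact (filt_frame lt_k).
have := act_pair d Y Z ff.
rewrite aZ // act0 (annih_contact aZ (lie_contact aY tf)) add0r => <-.
by [].
Qed.

(** The matrix of the multiplication Z : M_l -> M_(l+1) on row vectors. *)
Definition mult_mx Z l : 'M[F]_(m l.+1, m l.+2) :=
  \matrix_(i, k) pair (lie Z (f l.+1 i)) (g l.+2 k).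

Lemma row_mult_mx Z l i : row i (mult_mx Z l) = symbol l.+1 (lie Z (f l.+1 i)).
Proof. by apply/rowP => k; rewrite !mxE. Qed.

(** The action on symbols is linear over functions: the terms of the Leibniz
    rule in which a coefficient is differentiated do not raise the level. *)
Lemma symbol_lie Z l w : annih Z -> filt l w ->
  symbol l.+1 (lie Z w) = symbol l w *m mult_mx Z l.
Proof.
move=> aZ fw; rewrite -{1}(subrK (unsymbol (symbol l w)) w).
have fr := filt_rest fw; have fu := filt_unsymbol (symbol l w).
have fin_r : fin (w - unsymbol (symbol l w)).
  by apply: finB; [exact: filt_fin fw|exact: filt_fin fu].
rewrite lieFD //; last exact: filt_fin fu.
rewrite symbolD; [|exact/fin_lieF|]; last first.
  exact/fin_lieF/(filt_fin fu).
rewrite (_ : symbol l.+1 (lie Z (w - _)) = 0) ?add0r; last first.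
  case: l w fw fr {fu fin_r} => [|l] w fw /= fr.
    by rewrite fr lieF0 symbol0.
  exact/symbol_out/lie_filt.
have ff (k : 'I_(m l.+1)) : fin (f l.+1 k) := frame_fin Fr l.+1 k.
rewrite {1}/unsymbol (lieF_comb d Z _ (fun k : 'I__ => symbol l w 0 k)) //.
have fl k : fin (lie Z (f l.+1 k)) by apply/fin_lieF/(frame_fin Fr).
rewrite symbol_sum => [|k _]; last by apply: finD; apply: finZ.
rewrite mulmx_sum_row; apply: eq_bigr => k _.
rewrite symbolD; [|exact: finZ|exact: finZ].
rewrite !symbolZ // row_mult_mx (symbol_out (filt_frame _)) //.
by rewrite scaler0 addr0.
Qed.

(** The difference of the two products is the symbol of the Lie derivative along
    the bracket, which belongs to the annihilator and raises the level by one
    only. *)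
Lemma mult_mxC Y Z l : annih Y -> annih Z ->
  mult_mx Y l *m mult_mx Z l.+1 = mult_mx Z l *m mult_mx Y l.+1.
Proof.
move=> aY aZ; apply/row_matrixP => i; rewrite !row_mul !row_mult_mx.
have ffilt : filt l (f l.+1 i) by apply: filt_frame.
have ff := frame_fin Fr l.+1 i.
have ffl X : fin (lie X (f l.+1 i)) by apply: fin_lieF.
rewrite -!symbol_lie //; try exact: lie_filt.
apply/eqP; rewrite -subr_eq0 -symbolB; try exact: fin_lieF.
rewrite -lieF_bracket //; apply/eqP/symbol_out/lie_filt => //.
exact: annih_bracket.
Qed.

Lemma mult_mx_comb n (a : nat -> F) (Z : nat -> vec) l : (forall j, annih (Z j)) ->
  mult_mx (\sum_(j < n) a j *: Z j) l = \sum_(j < n) a j *: mult_mx (Z j) l.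
Proof.
move=> aZ; apply/matrixP => i k; rewrite !mxE summxE.
have ff := frame_fin Fr l.+1 i.
have fl X : fin (lie X (f l.+1 i)) by apply: fin_lieF.
rewrite lieF_suml //.
rewrite (eq_bigr (fun j : 'I_n => a j *: lie (Z j) (f l.+1 i))); last first.
  by move=> j _; rewrite lieF_scalel // aZ // scale0r addr0.
rewrite pair_suml => [|j _]; last exact: finZ.
by apply: eq_bigr => j _; rewrite pairZl // !mxE.
Qed.

Variable l0 : nat.
Hypothesis frame_gen : forall l k, (l0 <= l)%N -> (k < m l.+2)%N ->
  exists2 u : nat -> vec, forall j, filt l (u j) &
    filt l (f l.+2 k - \sum_(j < m 0) lie (g 0 j) (u j)).

(** The condition Om l + L_H (Om l) = Om (l + 1) read on symbols: in degrees at
    least l0 the graded module is generated by its component of degree l0. *)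
Lemma mult_mx_gen l (r : 'rV[F]_(m l.+2)) : (l0 <= l)%N ->
  exists u : nat -> 'rV[F]_(m l.+1), r = \sum_(j < m 0) u j *m mult_mx (base_field j) l.
Proof.
move=> le_l; have row_gen (k : 'I_(m l.+2)) : exists u : nat -> 'rV[F]_(m l.+1),
    delta_mx 0 k = \sum_(j < m 0) u j *m mult_mx (base_field j) l.
  have [u fu fr] := frame_gen le_l (ltn_ord k).
  exists (fun j => symbol l (u j)).
  have fin_l (j : 'I_(m 0)) : fin (lie (g 0 j) (u j)).
    by apply/fin_lieF/(filt_fin (fu j)).
  have fs : fin (\sum_(j < m 0) lie (g 0 j) (u j)) by apply: fin_sum.
  transitivity (symbol l.+1 (f l.+2 k)).
    apply/rowP => i; rewrite !mxE (frame_dual Fr) // !eqxx /= [i == k]eq_sym.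
    by rewrite val_eqE.
  have := symbol_out fr; rewrite symbolB => [/subr0_eq->||] //; last exact: (frame_fin Fr).
  rewrite symbol_sum //; apply: eq_bigr => j _; rewrite /base_field ltn_ord.
  by rewrite symbol_lie //; apply: annih_dual.
have /fin_all_exists[u Hu] := row_gen.
exists (fun j => \sum_k r 0 k *: u k j).
rewrite [LHS]row_sum_delta; under eq_bigr do rewrite Hu scaler_sumr.
rewrite exchange_big; apply: eq_bigr => j _ /=; rewrite mulmx_suml.
by apply: eq_bigr => k _; rewrite scalemxAl.
Qed.

(** Conversely the generation of symbols gives back the condition on the
    filtration, for all its elements and not only for the frame. *)
Lemma filt_gen l w : (l0 <= l)%N -> filt l.+1 w ->
  exists2 u : nat -> vec, forall j, filt l (u j) &
    filt l (w - \sum_(j < m 0) lie (g 0 j) (u j)).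
Proof.
move=> le_l fw; have [u Hu] := mult_mx_gen (symbol l.+1 w) le_l.
exists (fun j => unsymbol (u j)) => [j|]; first exact: filt_unsymbol.
have fl (j : 'I_(m 0)) : filt l.+1 (lie (g 0 j) (unsymbol (u j))).
  by apply: lie_filt; [apply: annih_dual|apply: filt_unsymbol].
have fs : filt l.+1 (\sum_(j < m 0) lie (g 0 j) (unsymbol (u j))) by apply: filt_sum.
apply: (@filt_predP l.+1); first exact: filtB.
rewrite symbolB; [|exact: filt_fin fw|exact: filt_fin fs].
apply/eqP; rewrite subr_eq0 Hu symbol_sum => [|j _]; last exact: filt_fin (fl j).
apply/eqP/eq_bigr => j _; rewrite symbol_lie; [|exact: annih_dual|exact: filt_unsymbol].
by rewrite unsymbolK /base_field ltn_ord.
Qed.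
End Frame.

(** * Restriction and evaluation of frames *)

Section FrameMorphism.
Variables (F G : comPzRingType) (d : derivations F) (e : derivations G).
Variable rho : {rmorphism F -> G}.
Hypothesis rho_d : forall i a, rho (d i a) = e i (rho a).

Definition map_vec (w : nat -> F^o) : nat -> G^o := fun i => rho (w i).
Local Notation rv := map_vec.

Lemma map_vec_fin w : fin w -> fin (rv w).
Proof. by move=> [N w0]; exists N => j /w0 e0; rewrite /rv e0 rmorph0. Qed.

Lemma map_vecB v w : rv (v - w) = rv v - rv w.
Proof. by apply/funext => i; rewrite /rv !fctE rmorphB. Qed.

Lemma map_vec_sum I (r : seq I) (P : pred I) (H : I -> nat -> F^o) :
  rv (\sum_(i <- r | P i) H i) = \sum_(i <- r | P i) rv (H i).
Proof.
by apply/funext => j; rewrite /rv !fct_sumE rmorph_sum.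
Qed.

Lemma map_vecZ a w : rv (a *: w) = rho a *: rv w.
Proof. by apply/funext => j; apply: rmorphM. Qed.

Lemma rho_fsum u : fin u -> rho (fsum u) = fsum (rv u).
Proof.
move=> [N u0]; rewrite (fsumE u0) rmorph_sum (@fsumE _ _ N) // => j /u0 e0.
by rewrite /rv e0 rmorph0.
Qed.

Lemma rho_pair w Z : fin w -> pair (rv w) (rv Z) = rho (pair w Z).
Proof.
move=> fw; rewrite [in RHS]/pair rho_fsum; last exact: finMr.
by apply: eq_fsum => j; rewrite /rv rmorphM.
Qed.

Lemma rho_act Z a : act e (rv Z) (rho a) = rho (act d Z a).
Proof.
rewrite [in RHS]/act rho_fsum; last exact: act_fin.
by apply: eq_fsum => j; rewrite /rv rmorphM rho_d.
Qed.

Lemma map_vec_lie Z w : fin w -> lieF e (rv Z) (rv w) = rv (lieF d Z w).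
Proof.
move=> fw; apply/funext => i.
have -> : rv (lieF d Z w) i = rho (act d Z (w i) + fsum (fun j => w j * d i (Z j))) by [].
rewrite rmorphD -rho_act; congr (_ + _); rewrite rho_fsum; last exact: finMr.
by apply: eq_fsum => j; rewrite /rv rmorphM rho_d.
Qed.

Variables (m : nat -> nat) (f g : nat -> nat -> nat -> F^o).
Hypothesis Fr : frame m f g.
Local Notation rf := (fun l k => rv (f l k)).
Local Notation rg := (fun l k => rv (g l k)).

(** Duality and the expansions of the dh^i are identities in the ring, so that
    frames restrict to smaller open sets. *)
Lemma map_frame : frame m rf rg.
Proof.
split.
- by move=> l k; apply/map_vec_fin/(frame_fin Fr).
- move=> l k l' k' lt_k lt_k'; rewrite rho_pair ?(frame_dual Fr) ?rmorph_nat //.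
  exact: frame_fin Fr _ _.
move=> i; have [L EL] := frame_full Fr i; exists L.
have -> : unit_form G i = rv (unit_form F i).
  by apply/funext => j; rewrite /rv /unit_form rmorph_nat.
rewrite EL map_vec_sum; apply: eq_bigr => l _; rewrite map_vec_sum.
by apply: eq_bigr => k _; rewrite map_vecZ.
Qed.

Lemma map_filt l w : filt m g l w -> filt m rg l (rv w).
Proof.
move=> [fw w0 wl]; split; first exact: map_vec_fin.
  by move=> k lt_k; rewrite rho_pair // w0 // rmorph0.
by move=> l' k lt_l lt_k; rewrite rho_pair // wl // rmorph0.
Qed.

Lemma map_lie_frame :
  (forall l j k, (j < m 0)%N -> (k < m l.+1)%N ->
    filt m g l.+1 (lieF d (g 0 j) (f l.+1 k))) ->
  forall l j k, (j < m 0)%N -> (k < m l.+1)%N ->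
    filt m rg l.+1 (lieF e (rg 0 j) (rf l.+1 k)).
Proof.
move=> lie_f l j k lt_j lt_k; rewrite map_vec_lie; last exact: frame_fin Fr _ _.
exact/map_filt/lie_f.
Qed.

Lemma map_frame_gen l0 :
  (forall l k, (l0 <= l)%N -> (k < m l.+2)%N ->
    exists2 u : nat -> nat -> F^o, forall j, filt m g l (u j) &
    filt m g l (f l.+2 k - \sum_(j < m 0) lieF d (g 0 j) (u j))) ->
  forall l k, (l0 <= l)%N -> (k < m l.+2)%N ->
    exists2 u : nat -> nat -> G^o, forall j, filt m rg l (u j) &
    filt m rg l (rf l.+2 k - \sum_(j < m 0) lieF e (rg 0 j) (u j)).
Proof.
move=> gen l k le_l lt_k; have [u fu fr] := gen l k le_l lt_k.
exists (fun j => rv (u j)) => [j|]; first exact/map_filt.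
have -> : \sum_(j < m 0) lieF e (rg 0 j) (rv (u j)) =
    rv (\sum_(j < m 0) lieF d (g 0 j) (u j)).
  rewrite map_vec_sum; apply: eq_bigr => j _.
  by rewrite map_vec_lie //; apply: filt_fin (fu j).
by rewrite -map_vecB; apply: map_filt.
Qed.

Lemma map_base_field j : base_field m rg j = rv (base_field m g j).
Proof.
by rewrite /base_field; case: ifP => // _; apply/funext => i; rewrite /rv rmorph0.
Qed.

Lemma map_mult_mx Z l :
  mult_mx e m rf rg (rv Z) l = map_mx rho (mult_mx d m f g Z l).
Proof.
apply/matrixP => i k; rewrite !mxE map_vec_lie; last exact: frame_fin Fr _ _.
by rewrite rho_pair //; apply/fin_lieF/(frame_fin Fr).
Qed.
End FrameMorphism.

Section Restriction.
Context {R : realType}.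
Variables U V : open_set R.
Hypothesis VU : carrier V `<=` carrier U.

(** The inclusion is an argument because the ring morphism structure depends on
    it; likewise for the point of evaluation below. *)
Definition restr_fn (sVU : carrier V `<=` carrier U) (a : smoothfn U) : smoothfn V :=
  mk_smoothfn (functions_on_restr (carrier_open V) sVU (smoothfnP a)).
Local Notation rho := (restr_fn VU).

Lemma restr_fnE a x : carrier V x -> val (rho a) x = val a x.
Proof. exact: zero_ext_in. Qed.

Fact restr_fn_additive : zmod_morphism rho.
Proof.
move=> a b; apply: smoothfn_ext => x Vx; rewrite restr_fnE //.
have -> : val (rho a - rho b) x = val (rho a) x - val (rho b) x by [].
by rewrite !restr_fnE.
Qed.
HB.instance Definition _ :=
  GRing.isZmodMorphism.Build (smoothfn U) (smoothfn V) rho restr_fn_additive.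

Fact restr_fn_multiplicative : monoid_morphism rho.
Proof.
split=> [|a b]; apply: smoothfn_ext => x Vx; rewrite restr_fnE //.
  by rewrite /= !zero_ext_in //; apply: VU.
have -> : val (rho a * rho b) x = val (rho a) x * val (rho b) x by [].
by rewrite !restr_fnE.
Qed.
HB.instance Definition _ :=
  GRing.isMonoidMorphism.Build (smoothfn U) (smoothfn V) rho restr_fn_multiplicative.

Lemma restr_fn_der i a : rho (partials U i a) = partials V i (rho a).
Proof.
apply: smoothfn_ext => x Vx; rewrite restr_fnE //.
rewrite [LHS](derE i a (VU Vx)) [RHS](derE i (rho a) Vx).
apply: (pd_eq_on (carrier_open V)) => // y Vy.
by rewrite restr_fnE.
Qed.

Lemma restr_ofF w : restr V (ofF w) = ofF (map_vec rho w).
Proof. by []. Qed.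
End Restriction.

Section Evaluation.
Context {R : realType}.
Variables (U : open_set R) (P : pt R).
Hypothesis PU : carrier U P.

Definition eval_at (_ : carrier U P) : smoothfn U -> R := @ev R U P.
Local Notation evP := (eval_at PU).
Fact eval_additive : zmod_morphism evP. Proof. by []. Qed.
HB.instance Definition _ :=
  GRing.isZmodMorphism.Build (smoothfn U) R evP eval_additive.
Fact eval_multiplicative : monoid_morphism evP.
Proof. by split=> //; apply: ev1. Qed.
HB.instance Definition _ :=
  GRing.isMonoidMorphism.Build (smoothfn U) R evP eval_multiplicative.

End Evaluation.

(** * The frame of a good filtration *)

Section DualFrame.
Variables (F : comPzRingType) (m : nat -> nat) (f : nat -> nat -> nat -> F^o).
Local Notation vec := (nat -> F^o).
Definition level_comb (c : nat -> nat -> F) l : vec := \sum_(k < m l) c l k *: f l k.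
Hypothesis f_fin : forall l k, fin (f l k).
Hypothesis f_free : forall L c, \sum_(l < L) level_comb c l = 0 ->
  forall l k, (l < L)%N -> (k < m l)%N -> c l k = 0.
Hypothesis f_span : forall i, exists L c, unit_form F i = \sum_(l < L) level_comb c l.

Lemma level_comb_trunc c L L' : (L <= L')%N ->
  \sum_(l < L') level_comb (fun l k => if (l < L)%N then c l k else 0) l
  = \sum_(l < L) level_comb c l.
Proof.
move=> le_LL'; set c' := (X in level_comb X).
rewrite -(big_mkord xpredT (level_comb c')) -(big_mkord xpredT (level_comb c)).
rewrite (@big_cat_nat _ _ _ L) //=.
rewrite [X in _ + X]big1_seq ?addr0 => [|l /andP[_]]; last first.
  rewrite mem_index_iota => /andP[le_Ll _]; rewrite /level_comb big1 // => k _.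
  by rewrite /c' ltnNge le_Ll scale0r.
apply: eq_big_nat => l /= lt_lL; apply: eq_bigr => k _; by rewrite /c' lt_lL.
Qed.

(** The i-th component of the dual field g l k is the coefficient of f l k in the
    expansion of dh^i; duality is then the uniqueness of the expansion of f l k. *)
Lemma dual_frame : exists g, frame m f g.
Proof.
have /choice[Lc HLc] : forall i, exists p : nat * (nat -> nat -> F),
    (forall l k, (p.1 <= l)%N -> p.2 l k = 0) /\
    unit_form F i = \sum_(l < p.1) level_comb p.2 l.
  move=> i; have [L [c Ec]] := f_span i.
  exists (L, fun l k => if (l < L)%N then c l k else 0); split=> /= [l k le_l|].
    by rewrite ltnNge le_l.
  by rewrite level_comb_trunc.
pose g l k : vec := fun i => (Lc i).2 l k.
have full i : unit_form F i = \sum_(l < (Lc i).1) level_comb (fun l k => g l k i) l.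
  exact: (HLc i).2.
have full_le i L : ((Lc i).1 <= L)%N ->
    unit_form F i = \sum_(l < L) level_comb (fun l k => g l k i) l.
  move=> le_L; rewrite full -(level_comb_trunc _ le_L); apply: eq_bigr => l _.
  apply: eq_bigr => k _; case: ltnP => // le_l.
  by rewrite /g (HLc i).1.
exists g; split=> //; last by move=> i; exists (Lc i).1; apply: full.
move=> l k l' k' lt_k lt_k'; have [N fN] := f_fin l k.
have pE Z : pair (f l k) Z = \sum_(i < N) f l k i * Z i.
  by apply: fsumE => j /fN ->; rewrite mul0r.
pose L := maxn (maxn l.+1 l'.+1) (\max_(i < N) (Lc i).1).
have le_iL (i : 'I_N) : ((Lc i).1 <= L)%N.
  by rewrite leq_max (leq_bigmax i) orbT.
have lt_lL : (l < L)%N by rewrite /L !leq_max leqnn.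
have lt_l'L : (l' < L)%N by rewrite /L !leq_max leqnn orbT.
pose c l1 k1 := pair (f l k) (g l1 k1) - ((l == l1) && (k == k1))%:R.
suff /f_free/(_ l' k' lt_l'L lt_k')/subr0_eq : \sum_(l1 < L) level_comb c l1 = 0 by [].
have -> : \sum_(l1 < L) level_comb c l1 =
    \sum_(l1 < L) level_comb (fun l1 k1 => pair (f l k) (g l1 k1)) l1
    - \sum_(l1 < L) level_comb (fun l1 k1 => ((l == l1) && (k == k1))%:R) l1.
  rewrite -sumrB; apply: eq_bigr => l1 _; rewrite -sumrB; apply: eq_bigr => k1 _.
  by rewrite -scalerBl.
apply/eqP; rewrite subr_eq0; apply/eqP; transitivity (f l k).
  rewrite [in RHS](unit_decomp fN).
  under [RHS]eq_bigr => i _ do rewrite (full_le i L (le_iL i)) scaler_sumr.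
  rewrite exchange_big; apply: eq_bigr => l1 _ /=.
  under [RHS]eq_bigr do rewrite scaler_sumr; rewrite exchange_big; apply: eq_bigr => k1 _ /=.
  rewrite pE scaler_suml; apply: eq_bigr => i _; exact/esym/scalerA.
rewrite (bigD1 (Ordinal lt_lL)) //= [X in _ + X]big1 => [|l1 nl]; last first.
  rewrite /level_comb big1 // => k1 _; move: nl; rewrite -val_eqE /= eq_sym => /negPf->.
  by rewrite scale0r.
rewrite addr0 /level_comb (bigD1 (Ordinal lt_k)) //= !eqxx scale1r big1 ?addr0 //.
by move=> k1; rewrite -val_eqE /= eq_sym => /negPf->; rewrite ?andbF scale0r.
Qed.
End DualFrame.

Section Build.
Context {R : realType}.
Variable U : open_set R.
Local Notation F := (smoothfn U).
Local Notation vec := (nat -> F^o).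
Implicit Types v w Z : vec.

Lemma submodule_fin W w : submodule U W -> W (ofF w) -> fin w.
Proof. by case=> Wf _ _ _ /Wf/formsP[w' fw' /ofF_inj ->]. Qed.
Lemma submodule0 W : submodule U W -> W (ofF (0 : vec)). Proof. by case. Qed.
Lemma submoduleD W (v w : vec) : submodule U W -> W (ofF v) -> W (ofF w) -> W (ofF (v + w)).
Proof. by case=> _ _ WD _; apply: WD. Qed.
Lemma submoduleZ W a (w : vec) : submodule U W -> W (ofF w) -> W (ofF (a *: w)).
Proof. by case=> _ _ _ WZ; apply: WZ; apply: smoothfnP. Qed.
Lemma submoduleN W (w : vec) : submodule U W -> W (ofF w) -> W (ofF (- w)).
Proof. by rewrite -scaleN1r; apply: submoduleZ. Qed.
Lemma submodule_sum W I (r : seq I) (P : pred I) (G : I -> vec) : submodule U W ->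
  (forall i, P i -> W (ofF (G i))) -> W (ofF (\sum_(i <- r | P i) G i)).
Proof.
move=> sW WG; elim/big_ind: _ => //; first exact: submodule0.
by move=> v w; apply: submoduleD.
Qed.

Lemma submodule_zero : submodule U [set 0].
Proof.
split=> //.
- by move=> _ ->; apply/formsP; exists 0; first exact: fin0.
- by move=> _ _ -> ->; rewrite /set1 /= addr0.
- by move=> a _ _ ->; apply/funext => i; apply: mulr0.
Qed.

(** A submodule contains all combinations of the frame elements in it; together
    with the definition of filt by coordinates this identifies generated modules. *)
Lemma filt_in_submodule m f g W l w : frame m f g -> submodule U W ->
  (forall l' k, (l' <= l)%N -> (k < m l'.+1)%N -> W (ofF (f l'.+1 k))) ->
  filt m g l w -> W (ofF w).
Proof.
move=> Fr sW Wf [fw w0 wl]; have [L [_ ->]] := frame_decomp Fr fw.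
apply: submodule_sum => // -[[|l'] lt_l'] _ /=; apply: submodule_sum => // k _.
  by rewrite w0 // scale0r; apply: submodule0.
have [le_l'l|lt_ll'] := leqP l' l; first by apply: submoduleZ => //; apply: Wf.
by rewrite wl // scale0r; apply: submodule0.
Qed.

(** A basis of a quotient, with lifts and coefficients in the ring of functions
    and indices in nat; indices beyond the rank get the value 0. *)
Lemma basis_vec W W' k : (forall w : coefs R, W w -> forms U w) ->
  (exists e : 'I_k -> coefs R, basis_mod U W W' e) -> exists e : nat -> vec,
  [/\ forall i, fin (e i) /\ ((i < k)%N -> W (ofF (e i))),
      forall w, W (ofF w) -> exists a : nat -> F, W' (ofF (w - \sum_(i < k) a i *: e i)) &
      forall a : nat -> F, W' (ofF (\sum_(i < k) a i *: e i)) ->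
        forall i, (i < k)%N -> a i = 0].
Proof.
move=> Wf [e [We e_span e_free]].
have /choice[e1 He1] i : exists v : vec, fin v /\ e i = ofF v.
  by have /Wf/formsP[v fv ->] := We i; exists v.
pose e2 i : vec := if insub i is Some j then e1 j else 0.
have e2E (i : 'I_k) : e2 i = e1 i by rewrite /e2 valK.
have comb (a : nat -> F) : ofF (\sum_(i < k) a i *: e2 i) =
    \sum_(i < k) fscale (val (a i)) (e i).
  rewrite ofF_sum; apply: eq_bigr => i _; rewrite e2E ofFZ.
  by have [_ ->] := He1 i.
exists e2; split.
- move=> i; split; first by rewrite /e2; case: insub => [j|]; [have [] := He1 j|apply: fin0].
  by move=> lt_ik; rewrite -[i]/(val (Ordinal lt_ik)) e2E; have [_ <-] := He1 (Ordinal lt_ik).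
- move=> w /e_span[a Ua Wa].
  pose a' i : F := if insub i is Some j then mk_smoothfn (Ua j) else 0.
  exists a'; rewrite ofFB (comb a') /a'; move: Wa; congr (W' (_ - _)); apply: eq_bigr => i _.
  by rewrite valK.
move=> a; rewrite comb => /e_free a0 i lt_ik; apply: val_inj.
by apply: (a0 _ (Ordinal lt_ik)) => j; apply: smoothfnP.
Qed.

Variables (n : nat) (Omega : set (coefs R)) (Om : nat -> set (coefs R)).
Hypotheses (Omega_sub : submodule U Omega) (Omega_codim : codim U Omega n)
  (Om_good : good_filtration U Omega Om)
  (M_bases : forall l, finite_rank_mod U (Om l) (pred_filt Om l)).

Let Om_sub l : submodule U (Om l). Proof. by have [/(_ l)[]] := Om_good. Qed.
Let Om_fin l w : Om l (ofF w) -> fin w. Proof. exact: submodule_fin. Qed.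

Lemma Om_le l l' : (l <= l')%N -> Om l `<=` Om l'.
Proof.
have [_ Om_incr _ _ _] := Om_good; move=> /subnK <-; elim: (l' - l)%N => // d IHd.
by rewrite addSn; apply: subset_trans IHd (Om_incr _).
Qed.

Lemma pred_filt_sub l : submodule U (pred_filt Om l).
Proof. by case: l => [|l]; [apply: submodule_zero|apply: Om_sub]. Qed.

Lemma pred_filt0 w : pred_filt Om 0 (ofF w) -> w = 0.
Proof. by move=> w0; apply: ofF_inj. Qed.

(** The module that level l of the frame belongs to, and the submodule modulo
    which it is a basis: all forms modulo Omega for l = 0, then Om l' modulo
    Om (l' - 1) for l = l' + 1. *)
Definition in_level (w : vec) l : Prop :=
  if l is l'.+1 then Om l' (ofF w) else fin w.
Definition below (w : vec) l : Prop :=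
  if l is l'.+1 then pred_filt Om l' (ofF w) else Omega (ofF w).

Lemma graded_bases : exists (m : nat -> nat) (f : nat -> nat -> vec), [/\ m 0%N = n,
  forall l k, fin (f l k) /\ ((k < m l)%N -> in_level (f l k) l),
  forall l w, in_level w l -> exists a : nat -> F,
    below (w - \sum_(k < m l) a k *: f l k) l &
  forall l (a : nat -> F), below (\sum_(k < m l) a k *: f l k) l ->
    forall k, (k < m l)%N -> a k = 0].
Proof.
have base l : exists p : nat * (nat -> vec), [/\ l = 0%N -> p.1 = n,
    forall k, fin (p.2 k) /\ ((k < p.1)%N -> in_level (p.2 k) l),
    forall w, in_level w l -> exists a : nat -> F,
      below (w - \sum_(k < p.1) a k *: p.2 k) l &
    forall (a : nat -> F), below (\sum_(k < p.1) a k *: p.2 k) l ->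
      forall k, (k < p.1)%N -> a k = 0].
  case: l => [|l].
    have [|e [He1 He2 He3]] := basis_vec _ Omega_codim => //.
    exists (n, e); split=> // [k|w fw]; first by have [fe _] := He1 k.
    by apply/He2/formsP; exists w.
  have [k Hk] := M_bases l.
  have [|e [He1 He2 He3]] := basis_vec _ Hk; first by have [Wf _ _ _] := Om_sub l.
  by exists (k, e).
have {base} /choice[p Hp] := base.
exists (fun l => (p l).1), (fun l => (p l).2); split.
- by have [->] := Hp 0%N.
- by move=> l; have [] := Hp l.
- by move=> l; have [] := Hp l.
- by move=> l; have [] := Hp l.
Qed.

Lemma Omega_Om (w : coefs R) : Omega w <-> exists l, Om l w.
Proof.
have [_ _ -> _ _] := Om_good.
by split=> [[l _ Ow]|[l Ow]]; exists l.
Qed.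

(** Every form is reduced modulo the complement to an element of Omega, hence of
    some Om l, and then degree by degree down to 0. *)
Lemma level_span (m : nat -> nat) (f : nat -> nat -> vec) w :
  (forall l w, in_level w l -> exists a : nat -> F,
    below (w - \sum_(k < m l) a k *: f l k) l) -> fin w ->
  exists L c, w = \sum_(l < L) level_comb m f c l.
Proof.
move=> span fw; have [a0 /= Omega_r] := span 0%N w fw.
have Om_span l v : Om l (ofF v) -> exists c : nat -> nat -> F,
    v = \sum_(l' < l.+1) \sum_(k < m l'.+1) c l' k *: f l'.+1 k.
  elim: l v => [|l IHl] v Ov.
    have [a /= Oa] := span 1%N v Ov; exists (fun _ => a); rewrite big_ord1.
    by apply/eqP; rewrite -subr_eq0; apply/eqP/(pred_filt0 Oa).
  have [a /= /IHl[c Ec]] := span l.+2 v Ov.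
  exists (fun l' => if l' == l.+1 then a else c l').
  rewrite big_ord_recr /= eqxx -[LHS](subrK (\sum_(k < m l.+2) a k *: f l.+2 k)) Ec.
  congr (_ + _); apply: eq_bigr => l' _; by rewrite ltn_eqF.
have [l /Om_span[c Ec]] := (Omega_Om _).1 Omega_r.
exists l.+2, (fun l' => if l' is l1.+1 then c l1 else a0).
rewrite big_ord_recl /= /level_comb /= -[LHS](subrK (\sum_(k < m 0) a0 k *: f 0 k)) Ec.
by rewrite addrC.
Qed.

(** In a relation, the coefficients of level 0 vanish because the rest lies in
    Omega; after that the coefficients of the highest remaining level vanish
    because the rest lies in the preceding module of the filtration. *)
Lemma level_free (m : nat -> nat) (f : nat -> nat -> vec) :
  (forall l k, fin (f l k) /\ ((k < m l)%N -> in_level (f l k) l)) ->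
  (forall l (a : nat -> F), below (\sum_(k < m l) a k *: f l k) l ->
    forall k, (k < m l)%N -> a k = 0) ->
  forall L c, \sum_(l < L) level_comb m f c l = 0 ->
  forall l k, (l < L)%N -> (k < m l)%N -> c l k = 0.
Proof.
move=> f_in free L c; case: L => [|L] // E0.
have comb_Om l : Om l (ofF (level_comb m f c l.+1)).
  by apply: submodule_sum => // k _; apply: submoduleZ => //; apply: (f_in l.+1 k).2.
have comb_pred l : pred_filt Om l (ofF (\sum_(l' < l) level_comb m f c l'.+1)).
  case: l => [|l]; first by rewrite big_ord0.
  apply: submodule_sum => [|l' _]; first exact: pred_filt_sub.
  by apply: (Om_le (ltn_ord l' : (l' <= l)%N)); apply: comb_Om.
have c0 k : (k < m 0)%N -> c 0%N k = 0.
  have E : level_comb m f c 0 = - \sum_(l < L) level_comb m f c l.+1.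
    by move/eqP: E0; rewrite big_ord_recl addr_eq0 => /eqP.
  apply: (free 0%N (c 0%N)); rewrite /below -/(level_comb m f c 0) E.
  apply: submoduleN => //.
  apply: submodule_sum => // l' _; apply/Omega_Om; exists (l' : nat); exact: comb_Om.
have {E0} : \sum_(l < L) level_comb m f c l.+1 = 0.
  move: E0; rewrite big_ord_recl {1}/level_comb big1 ?add0r // => k _.
  by rewrite c0 ?scale0r.
elim: L => [_ [|l] k //|L IHL E0 l k].
  by move=> _; apply: c0.
have cL k' : (k' < m L.+1)%N -> c L.+1 k' = 0.
  have E : level_comb m f c L.+1 = - \sum_(l < L) level_comb m f c l.+1.
    by move/eqP: E0; rewrite big_ord_recr /= addrC addr_eq0 => /eqP.
  apply: (free L.+1 (c L.+1)); rewrite /below -/(level_comb m f c L.+1) E.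
  apply: submoduleN; [exact: pred_filt_sub|exact: comb_pred].
rewrite ltnS leq_eqVlt => /predU1P[->|]; first exact: cL.
apply: IHL; move: E0; rewrite big_ord_recr /= [X in _ + X]big1 ?addr0 // => k' _.
by rewrite cL ?scale0r.
Qed.

Local Notation d := (partials U).

(** Bases of the quotients M_l and of the forms modulo Omega lift to a basis of all
    forms.  In particular each Om l is a direct summand, which is what lets
    filtrations be compared by coordinates. *)
Theorem adapted_frame : exists (m : nat -> nat) f g, [/\ m 0%N = n,
  frame m f g, forall l w, Om l (ofF w) <-> filt m g l w &
  forall w, Omega (ofF w) <-> contact m g w].
Proof.
have [m [f [m0 f_in f_span f_free]]] := graded_bases.
have [|||g Fr] := @dual_frame _ m f.
- by move=> l k; have [] := f_in l k.
- exact: level_free.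
- by move=> i; apply: level_span => //; apply: fin_unit.
have Om_filt l w : Om l (ofF w) -> filt m g l w.
  elim: l w => [|l IHl] w Ow; have [a /= Ha] := f_span _.+1 w Ow.
    rewrite -[w](subrK (\sum_(k < m 1) a k *: f 1 k)) (pred_filt0 Ha) add0r.
    by apply: filt_sum => k _; apply/filtZ/(filt_frame Fr).
  rewrite -[w](subrK (\sum_(k < m l.+2) a k *: f l.+2 k)); apply: filtD.
    exact/(filt_leW (leqnSn l))/IHl.
  by apply: filt_sum => k _; apply/filtZ/(filt_frame Fr).
have filt_Om l w : filt m g l w -> Om l (ofF w).
  apply: (filt_in_submodule Fr) => // l' k le_l'l lt_k.
  exact: (Om_le le_l'l ((f_in l'.+1 k).2 lt_k)).
exists m, f, g; split=> // [l w|w]; first by split; [apply: Om_filt|apply: filt_Om].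
rewrite Omega_Om; split=> [[l /Om_filt/filt_contact]//|].
by move=> /(contact_filt Fr)[l /filt_Om]; exists l.
Qed.

Section Adapted.
Variables (m : nat -> nat) (f g : nat -> nat -> vec).
Hypotheses (Fr : frame m f g) (OmP : forall l w, Om l (ofF w) <-> filt m g l w)
  (OmegaP : forall w, Omega (ofF w) <-> contact m g w).

Lemma perp_annih Z : perp U Omega (ofF Z) <-> annih m f Z.
Proof.
split=> [[_ ZO] l k lt_k|aZ].
  have ff := frame_fin Fr l.+1 k; apply: val_inj; rewrite -pairing_ofF //.
  by apply: ZO; apply/OmegaP/(filt_contact (filt_frame Fr lt_k)).
split=> [|W WO]; first by apply/vfieldsP; exists Z.
have [Wf _ _ _] := Omega_sub; have /formsP[w fw Ew] := Wf W WO.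
by rewrite Ew pairing_ofF // (annih_contact Fr aZ) //; apply/OmegaP; rewrite -Ew.
Qed.

Lemma adapted_lie_frame l j k : (j < m 0)%N -> (k < m l.+1)%N ->
  filt m g l.+1 (lieF d (g 0 j) (f l.+1 k)).
Proof.
move=> lt_j lt_k; have [_ _ _ lie_Om _] := Om_good.
apply/OmP/lie_Om; rewrite -lie_ofF; last exact: frame_fin Fr _ _.
apply: sub_gen_smallest; exists (ofF (g 0%N j)).
  exact/perp_annih/(annih_dual Fr).
by exists (ofF (f l.+1 k)) => //; apply/OmP/(filt_frame Fr).
Qed.

(** In the sum of Om l and the module generated by Lie derivatives, the latter is
    replaced modulo Om l by the sums of Lie derivatives along the finitely many
    dual fields: such sums are closed under multiplication by functions, since
    the derivative of a coefficient produces elements of Om l only. *)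
Lemma adapted_frame_gen : exists l0, forall l k, (l0 <= l)%N -> (k < m l.+2)%N ->
  exists2 u : nat -> vec, forall j, filt m g l (u j) &
    filt m g l (f l.+2 k - \sum_(j < m 0) lieF d (g 0 j) (u j)).
Proof.
have [_ _ _ _ [l0 gen]] := Om_good; exists l0 => l k le_l lt_k.
(* T is the module of forms congruent modulo Om l to such a sum. *)
pose T : set (coefs R) := [set W | exists2 w, W = ofF w & fin w /\
  exists2 u : nat -> vec, forall j, filt m g l (u j) &
    filt m g l (w - \sum_(j < m 0) lieF d (g 0 j) (u j))].
have lieD (u v : nat -> vec) : (forall j, filt m g l (u j)) -> (forall j, filt m g l (v j)) ->
    \sum_(j < m 0) lieF d (g 0 j) (u j + v j) =
    \sum_(j < m 0) lieF d (g 0 j) (u j) + \sum_(j < m 0) lieF d (g 0 j) (v j).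
  move=> fu fv; rewrite -big_split; apply: eq_bigr => j _.
  by rewrite lieFD //; [apply: filt_fin (fu j)|apply: filt_fin (fv j)].
have T_sub : submodule U T.
  split.
  - by move=> _ [w -> [fw _]]; apply/formsP; exists w.
  - exists 0 => //; split; first exact: fin0.
    exists (fun=> 0) => [j|]; first exact: filt0.
    rewrite big1 ?subr0 => [|j _]; [exact: filt0|exact: lieF0].
  - move=> _ _ [v -> [fv [u fu Hu]]] [w -> [fw [u' fu' Hu']]].
    exists (v + w) => //; split; first exact: finD.
    exists (fun j => u j + u' j) => [j|]; first exact: filtD.
    by rewrite lieD // opprD addrACA; apply: filtD.
  - move=> a _ Ua [w -> [fw [u fu Hu]]]; have [b {Ua}->] := smoothfn_of Ua.
    exists (b *: w) => //; split; first exact: finZ.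
    exists (fun j => b *: u j) => [j|]; first exact: filtZ.
    rewrite (eq_bigr (fun j : 'I_(m 0) => b *: lieF d (g 0 j) (u j) + act d (g 0 j) b *: u j)).
      rewrite big_split /= -scaler_sumr opprD addrA -scalerBr.
      by apply: filtB; [apply: filtZ|apply: filt_sum => j _; apply: filtZ].
    by move=> j _; apply/lieF_scale/(filt_fin (fu j)).
have gens_T : [set lie U Z w | Z in perp U Omega & w in Om l] `<=` T.
  move=> _ [Z' HZ [w' Ow <-]].
  have /vfieldsP[Z EZ] := HZ.1; have [Wf _ _ _] := Om_sub l.
  have /formsP[w fw Ew] := Wf w' Ow.
  rewrite EZ Ew lie_ofF //; move: HZ Ow; rewrite EZ Ew => /perp_annih aZ /OmP filt_w.
  exists (lieF d Z w) => //; split; first exact: fin_lieF.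
  exists (fun j => pair (f 0 j) Z *: w) => [j|]; first exact: filtZ.
  have -> : lieF d Z w = \sum_(j < m 0) pair (f 0 j) Z *: lieF d (g 0 j) w.
    rewrite {1}(annih_decomp Fr aZ) lieF_suml //; apply: eq_bigr => j _.
    rewrite lieF_scalel // (annih_contact Fr (annih_dual Fr _)) //.
      by rewrite scale0r addr0.
    exact: filt_contact filt_w.
  rewrite -sumrB; apply: filt_sum => j _; rewrite lieF_scale // opprD addrA subrr add0r.
  exact/filtN/filtZ.
have : Om l.+1 (ofF (f l.+2 k)) by apply/OmP/(filt_frame Fr).
rewrite -(gen l le_l) => -[v' Ov [t' Tt' Ef]].
have {}/(smallest_sub T_sub gens_T)[t Et [ft [u fu Hu]]] := Tt'.
have [Wf _ _ _] := Om_sub l; have /formsP[v fv Ev] := Wf v' Ov.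
exists u => //; move: Ov Ef; rewrite Ev Et -ofFD => /OmP filt_v /ofF_inj <-.
by rewrite -addrA; apply: filtD.
Qed.
End Adapted.
End Build.

(** * Propagation of quasiregularity *)

Section Propagation.
Variables (A : comPzRingType) (n : nat) (m : nat -> nat).
Variable C : nat -> forall t, 'M[A]_(m t, m t.+1).
Hypothesis C_comm : forall j k t, C j t *m C k t.+1 = C k t *m C j t.+1.
Hypothesis C_gen : forall t (v : 'rV[A]_(m t.+1)),
  exists u : nat -> 'rV[A]_(m t), v = \sum_(j < n) u j *m C j t.

(** Degree 0 stands for the degree from which on the graded module is studied;
    J0 k is the part of the ideal in this lowest degree, which comes from one
    degree below, outside the module considered here. *)
Variable J0 : nat -> 'rV[A]_(m 0) -> Prop.
Hypothesis J0_mul : forall k j v, J0 k v ->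
  exists u : nat -> 'rV[A]_(m 0), v *m C j 0 = \sum_(k <= i < n) u i *m C i 0.

(** The degree t part of (C k, ..., C (n - 1)) M.  The quotients
    Q k = M / (C k, ..., C (n - 1)) M run from Q n = M down to Q 0, which vanishes
    in positive degrees, and the multiplication by C k maps Q (k + 1) to itself
    with cokernel Q k. *)
Definition tail_ideal (k t : nat) : 'rV[A]_(m t) -> Prop :=
  match t return 'rV[A]_(m t) -> Prop with
  | 0 => J0 k
  | t.+1 => fun v => exists u : nat -> 'rV[A]_(m t),
              v = \sum_(k <= i < n) u i *m C i t
  end.

(** Expected ranks and candidate bases of the Q k in all degrees, from those of
    the lowest degree: if C k is injective on Q (k + 1), then a basis of Q (k + 1)
    in degree t + 1 consists of the products by C k of a basis in degree t and of
    lifts of a basis of Q k. *)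
Variable d0 : nat -> nat.
Fixpoint dims (t : nat) : nat -> nat :=
  if t is t'.+1 then
    fix dims_t k := if k is k'.+1 then (dims t' k + dims_t k')%N else 0%N
  else d0.

Variable S0 : forall k, 'M[A]_(d0 k, m 0).
Fixpoint gens (t : nat) : forall k, 'M[A]_(dims t k, m t) :=
  match t return forall k, 'M[A]_(dims t k, m t) with
  | 0 => S0
  | t'.+1 => fix gens_t k : 'M[A]_(dims t'.+1 k, m t'.+1) :=
      match k return 'M[A]_(dims t'.+1 k, m t'.+1) with
      | 0 => 0
      | k'.+1 => col_mx (gens t' k'.+1 *m C k' t') (gens_t k')
      end
  end.

Hypothesis S0_gen : forall k, (k <= n)%N -> forall v : 'rV_(m 0),
  exists a : 'rV_(d0 k), J0 k (v - a *m S0 k).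
(** The expected rank of M = Q n is its true rank. *)
Hypothesis dims_total : forall t, dims t.+1 n = m t.+1.

Lemma dimsS t k : dims t.+1 k.+1 = (dims t k.+1 + dims t.+1 k)%N.
Proof. by []. Qed.

Lemma tail_ideal_mul k t j v : tail_ideal k v ->
  @tail_ideal k t.+1 (v *m C j t).
Proof.
case: t v => [|t] v /=; first exact: J0_mul.
case=> u ->; exists (fun i => u i *m C j t).
rewrite mulmx_suml; apply: eq_bigr => i _.
by rewrite -!mulmxA C_comm.
Qed.

Lemma gens_split t k (a : 'rV_(dims t k.+1)) (b : 'rV_(dims t.+1 k)) :
  row_mx a b *m gens t.+1 k.+1 = a *m gens t k.+1 *m C k t + b *m gens t.+1 k.
Proof. by rewrite /= mul_row_col mulmxA. Qed.

Hypothesis J0_add : forall k v w, J0 k v -> J0 k w -> J0 k (v + w).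

Lemma tail_idealD k t v w : @tail_ideal k t v -> tail_ideal k w ->
  tail_ideal k (v + w).
Proof.
case: t v w => [|t] v w /=; first exact: J0_add.
move=> [a ->] [b ->]; exists (fun i => a i + b i).
by rewrite -big_split; apply: eq_bigr => i _; rewrite mulmxDl.
Qed.

Definition spanned k t (v : 'rV_(m t)) : Prop :=
  exists a : 'rV_(dims t k), tail_ideal k (v - a *m gens t k).

Lemma spannedD k t v w : @spanned k t v -> spanned k w -> spanned k (v + w).
Proof.
move=> [a Ha] [b Hb]; exists (a + b).
by rewrite mulmxDl opprD addrACA; apply: tail_idealD.
Qed.

Lemma tail_ideal_spanned k t v : @tail_ideal k t v -> spanned k v.
Proof. by exists 0; rewrite mul0mx subr0. Qed.

Lemma spanned_mul k t v : @spanned k.+1 t v -> @spanned k.+1 t.+1 (v *m C k t).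
Proof.
case=> a Ha; exists (row_mx a 0).
by rewrite gens_split mul0mx addr0 -mulmxBl; apply: tail_ideal_mul.
Qed.

(** The candidates generate: modulo the ideal, a product by C j is a combination
    of products by C j of generators of Q (j + 1), and the rest is treated by
    induction on the number of operators. *)
Lemma gens_gen t k : (k <= n)%N -> forall v : 'rV_(m t), spanned k v.
Proof.
elim: t k => [|t IHt] k le_kn; first exact: S0_gen.
have lower u : spanned k (\sum_(0 <= j < k) u j *m C j t).
  elim: k le_kn => [|k IHk] lt_kn.
    rewrite big_geq //; apply: tail_ideal_spanned; exists (fun=> 0).
    by rewrite big1 // => i _; rewrite mul0mx.
  rewrite big_nat_recr //=; apply: spannedD; last exact/spanned_mul/IHt.
  have [b [w Hw]] := IHk (ltnW lt_kn).
  rewrite -(subrK (b *m gens t.+1 k) (\sum_(0 <= j < k) _)) Hw big_ltn // addrAC.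
  apply: spannedD; last by apply: tail_ideal_spanned; exists w.
  rewrite addrC; apply: spannedD; last exact/spanned_mul/IHt.
  exists (row_mx 0 b); rewrite gens_split !mul0mx add0r subrr.
  by exists (fun=> 0); rewrite big1 // => i _; rewrite mul0mx.
move=> v; have [u {v}->] := C_gen v.
rewrite -(big_mkord xpredT (fun j => u j *m C j t)) (@big_cat_nat _ _ _ k) //=.
by apply: spannedD => //; apply: tail_ideal_spanned; exists u.
Qed.

Lemma row_gens t (a : forall k, 'rV_(dims t k)) k :
  exists b : 'rV_(dims t.+1 k),
    b *m gens t.+1 k = \sum_(0 <= j < k) a j.+1 *m gens t j.+1 *m C j t
    /\ (b = 0 -> forall j, (j < k)%N -> a j.+1 = 0).
Proof.
elim: k => [|k [b [Eb b0]]].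
  by exists 0; rewrite big_geq // mul0mx.
exists (row_mx (a k.+1) b); rewrite gens_split Eb big_nat_recr //= addrC.
split=> // /eqP; rewrite row_mx_eq0 => /andP[/eqP a0 /eqP/b0 b0'] j.
by rewrite ltnS leq_eqVlt => /predU1P[->|/b0'].
Qed.

Lemma mulmx1C_cast d e (X : 'M[A]_(e, d)) (Y : 'M[A]_(d, e)) :
  d = e -> X *m Y = 1%:M -> Y *m X = 1%:M.
Proof. by move=> eq_de; case: e / eq_de X Y => X Y; apply: mulmx1C. Qed.

(** In degree t + 1 the generators of M form a square matrix with a left inverse,
    by the count of ranks; over a commutative ring it is then invertible, so
    that they satisfy no relation. *)
Lemma gens_free t (a : forall k, 'rV_(dims t k)) :
  \sum_(0 <= j < n) a j.+1 *m gens t j.+1 *m C j t = 0 ->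
  forall j, (j < n)%N -> a j.+1 = 0.
Proof.
have [X HX] : exists X : 'M[A]_(m t.+1, dims t.+1 n), X *m gens t.+1 n = 1%:M.
  have row_gen i : exists x : 'rV_(dims t.+1 n), x *m gens t.+1 n = row i 1%:M.
    have [x [u]] := gens_gen (leqnn n) (row i (1%:M : 'M[A]_(m t.+1))).
    by rewrite big_geq // => /subr0_eq ->; exists x.
  have {row_gen} /fin_all_exists[x Hx] := row_gen.
  exists (\matrix_i x i); apply/row_matrixP => i.
  by rewrite row_mul rowK Hx.
have [b [<- b0]] := row_gens a n.
have GX := mulmx1C_cast (dims_total t) HX.
by move=> /(congr1 (mulmx^~ X)); rewrite -mulmxA GX mulmx1 mul0mx.
Qed.

(** Elements of the ideal are combinations of the same products: coefficients of
    C k are reduced modulo the later operators, starting with k. *)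
Lemma tail_ideal_gens t k v : (k <= n)%N -> @tail_ideal k t.+1 v ->
  exists a : forall j, 'rV_(dims t j),
    v = \sum_(k <= j < n) a j.+1 *m gens t j.+1 *m C j t.
Proof.
move=> le_kn; rewrite -(subKn le_kn).
move: (n - k)%N (leq_subr k n) => h {k le_kn}.
elim: h v => [|h IHh] v le_hn.
  by rewrite subn0 => -[u ->]; exists (fun=> 0); rewrite !big_geq.
case=> u; set k := (n - h.+1)%N.
have Ek : (n - h)%N = k.+1 by rewrite /k subnSK.
have lt_kn : (k < n)%N by rewrite -Ek leq_subr.
rewrite big_ltn // => ->.
have [b Hb] := gens_gen lt_kn (u k).
have tb := tail_ideal_mul k Hb.
have tu : @tail_ideal k.+1 t.+1 (\sum_(k.+1 <= i < n) u i *m C i t) by exists u.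
have := IHh _ (ltnW le_hn); rewrite Ek => /(_ _ (tail_idealD tb tu)) [a Ha].
exists (eqtype.dfwith a b).
rewrite [RHS]big_ltn // dfwith_in.
rewrite [in RHS](_ : \sum_(k.+1 <= j < n) _ =
    \sum_(k.+1 <= j < n) a j.+1 *m gens t j.+1 *m C j t).
  by rewrite -Ha addrA; congr (_ + _); rewrite mulmxBl addrC subrK.
rewrite big_nat_cond [RHS]big_nat_cond; apply: eq_bigr => j.
by rewrite andbT => /andP[lt_kj _]; rewrite dfwith_out // eqSS ltn_eqF.
Qed.

(** Injectivity of C k on Q (k + 1).  If the product of v by C k lies in the
    ideal, then so does that of its representative b *m gens, and comparing with
    [tail_ideal_gens] gives a relation between elements of a basis of M in which b
    occurs as the coefficients of index k; hence b = 0. *)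
Lemma quasiregular_propagation t k v : (k < n)%N ->
  @tail_ideal k.+1 t.+1 (v *m C k t) -> @tail_ideal k.+1 t v.
Proof.
move=> lt_kn; have [b Hb] := gens_gen lt_kn v.
move=> Hv.
suff b0 : b = 0 by move: Hb; rewrite b0 mul0mx subr0.
have : @tail_ideal k.+1 t.+1 (b *m gens t k.+1 *m C k t).
  have [w Hw] := Hv; have [w' Hw'] := tail_ideal_mul k Hb.
  exists (fun i => w i - w' i); under eq_bigr do rewrite mulmxBl.
  by rewrite sumrB -Hw -Hw' -mulmxBl opprB addrC subrK.
case/(tail_ideal_gens lt_kn) => a Ha.
pose a' := eqtype.dfwith (fun j => if (k.+1 < j)%N then - a j else 0) b.
suff /gens_free/(_ k lt_kn) : \sum_(0 <= j < n) a' j.+1 *m gens t j.+1 *m C j t = 0.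
  by rewrite /a' dfwith_in.
rewrite (@big_cat_nat _ _ _ k) //=; last exact: ltnW.
rewrite big_nat_cond big1 ?add0r; last first.
  move=> j; rewrite andbT => /= lt_jk; rewrite /a' dfwith_out ?eqSS ?gtn_eqF //.
  by rewrite ltnS ltnNge (ltnW lt_jk) !mul0mx.
rewrite big_ltn // {1}/a' dfwith_in Ha.
rewrite -big_split big_nat_cond big1 // => j; rewrite andbT => /andP[lt_kj _].
by rewrite /a' dfwith_out ?eqSS ?ltn_eqF //= ltnS lt_kj !mulNmx addrN.
Qed.
End Propagation.

(** * Noetherian modules over commuting operators *)

Section Noetherian.
Variables (K : fieldType) (E : lmodType K) (z : nat -> {linear E -> E}).
Hypothesis zC : forall i j v, z i (z j v) = z j (z i v).
Implicit Types (W N : E -> Prop).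

Definition linear_subspace W : Prop :=
  W 0 /\ forall a v w, W v -> W w -> W (a *: v + w).
Definition stable_under k W : Prop := forall j v, (j < k)%N -> W v -> W (z j v).

(** The ascending chain condition for the subspaces of N stable under the first k
    operators, that is for the submodules over polynomials in k variables.  The
    members of a chain may leave N, but only their traces on N are compared. *)
Definition noetherian k N : Prop := forall W : nat -> E -> Prop,
  (forall a, linear_subspace (W a)) -> (forall a, stable_under k (W a)) ->
  (forall a v, W a v -> W a.+1 v) ->
  exists a0, forall a v, N v -> W a v -> W a0 v.

Section SubspaceTheory.
Variables (W : E -> Prop) (W_sub : linear_subspace W).

Lemma subspace0 : W 0. Proof. by case: W_sub. Qed.
Lemma subspaceD v w : W v -> W w -> W (v + w).
Proof. by move=> Wv Ww; rewrite -[v]scale1r; apply: W_sub.2. Qed.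
Lemma subspaceZ a v : W v -> W (a *: v).
Proof. by move=> Wv; rewrite -[_ *: _]addr0; apply: W_sub.2 => //; apply: subspace0. Qed.
Lemma subspaceB v w : W v -> W w -> W (v - w).
Proof. by move=> Wv Ww; rewrite addrC -scaleN1r; apply: W_sub.2. Qed.
Lemma subspace_sum I (r : seq I) (P : pred I) (F : I -> E) :
  (forall i, P i -> W (F i)) -> W (\sum_(i <- r | P i) F i).
Proof. by move=> WF; elim/big_ind: _ => //; [apply: subspace0 | apply: subspaceD]. Qed.
End SubspaceTheory.

Lemma chain_le (W : nat -> E -> Prop) : (forall a v, W a v -> W a.+1 v) ->
  forall a b v, (a <= b)%N -> W a v -> W b v.
Proof.
move=> W_incr a b v /subnK <-; elim: (b - a)%N => // d IHd Wv.
by rewrite addSn; apply/W_incr/IHd.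
Qed.

Definition line_add (u : E) N : E -> Prop :=
  fun v => exists c w, N w /\ v = c *: u + w.

(** A finite-dimensional space is built up line by line; a chain on the larger
    space is controlled by its trace on N and by the first index, if any, at
    which it meets the coset u + N. *)
Lemma noetherian_line_add u N : linear_subspace N -> noetherian 0 N ->
  noetherian 0 (line_add u N).
Proof.
move=> N_sub N_noeth W W_sub W_stab W_incr.
have [a0 Ha0] := N_noeth W W_sub W_stab W_incr.
have W_le := chain_le W_incr.
have [[a1 [w1 [Nw1 Ww1]]]|no_u] := pselect (exists a w, N w /\ W a (u + w)).
  exists (maxn a0 a1) => a _ [c [w [Nw ->]]] Wv.
  have Wc : W (maxn a0 a1) (c *: (u + w1)).
    by apply: subspaceZ => //; apply: (W_le a1); rewrite ?leq_maxr.
  have Wd : W (maxn a0 a1) (w - c *: w1).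
    apply: (W_le a0); rewrite ?leq_maxl //; apply: (Ha0 (maxn a a1)).
      by apply: subspaceB => //; apply: subspaceZ.
    rewrite (_ : _ - _ = c *: u + w - c *: (u + w1)).
      apply: subspaceB => //; first by apply: (W_le a); rewrite ?leq_maxl.
      by apply: subspaceZ => //; apply: (W_le a1); rewrite ?leq_maxr.
    by rewrite scalerDr opprD addrACA subrr add0r.
  rewrite (_ : _ + _ = c *: (u + w1) + (w - c *: w1)); first exact: subspaceD.
  by rewrite scalerDr -addrA [_ *: w1 + _]addrC subrK.
exists a0 => a _ [c [w [Nw ->]]] Wv.
have [c0|c0] := eqVneq c 0.
  by move: Wv; rewrite c0 scale0r add0r => Wv; apply: Ha0 Wv.
case: no_u; exists a, (c^-1 *: w); split; first exact: subspaceZ.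
have -> : u + c^-1 *: w = c^-1 *: (c *: u + w).
  by rewrite scalerDr scalerA mulVf // scale1r.
exact: subspaceZ.
Qed.

Lemma subspace_line_add u N : linear_subspace N -> linear_subspace (line_add u N).
Proof.
move=> N_sub; split.
  by exists 0, 0; split; [apply: subspace0 | rewrite scale0r addr0].
move=> a _ _ [c [w [Nw ->]]] [d [x [Nx ->]]].
exists (a * c + d), (a *: w + x); split; first by apply: N_sub.2.
by rewrite scalerDr scalerDl scalerA addrACA.
Qed.

(** The polynomials of degree less than i in the operator z k, with coefficients
    in N. *)
Fixpoint low_part k N i : E -> Prop :=
  if i is i'.+1 then
    fun v => exists u w, [/\ N u, low_part k N i' w & v = iter i' (z k) u + w]
  else fun v => v = 0.

Definition adjoin k N : E -> Prop := fun v => exists i, low_part k N i v.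

Lemma iter_lin k i a u v :
  iter i (z k) (a *: u + v) = a *: iter i (z k) u + iter i (z k) v.
Proof. by elim: i => //= i ->; rewrite linearP. Qed.

Lemma iterC j k i u : z j (iter i (z k) u) = iter i (z k) (z j u).
Proof. by elim: i => //= i <-; rewrite zC. Qed.

Section Adjoin.
Variables (k : nat) (N : E -> Prop).
Hypotheses (N_sub : linear_subspace N) (N_stab : stable_under k N).

Lemma low_subspace i : linear_subspace (low_part k N i).
Proof.
elim: i => [|i [IH0 IHi]]; split=> //=.
- by move=> a v w -> ->; rewrite scaler0 addr0.
- exists 0, 0; split=> //; first exact: subspace0.
  by have := iter_lin k i (-1) 0 0; rewrite !scaleN1r oppr0 add0r addNr addr0 => ->.
- move=> a v w [u [x [Nu Lx ->]]] [u' [x' [Nu' Lx' ->]]].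
  exists (a *: u + u'), (a *: x + x'); split; [exact: N_sub.2|exact: IHi|].
  by rewrite iter_lin scalerDr addrACA.
Qed.

Lemma low_stable i : stable_under k (low_part k N i).
Proof.
elim: i => [|i IHi] j v lt_jk /=; first by move=> ->; rewrite linear0.
move=> [u [x [Nu Lx ->]]]; exists (z j u), (z j x).
by split; [exact: N_stab|exact: IHi|rewrite linearD iterC].
Qed.

Lemma low_incr i v : low_part k N i v -> low_part k N i.+1 v.
Proof.
move=> Lv; exists 0, v; split=> //; first exact: subspace0.
by have := iter_lin k i (-1) 0 0; rewrite !scaleN1r oppr0 add0r addNr => ->; rewrite add0r.
Qed.

Lemma low_shift i v : low_part k N i v -> low_part k N i.+1 (z k v).
Proof.
elim: i v => [|i IHi] v /=.
  move=> ->; exists 0, 0; split=> //; first exact: subspace0.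
  by rewrite linear0 /= addr0.
move=> [u [x [Nu /IHi Lx ->]]]; exists u, (z k x).
by split=> //; rewrite linearD.
Qed.

Lemma subspace_adjoin : linear_subspace (adjoin k N).
Proof.
split; first by exists 0.
move=> a v w [i Lv] [j Lw]; exists (maxn i j).
apply: (low_subspace _).2.
  by apply: (chain_le low_incr) Lv; rewrite leq_maxl.
by apply: (chain_le low_incr) Lw; rewrite leq_maxr.
Qed.

Lemma stable_adjoin : stable_under k.+1 (adjoin k N).
Proof.
move=> j v; rewrite ltnS leq_eqVlt => /predU1P[->|lt_jk] [i Lv].
  by exists i.+1; apply: low_shift.
by exists i; apply: low_stable.
Qed.

Lemma sub_adjoin v : N v -> adjoin k N v.
Proof. by move=> Nv; exists 1, v, 0; rewrite addr0. Qed.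

(** Hilbert's basis theorem for modules.  The leading coefficients in degree i of
    the elements of W a form a stable subspace lead a i, increasing in both
    indices.  The diagonal chain lead a a is stationary from a0 on, so only the
    finitely many chains with i < a0 remain to be bounded; equality of all
    leading coefficients then gives equality by induction on the degree. *)
Lemma noetherian_adjoin : noetherian k N -> noetherian k.+1 (adjoin k N).
Proof.
move=> N_noeth W W_sub W_stab W_incr.
have W_le := chain_le W_incr.
pose lead a i u := exists2 v, low_part k N i v & W a (iter i (z k) u + v).
have lead_sub a i : linear_subspace (lead a i).
  split.
    exists 0; first exact: (low_subspace i).1.
    have := iter_lin k i (-1) 0 0; rewrite !scaleN1r oppr0 add0r addNr => ->.
    by rewrite add0r; apply: subspace0.
  move=> c u u' [v Lv Wv] [v' Lv' Wv']; exists (c *: v + v').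
    exact: (low_subspace i).2.
  by rewrite iter_lin addrACA -scalerDr; apply: (W_sub a).2.
have lead_stab a i : stable_under k (lead a i).
  move=> j u lt_jk [v Lv Wv]; exists (z j v); first exact: low_stable.
  by rewrite -iterC -linearD; apply: W_stab; rewrite // ltnS ltnW.
have leadSl a i u : lead a i u -> lead a.+1 i u.
  by case=> v Lv Wv; exists v => //; apply: W_incr.
have leadSr a i u : lead a i u -> lead a i.+1 u.
  case=> v Lv Wv; exists (z k v); first exact: low_shift.
  by rewrite iterS -linearD; apply: W_stab.
have lead_le a b i j u : (a <= b)%N -> (i <= j)%N -> lead a i u -> lead b j u.
  move=> le_ab le_ij /(chain_le (fun a => leadSl a i) le_ab).
  exact: (chain_le (leadSr b) le_ij).
have [a0 Ha0] := N_noeth _ (fun a => lead_sub a a) (fun a => lead_stab a a)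
  (fun a v Lv => leadSl a _ v (leadSr a a v Lv) : lead a.+1 a.+1 v).
pose Q i b := forall a u, N u -> lead a i u -> lead b i u.
have Q_ex i : (i < a0)%N -> exists b, Q i b.
  move=> _; exact: N_noeth _ (fun a => lead_sub a i) (fun a => lead_stab a i)
    (fun a => leadSl a i).
have Q_le i a b : (a <= b)%N -> Q i a -> Q i b.
  by move=> le_ab Qa c u Nu /(Qa c u Nu); apply: lead_le.
have [b Hb] := common_bound Q_le Q_ex.
pose a1 := maxn a0 b.
have stab i : Q i a1.
  have [lt_ia|le_ai] := ltnP i a0; first by apply: Q_le (Hb i lt_ia); apply: leq_maxr.
  move=> a u Nu La; apply: (lead_le a0 _ a0); rewrite ?leq_maxl //.
  apply: (Ha0 (maxn a i)) => //; apply: lead_le La; first exact: leq_maxl.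
  exact: leq_maxr.
exists a1 => a v [i Lv]; elim: i a v Lv => [|i IHi] a v.
  by move=> -> _; apply: subspace0.
move=> /= [u [w [Nu Lw ->]]] Wv.
have [w' Lw' Ww'] : lead a1 i u by apply: (stab i a) => //; exists w.
have -> : iter i (z k) u + w = (iter i (z k) u + w') + (w - w').
  by rewrite -addrA [w' + _]addrC subrK.
apply: subspaceD => //; apply: (IHi (maxn a a1)).
  by apply: subspaceB => //; apply: low_subspace.
have -> : w - w' = iter i (z k) u + w - (iter i (z k) u + w').
  by rewrite opprD addrACA subrr add0r.
apply: subspaceB => //; first by apply: (W_le a); rewrite ?leq_maxl.
by apply: (W_le a1); rewrite ?leq_maxr.
Qed.
End Adjoin.

Fixpoint span_upto (e : nat -> E) r : E -> Prop :=
  if r is r'.+1 then line_add (e r') (span_upto e r') else fun v => v = 0.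

(** The operators are adjoined one at a time, so that [noetherian_adjoin] applies
    at each step. *)
Fixpoint generated (e : nat -> E) r k : E -> Prop :=
  if k is k'.+1 then adjoin k' (generated e r k') else span_upto e r.

Lemma span_noetherian e r : linear_subspace (span_upto e r) /\ noetherian 0 (span_upto e r).
Proof.
elim: r => [|r [IHs IHn]].
  split; first by split=> // a v w -> ->; rewrite scaler0 addr0.
  by move=> W W_sub _ _; exists 0 => a v -> _; apply: subspace0.
by split; [apply: subspace_line_add | apply: noetherian_line_add].
Qed.

Lemma hilbert_basis e r k : [/\ linear_subspace (generated e r k),
  stable_under k (generated e r k) & noetherian k (generated e r k)].
Proof.
elim: k => [|k [IHsub IHstab IHnoeth]].
  by have [sub noeth] := span_noetherian e r; split.
split; [exact: subspace_adjoin|exact: stable_adjoin|exact: noetherian_adjoin].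
Qed.

Lemma span_generated e r k v : span_upto e r v -> generated e r k v.
Proof. by move=> ev; elim: k => // k IHk; apply: sub_adjoin. Qed.

Lemma span_upto_sum e r (c : nat -> K) :
  span_upto e r (\sum_(i < r) c i *: e i).
Proof.
elim: r => [|r IHr] /=; first by rewrite big_ord0.
by rewrite big_ord_recr /= addrC; exists (c r); eexists; split; first exact: IHr.
Qed.
End Noetherian.

(** * Linear forms on the moment curve *)

Section Curve.
Variables (A : comPzRingType) (m : nat -> nat) (n : nat).
Variable M : nat -> forall l, 'M[A]_(m l, m l.+1).
Hypothesis M_comm : forall j k l, M j l *m M k l.+1 = M k l *m M j l.+1.

(** The form M_0 + t M_1 + ... + t^(n-1) M_(n-1).  Generic linear forms are taken
    on the moment curve: a one-parameter family in which any n members are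
    independent is enough, and its coefficients are integers in every ring. *)
Definition curve_mx (t : nat) l : 'M[A]_(m l, m l.+1) :=
  \sum_(j < n) t%:R ^+ j *: M j l.

Lemma curve_mx_comm s t l :
  curve_mx s l *m curve_mx t l.+1 = curve_mx t l *m curve_mx s l.+1.
Proof.
rewrite /curve_mx mulmx_suml; under eq_bigr do rewrite mulmx_sumr.
rewrite mulmx_suml; under [RHS]eq_bigr do rewrite mulmx_sumr.
rewrite exchange_big; apply: eq_bigr => i _; apply: eq_bigr => j _.
by rewrite -!scalemxAl -!scalemxAr M_comm !scalerA mulrC.
Qed.

Lemma curve_mx_gen (tau : nat -> nat) (q : 'M[A]_n) l (v : 'rV_(m l.+1))
    (u : nat -> 'rV_(m l)) :
  (forall j k : 'I_n, \sum_(i < n) q i j * (tau i)%:R ^+ k = (j == k)%:R) ->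
  v = \sum_(j < n) u j *m M j l ->
  exists w : nat -> 'rV_(m l), v = \sum_(i < n) w i *m curve_mx (tau i) l.
Proof.
move=> qP ->.
exists (fun i => if insub i is Some i' then \sum_(j < n) q i' j *: u j else 0).
transitivity (\sum_(j < n) \sum_(k < n) (j == k)%:R *: (u j *m M k l)).
  apply: eq_bigr => j _; rewrite (bigD1 j) //= eqxx scale1r big1 ?addr0 // => k.
  by rewrite eq_sym => /negPf->; rewrite scale0r.
under [RHS]eq_bigr => i _ do rewrite valK mulmx_suml.
rewrite [RHS]exchange_big; apply: eq_bigr => j _ /=.
under [RHS]eq_bigr do rewrite mulmx_sumr; rewrite [RHS]exchange_big.
apply: eq_bigr => k _ /=; rewrite -qP scaler_suml; apply: eq_bigr => i _.
by rewrite -scalemxAl -scalemxAr scalerA.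
Qed.
End Curve.

Lemma map_curve_mx (A B : comPzRingType) (rho : {rmorphism A -> B}) m n M t l :
  map_mx rho (@curve_mx A m n M t l) = curve_mx n (fun j l => map_mx rho (M j l)) t l.
Proof.
rewrite /curve_mx (map_mx_sum rho); apply: eq_bigr => j _.
by rewrite map_mxZ rmorphXn rmorph_nat.
Qed.

(** A two-sided inverse of the Vandermonde matrix, stated by entries so that it can
    be transported along ring morphisms. *)
Lemma Vandermonde_inverse (K : numFieldType) n (tau : nat -> nat) :
  (forall i j, (i < j < n)%N -> tau i != tau j) ->
  exists q : 'M[K]_n,
    (forall j k : 'I_n, \sum_(i < n) q i j * (tau i)%:R ^+ k = (j == k)%:R) /\
    (forall i j : 'I_n, \sum_(k < n) (tau i)%:R ^+ k * q j k = (i == j)%:R).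
Proof.
move=> tau_inj; pose a : 'rV[K]_n := \row_i (tau i)%:R.
have V_unit : Vandermonde n a \in unitmx.
  rewrite unitmxE det_Vandermonde unitfE; apply/prodf_neq0 => i _.
  apply/prodf_neq0 => k lt_ik; rewrite !mxE subr_eq0 eqr_nat eq_sym.
  by rewrite tau_inj // lt_ik ltn_ord.
exists (invmx (Vandermonde n a)); split=> j k.
  have /matrixP/(_ k j) := mulmxV V_unit; rewrite !mxE eq_sym => <-.
  by apply: eq_bigr => i _; rewrite !mxE mulrC.
have /matrixP/(_ k j) := mulVmx V_unit; rewrite !mxE eq_sym => <-.
by apply: eq_bigr => i _; rewrite !mxE mulrC.
Qed.

(** Ideals generated by the first n - k forms become ideals generated by the last
    ones when the numbering of the forms is reversed. *)
Lemma sum_tail_rev (V : nmodType) n k (G : nat -> V) : (k <= n)%N ->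
  \sum_(k <= i < n) G (n - i.+1)%N = \sum_(j < n - k) G j.
Proof.
move E: (n - k)%N => h; elim: h k E => [|h IHh] k E le_kn.
  by rewrite big_ord0 big_geq // -subn_eq0 E.
have lt_kn : (k < n)%N by rewrite -subn_gt0 E.
have Eh : (n - k.+1)%N = h by rewrite subnS E.
by rewrite big_ltn // big_ord_recr /= IHh // addrC Eh.
Qed.

Lemma rev_index n i : (i < n)%N -> (n - (n - i.+1).+1)%N = i.
Proof. by move=> lt_in; rewrite subnSK // subKn // ltnW. Qed.

Lemma sum_tail_rev_mx (A : pzRingType) p q r n k (u : nat -> 'M[A]_(p, q))
    (B : nat -> 'M[A]_(q, r)) : (k <= n)%N ->
  \sum_(k <= i < n) u i *m B (n - i.+1)%N = \sum_(j < n - k) u (n - j.+1)%N *m B j.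
Proof.
move=> le_kn; rewrite -(sum_tail_rev (fun j => u (n - j.+1)%N *m B j) le_kn).
by apply: eq_big_nat => i /andP[_ lt_in]; rewrite rev_index.
Qed.

(** * Injectivity of generic linear forms *)

Section Generic.
Variables (K : numFieldType) (E : lmodType K) (z : nat -> {linear E -> E}).
Hypothesis zC : forall i j v, z i (z j v) = z j (z i v).
(** G l is the space of elements of degree l and pr l the projection to it; in
    degrees at least l0 the module is contained in the Noetherian module N. *)
Variables (n l0 : nat) (N : E -> Prop) (G : nat -> E -> Prop).
Variable pr : nat -> {linear E -> E}.
Hypotheses (N_noeth : noetherian z n N) (GN : forall l v, (l0 <= l)%N -> G l v -> N v).
Hypotheses (G_sub : forall l, linear_subspace (G l))
  (Gz : forall l j v, G l v -> G l.+1 (z j v))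
  (prG : forall k l v, G l v -> pr k v = if k == l then v else 0).

(** The operator of the module that [curve_mx] is the matrix of. *)
Definition curve_form (t : nat) (v : E) : E := \sum_(j < n) t%:R ^+ j *: z j v.
Local Notation y := curve_form.

Lemma curve_formP t a v w : y t (a *: v + w) = a *: y t v + y t w.
Proof.
rewrite /y scaler_sumr -big_split; apply: eq_bigr => j _.
by rewrite linearP scalerDr !scalerA mulrC.
Qed.
Lemma curve_form0 t : y t 0 = 0.
Proof. by have := curve_formP t (-1) 0 0; rewrite !scaleN1r oppr0 addr0 addNr. Qed.
Lemma curve_formD t v w : y t (v + w) = y t v + y t w.
Proof. by rewrite -[v in LHS]scale1r curve_formP scale1r. Qed.
Lemma curve_formN t v : y t (- v) = - y t v.
Proof. by rewrite -[- v]addr0 -scaleN1r curve_formP curve_form0 addr0 scaleN1r. Qed.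
Lemma curve_form_sum t (I : Type) (r : seq I) (F : I -> E) :
  y t (\sum_(i <- r) F i) = \sum_(i <- r) y t (F i).
Proof. by apply: (big_morph (y t)); [exact: curve_formD|exact: curve_form0]. Qed.
Lemma curve_form_z t j v : y t (z j v) = z j (y t v).
Proof. by rewrite /y linear_sum; apply: eq_bigr => i _; rewrite linearZ /= zC. Qed.
Lemma curve_formC s t v : y s (y t v) = y t (y s v).
Proof.
rewrite {2 3}/y curve_form_sum; apply: eq_bigr => j _.
by rewrite -[X in y s X]addr0 curve_formP curve_form0 addr0 curve_form_z.
Qed.
Lemma curve_form_deg t l v : G l v -> G l.+1 (y t v).
Proof.
by move=> Gv; apply: subspace_sum => // j _; apply: subspaceZ => //; apply: Gz.
Qed.
Lemma curve_form_stable t J v : linear_subspace J -> stable_under z n J -> J v -> J (y t v).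
Proof.
by move=> Js Jz Jv; apply: subspace_sum => // j _; apply: subspaceZ => //; apply: Jz.
Qed.

Lemma curve_form_span J (T : seq nat) v : linear_subspace J -> uniq T -> (n <= size T)%N ->
  (forall t, t \in T -> J (y t v)) -> forall j, (j < n)%N -> J (z j v).
Proof.
move=> J_sub T_uniq le_nT JT j lt_jn.
have [|q [qP _]] := @Vandermonde_inverse K n (nth 0%N T).
  move=> i k /andP[lt_ik lt_kn]; rewrite nth_uniq ?ltn_eqF //.
    exact: leq_trans (ltn_trans lt_ik lt_kn) le_nT.
  exact: leq_trans lt_kn le_nT.
suff -> : z j v = \sum_(i < n) q i (Ordinal lt_jn) *: y (nth 0 T i) v.
  apply: subspace_sum => // i _; apply: subspaceZ => //.
  by apply/JT/mem_nth/(leq_trans (ltn_ord i)).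
under eq_bigr do rewrite scaler_sumr; rewrite exchange_big /=.
transitivity (\sum_(k < n) (Ordinal lt_jn == k)%:R *: z k v).
  rewrite (bigD1 (Ordinal lt_jn)) //= eqxx scale1r big1 ?addr0 //.
  by move=> k; rewrite eq_sym => /negPf ->; rewrite scale0r.
apply: eq_bigr => k _; rewrite -qP scaler_suml.
by apply: eq_bigr => i _; rewrite scalerA.
Qed.

Section Relative.
Variable J : E -> Prop.
Hypotheses (J_sub : linear_subspace J) (J_stab : stable_under z n J)
  (J_pr : forall l v, J v -> J (pr l v)).

(** The elements annihilated by all operators modulo J are bounded in degree: by
    Noetherianity they are sums of ones of bounded degrees modulo J, and J is
    graded. *)
Lemma socle_bound : exists c, forall l v, (c <= l)%N -> G l v ->
  (forall j, (j < n)%N -> J (z j v)) -> J v.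
Proof.
pose soc s := forall l, G l (s l) /\ forall j, (j < n)%N -> J (z j (s l)).
(* The chain of the submodules J + (socle in degrees less than a). *)
pose W a v := exists2 s : nat -> E, soc s & J (v - \sum_(l < a) s l).
have soc0 : soc (fun=> 0).
  move=> l; split=> [|j _]; first exact: subspace0.
  by rewrite linear0; apply: subspace0.
have W_sub a : linear_subspace (W a).
  split; first by exists (fun=> 0); rewrite // big1 // subr0; apply: subspace0.
  move=> c v w [s sP Jv] [s' sP' Jw]; exists (fun l => c *: s l + s' l).
    move=> l; have [[Gs Js] [Gs' Js']] := (sP l, sP' l).
    split=> [|j lt_jn]; first exact: (G_sub l).2.
    by rewrite linearP; apply: J_sub.2; auto.
  rewrite big_split -scaler_sumr opprD addrACA -scalerBr; exact: J_sub.2.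
have W_stab a : stable_under z n (W a).
  move=> j v lt_jn [s sP Jv]; exists (fun=> 0) => //; rewrite big1 // subr0.
  rewrite -(subrK (\sum_(l < a) s l) v) linearD.
  apply: subspaceD => //; first exact: J_stab.
  by rewrite linear_sum; apply: subspace_sum => // l _; apply: (sP l).2.
have W_incr a v : W a v -> W a.+1 v.
  move=> [s sP Jv]; exists (fun l => if (l < a)%N then s l else 0).
    by move=> l; case: ifP => _; [exact: sP|exact: (soc0 l)].
  rewrite big_ord_recr /= ltnn addr0; move: Jv.
  by congr (J (_ - _)); apply: eq_bigr => i _; rewrite ltn_ord.
have [a0 Ha0] := N_noeth W_sub W_stab W_incr.
exists (maxn a0 l0) => l v; rewrite geq_max => /andP[le_al le_l0l] Gv soc_v.
have [|s sP Js] := Ha0 l.+1 v (GN le_l0l Gv).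
  exists (fun k => if k == l then v else 0).
    by move=> k; case: eqP => [->|_]; [split|exact: (soc0 k)].
  rewrite big_ord_recr /= eqxx big1 => [|i _]; last by rewrite ltn_eqF.
  by rewrite add0r subrr; apply: subspace0.
have := J_pr l Js; rewrite linearB (prG _ Gv) eqxx.
rewrite linear_sum big1 ?subr0 // => i _; rewrite (prG _ (sP i).1) gtn_eqF //.
exact: leq_trans (ltn_ord i) le_al.
Qed.

(** The forms of T have common zeros outside J in arbitrarily high degrees.  In the
    language of associated primes: the forms of T lie in a common associated
    prime of M/J other than the irrelevant ideal. *)
Definition recurrent_zeros (T : seq nat) : Prop := forall c, exists l v,
  [/\ (c <= l)%N, G l v, ~ J v & forall t, t \in T -> J (y t v)].

Lemma recurrent_zeros_sub T T' : {subset T <= T'} ->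
  recurrent_zeros T' -> recurrent_zeros T.
Proof.
move=> sTT' HT c; have [l [v [le_cl Gv nJv JT]]] := HT c.
by exists l, v; split=> // t /sTT'; apply: JT.
Qed.

(** n forms of the curve span all linear forms, whose common zeros are bounded
    in degree by [socle_bound]. *)
Lemma recurrent_zeros_size T : uniq T -> recurrent_zeros T -> (size T < n)%N.
Proof.
move=> T_uniq HT; rewrite ltnNge; apply/negP => le_nT.
have [c Hc] := socle_bound; have [l [v [le_cl Gv nJv JT]]] := HT c.
exact/nJv/(Hc l)/(curve_form_span J_sub T_uniq le_nT).
Qed.

Lemma maximal_recurrent_zeros t : recurrent_zeros [:: t] -> exists T,
  [/\ t \in T, recurrent_zeros T & forall s, s \notin T -> ~ recurrent_zeros (s :: T)].
Proof.
have: uniq [:: t] by []; have: t \in [:: t] by rewrite inE.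
have: (n <= size [:: t] + n)%N by rewrite leq_addl.
elim: {2}n [:: t] => [|d IHd] T le_nT tT uT HT.
  by have := recurrent_zeros_size uT HT; rewrite ltnNge -[size T]addn0 le_nT.
have [[s [sT Hs]]|nos] := pselect (exists s, s \notin T /\ recurrent_zeros (s :: T)).
  apply: (IHd (s :: T)) => //=; rewrite ?inE ?tT ?orbT ?sT //.
  by rewrite addSn -addnS.
by exists T; split=> // s sT Hs; apply: nos; exists s.
Qed.

Lemma not_recurrent_zeros T : ~ recurrent_zeros T -> exists c, forall l v,
  (c <= l)%N -> G l v -> (forall t, t \in T -> J (y t v)) -> J v.
Proof.
move=> nT; apply: contrapT => nc; apply: nT => c; apply: contrapT => nlv.
apply: nc; exists c => l v le_cl Gv JT; apply: contrapT => nJv.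
by apply: nlv; exists l, v.
Qed.

(** The form of index t fails to be injective in high degrees when it lies in one
    of the associated primes other than the irrelevant ideal; there are finitely
    many, each containing fewer than n forms of the curve.  The finiteness is
    obtained directly from the chain condition.  For every bad index i let T_i be
    a maximal set of recurrent zeros that contains i, and let ann_i be the
    submodule of the common zeros of T_i modulo J.  The chain
    J + ann_0 + ... + ann_(a-1) is stationary from some a0 on.  Let t be a bad
    index outside T_i for all i < a0.  By maximality of T_i, which does not contain
    t, some w_i in T_i lies outside T_t; by maximality of T_t the form of index w_i
    is injective modulo J on ann_t in high degrees, while it annihilates ann_i.  Multiplying an element
    of ann_t in J + ann_0 + ... + ann_(a0-1) by the forms of index w_i, one at a
    time, shows that it is in J: a contradiction. *)
Lemma generic_injective : exists t0, forall t, (t0 <= t)%N ->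
  exists c, forall l v, (c <= l)%N -> G l v -> J (y t v) -> J v.
Proof.
pose bad t := recurrent_zeros [:: t].
suff [t0 Ht0] : exists t0, forall t, (t0 <= t)%N -> ~ bad t.
  exists t0 => t /Ht0/not_recurrent_zeros[c Hc]; exists c => l v le_cl Gv Jyv.
  by apply: Hc le_cl Gv _ => s; rewrite inE => /eqP ->.
apply: contrapT => bad_inf.
have {}bad_inf t0 : exists2 t, (t0 <= t)%N & bad t.
  apply: contrapT => no_t; apply: bad_inf; exists t0 => t le_t bad_t.
  by apply: no_t; exists t.
have /choice[Tm TmP] t : exists T, bad t -> [/\ t \in T, recurrent_zeros T &
    forall s, s \notin T -> ~ recurrent_zeros (s :: T)].
  have [/maximal_recurrent_zeros[T HT]|nbad] := pselect (bad t); first by exists T.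
  by exists [::].
pose ann s := forall i, (bad i -> forall t, t \in Tm i -> J (y t (s i)))
                     /\ (~ bad i -> s i = 0).
pose W a v := exists2 s : nat -> E, ann s & J (v - \sum_(i < a) s i).
have ann0 : ann (fun=> 0).
  by move=> i; split=> // _ t _; rewrite curve_form0; apply: subspace0.
have W_sub a : linear_subspace (W a).
  split; first by exists (fun=> 0); rewrite // big1 // subr0; apply: subspace0.
  move=> c v w [s sP Jv] [s' sP' Jw]; exists (fun i => c *: s i + s' i).
    move=> i; have [[s1 s2] [s1' s2']] := (sP i, sP' i).
    split=> [bi t Tt|nbi]; last by rewrite s2 // s2' // scaler0 addr0.
    by rewrite curve_formP; apply: J_sub.2; auto.
  rewrite big_split -scaler_sumr opprD addrACA -scalerBr; exact: J_sub.2.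
have W_stab a : stable_under z n (W a).
  move=> j v lt_jn [s sP Jv]; exists (fun i => z j (s i)).
    move=> i; have [s1 s2] := sP i; split=> [bi t Tt|/s2->]; last exact: linear0.
    by rewrite curve_form_z; apply: J_stab => //; apply: s1.
  by rewrite -(linear_sum (z j)) -linearB; apply: J_stab.
have W_incr a v : W a v -> W a.+1 v.
  move=> [s sP Jv]; exists (fun i => if (i < a)%N then s i else 0).
    by move=> i; case: ifP => _; [exact: sP|exact: (ann0 i)].
  rewrite big_ord_recr /= ltnn addr0; move: Jv.
  by congr (J (_ - _)); apply: eq_bigr => i _; rewrite ltn_ord.
have [a0 Ha0] := N_noeth W_sub W_stab W_incr.
(* The sum exceeds every element of the sets T_i with i < a0. *)
have [t le_t bad_t] := bad_inf (\sum_(i < a0) \sum_(s <- Tm i) s).+1.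
have tT i : (i < a0)%N -> t \notin Tm i.
  move=> lt_ia; apply: contraTN le_t => tTi; rewrite -leqNgt.
  rewrite (bigD1 (Ordinal lt_ia)) //= (big_rem t) //= -addnA; exact: leq_addr.
have [tTt Ht Htmax] := TmP t bad_t.
have sep i : exists s, (i < a0)%N -> bad i -> s \in Tm i /\ ~ recurrent_zeros (s :: Tm t).
  have [[lt_ia bi]|nbi] := pselect ((i < a0)%N /\ bad i); last first.
    by exists 0 => lt_ia bi; case: nbi.
  have [iTi Hi Himax] := TmP i bi.
  have /hasP[s sTi sTt] : has (fun s => s \notin Tm t) (Tm i).
    rewrite has_predC; apply: contraPN (Himax t (tT i lt_ia)) => /allP sub Himax'.
    apply: Himax'; apply: recurrent_zeros_sub Ht => s; rewrite inE.
    by case/predU1P => [->|/sub].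
  by exists s => _ _; split=> //; apply: Htmax.
have {sep} [w wP] := choice sep.
pose Q i c := bad i -> forall l v, (c <= l)%N -> G l v ->
  (forall s, s \in w i :: Tm t -> J (y s v)) -> J v.
have Q_le i a b : (a <= b)%N -> Q i a -> Q i b.
  by move=> le_ab Qa bi l v /(leq_trans le_ab); apply: Qa.
have Q_ex i : (i < a0)%N -> exists c, Q i c.
  move=> lt_ia; have [bi|nbi] := pselect (bad i); last by exists 0%N.
  have [_ /not_recurrent_zeros[c Hc]] := wP i lt_ia bi.
  by exists c => _; apply: Hc.
have [c Hc] := common_bound Q_le Q_ex.
have [l [v [le_cl Gv nJv JT]]] := Ht (maxn c l0).
move: le_cl; rewrite geq_max => /andP[le_cl le_l0l].
have [|s sP] := Ha0 t.+1 v (GN le_l0l Gv).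
  exists (fun i => if i == t then v else 0).
    move=> i; case: eqP => [->|_]; last exact: (ann0 i).
    by split=> // /(_ bad_t).
  rewrite big_ord_recr /= eqxx big1 => [|i _]; last by rewrite ltn_eqF.
  by rewrite add0r subrr; apply: subspace0.
move=> Js; apply: nJv; move: Js; move: (leqnn a0).
suff Q_r r : (r <= a0)%N -> J (v - \sum_(i < r) s i) -> J v by apply: Q_r.
(* Induction on the number of summands left: multiplication by the form of index
   w_r removes the last one. *)
elim: r l v s sP le_cl {le_l0l} Gv JT => [|r IHr] l v s sP le_cl Gv JT le_ra.
  by rewrite big_ord0 subr0.
rewrite big_ord_recr /=; have [s1 s2] := sP r.
have [bad_r|/s2->] := pselect (bad r); last by rewrite addr0; apply: (IHr l); auto using ltnW.
move=> Jv; have [w_r _] := wP r le_ra bad_r.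
have Jyv : J (y (w r) v).
  apply: (IHr l.+1 _ (fun i => y (w r) (s i))).
  - move=> i; have [u1 u2] := sP i; split=> [bi x Tx|/u2->]; last exact: curve_form0.
    by rewrite curve_formC; apply: curve_form_stable => //; apply: u1.
  - exact: leqW.
  - exact: curve_form_deg.
  - by move=> x Tx; rewrite curve_formC; apply: curve_form_stable => //; apply: JT.
  - exact: ltnW.
  rewrite -curve_form_sum -curve_formN -curve_formD.
  have -> : v - \sum_(i < r) s i = v - (\sum_(i < r) s i + s r) + s r.
    by rewrite opprD addrA subrK.
  by rewrite curve_formD; apply: subspaceD => //; [exact: curve_form_stable|exact: s1].
apply: (Hc r le_ra bad_r l) => // x; rewrite inE => /predU1P[->//|]; exact: JT.
Qed.
End Relative.

Hypotheses (pr0z : forall j v, pr 0 (z j v) = 0)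
  (prSz : forall l j v, pr l.+1 (z j v) = z j (pr l v)).

Definition curve_ideal (tau : nat -> nat) (i : nat) (v : E) : Prop :=
  exists u : nat -> E, v = \sum_(j < i) y (tau j) (u j).

Lemma curve_ideal_sub tau i : linear_subspace (curve_ideal tau i).
Proof.
split; first by exists (fun=> 0); rewrite big1 // => j _; rewrite curve_form0.
move=> a _ _ [u ->] [u' ->]; exists (fun j => a *: u j + u' j).
rewrite scaler_sumr -big_split; apply: eq_bigr => j _.
by rewrite curve_formP.
Qed.

Lemma curve_ideal_stable tau i : stable_under z n (curve_ideal tau i).
Proof.
move=> j _ _ [u ->]; exists (fun k => z j (u k)).
by rewrite linear_sum; apply: eq_bigr => k _; rewrite curve_form_z.
Qed.

Lemma curve_ideal_pr tau i l v : curve_ideal tau i v -> curve_ideal tau i (pr l v).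
Proof.
move=> [u ->]; case: l => [|l].
  exists (fun=> 0); rewrite linear_sum !big1 // => j _; first by rewrite curve_form0.
  rewrite linear_sum big1 // => k _; rewrite linearZ /= pr0z; exact: scaler0.
exists (fun j => pr l (u j)); rewrite linear_sum; apply: eq_bigr => j _.
by rewrite linear_sum; apply: eq_bigr => k _; rewrite linearZ /= prSz.
Qed.

Lemma eq_curve_ideal tau tau' i v : (forall j, (j < i)%N -> tau j = tau' j) ->
  curve_ideal tau i v -> curve_ideal tau' i v.
Proof.
by move=> eq_tau [u ->]; exists u; apply: eq_bigr => j _; rewrite eq_tau.
Qed.

(** The forms are chosen one after the other, each generic with respect to the ideal
    of the preceding ones. *)
Lemma quasiregular_curve k : exists (tau : nat -> nat) c,
  (forall i j, (i < j < k)%N -> (tau i < tau j)%N) /\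
  forall i l v, (i < k)%N -> (c <= l)%N -> G l v ->
    curve_ideal tau i (y (tau i) v) -> curve_ideal tau i v.
Proof.
elim: k => [|k [tau [c [tau_incr Hc]]]]; first by exists id, 0%N; split=> // i j; rewrite andbF.
have [t0 Ht0] := generic_injective (curve_ideal_sub tau k)
  (curve_ideal_stable (i := k)) (@curve_ideal_pr tau k).
pose t := maxn t0 (\max_(i < k) tau i).+1.
have [c' Hc'] := Ht0 t (leq_maxl _ _).
pose tau' i := if (i < k)%N then tau i else t.
have tau'E i j : (i <= k)%N -> (j < i)%N -> tau j = tau' j.
  by move=> le_ik lt_ji; rewrite /tau' (leq_trans lt_ji).
exists tau', (maxn c c'); split=> [i j|i l v].
  rewrite ltnS (leq_eqVlt j) => /andP[lt_ij /predU1P[ej|lt_jk]].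
    rewrite /tau' ej ltnn -ej lt_ij leq_max.
    have lt_ik : (i < k)%N by rewrite -ej.
    by rewrite orbC ltnS (leq_bigmax (Ordinal lt_ik)).
  by rewrite /tau' lt_jk (ltn_trans lt_ij) // tau_incr ?lt_ij.
rewrite ltnS geq_max => le_ik /andP[le_cl le_c'l] Gv.
have to_tau w : curve_ideal tau' i w -> curve_ideal tau i w.
  by apply: eq_curve_ideal => j lt_ji; rewrite (tau'E i).
move=> /to_tau Hv; apply: (eq_curve_ideal (tau := tau)) => [j|].
  exact: tau'E.
move: le_ik Hv; rewrite leq_eqVlt => /predU1P[->|lt_ik]; rewrite /tau' ?ltnn ?lt_ik.
  exact: (Hc' l v le_c'l Gv).
exact: (Hc i l v lt_ik le_cl Gv).
Qed.
End Generic.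

(** * Quasiregularity at a point *)

Section GradedMatrices.
Variables (K : numFieldType) (m : nat -> nat).
Variable A : nat -> forall l, 'M[K]_(m l, m l.+1).
Local Notation E := (nat -> nat -> K^o).

(** A graded module given by matrices has components of varying size, whereas the
    chain condition is stated for operators of one vector space.  Rows are
    therefore extended by 0 to sequences, and the components collected in
    functions of the degree. *)
Definition row_fun p (r : 'rV[K]_p) : nat -> K^o :=
  fun k => if insub k is Some i then r 0 i else 0.
Definition fun_row p (f : nat -> K^o) : 'rV[K]_p := \row_i f i.

Lemma row_funK p : cancel (@row_fun p) (fun_row p).
Proof. by move=> r; apply/rowP => i; rewrite mxE /row_fun valK. Qed.
Lemma row_fun_lin p a (r s : 'rV[K]_p) :
  row_fun (a *: r + s) = a *: row_fun r + row_fun s.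
Proof.
apply/funext => k; rewrite /row_fun !fctE.
by case: insub => [i|]; rewrite ?mxE // scaler0 addr0.
Qed.
Lemma fun_row_lin p a f g :
  fun_row p (a *: f + g) = a *: fun_row p f + fun_row p g.
Proof. by apply/rowP => i; rewrite !mxE. Qed.
Lemma row_fun0 p : row_fun (0 : 'rV[K]_p) = 0.
Proof. by apply/funext => k; rewrite /row_fun; case: insub => // i; rewrite mxE. Qed.
Lemma fun_row0 p : fun_row p 0 = 0.
Proof. by apply/rowP => i; rewrite !mxE. Qed.

Definition shift_op j (v : E) : E := fun l =>
  if l is l'.+1 then row_fun (fun_row (m l') (v l') *m A j l') else 0.

Lemma shift_op_linear j : linear (shift_op j).
Proof.
move=> a v w; apply/funext => -[|l].
  by rewrite [RHS](_ : _ = a *: 0 + 0) // scaler0 addr0.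
by rewrite /shift_op fun_row_lin mulmxDl -scalemxAl row_fun_lin.
Qed.
HB.instance Definition _ j :=
  GRing.isLinear.Build K E E *:%R (shift_op j) (shift_op_linear j).

Definition component k (v : E) : E := fun l => if l == k then v l else 0.
Lemma component_linear k : linear (component k).
Proof.
move=> a v w; apply/funext => l.
rewrite [RHS](_ : _ = a *: component k v l + component k w l) // /component.
by case: eqP => // _; rewrite scaler0 addr0.
Qed.
HB.instance Definition _ k :=
  GRing.isLinear.Build K E E *:%R (component k) (component_linear k).

Definition homog l (r : 'rV[K]_(m l)) : E := fun k => if k == l then row_fun r else 0.

Lemma shift_homog j l r : shift_op j (@homog l r) = @homog l.+1 (r *m A j l).
Proof.
apply/funext => -[|k] //=; rewrite /homog eqSS; case: eqP => [->|_].
  by rewrite row_funK.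
by rewrite fun_row0 mul0mx row_fun0.
Qed.

Hypothesis A_comm : forall j k l, A j l *m A k l.+1 = A k l *m A j l.+1.
Variables (n l0 : nat).
Hypothesis A_gen : forall l (v : 'rV[K]_(m l.+1)), (l0 <= l)%N ->
  exists u : nat -> 'rV[K]_(m l), v = \sum_(j < n) u j *m A j l.

Lemma shift_opC i j v : shift_op i (shift_op j v) = shift_op j (shift_op i v).
Proof.
apply/funext => -[|[|l]] //=; first by rewrite fun_row0 !mul0mx.
by rewrite !row_funK -!mulmxA A_comm.
Qed.

Lemma homog_lin l a r s : @homog l (a *: r + s) = a *: homog r + homog s.
Proof.
apply/funext => k; rewrite [RHS](_ : _ = a *: homog r k + homog s k) // /homog.
by case: eqP => // _; rewrite ?row_fun_lin // scaler0 addr0.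
Qed.

Lemma homog0 l : @homog l 0 = 0.
Proof. by apply/funext => k; rewrite /homog row_fun0; case: ifP. Qed.
Lemma homogZ l a r : @homog l (a *: r) = a *: homog r.
Proof. by rewrite -[a *: r]addr0 homog_lin homog0 addr0. Qed.

Lemma homog_sum l I (r : seq I) (F : I -> 'rV[K]_(m l)) :
  homog (\sum_(i <- r) F i) = \sum_(i <- r) homog (F i).
Proof.
elim/big_rec2: _ => [|i x y _ <-]; first exact: homog0.
by rewrite -[F i]scale1r homog_lin !scale1r.
Qed.

Lemma homogK l (r : 'rV[K]_(m l)) : fun_row (m l) (homog r l) = r.
Proof. by rewrite /homog eqxx row_funK. Qed.

Lemma curve_form_homog t l r :
  curve_form shift_op n t (@homog l r) = @homog l.+1 (r *m curve_mx n A t l).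
Proof.
rewrite /curve_mx mulmx_sumr homog_sum; apply: eq_bigr => j _.
by rewrite -scalemxAr homogZ -shift_homog.
Qed.

Lemma curve_form_fun_row t (v : E) l :
  fun_row (m l.+1) (curve_form shift_op n t v l.+1) = fun_row (m l) (v l) *m curve_mx n A t l.
Proof.
rewrite /curve_form fct_sumE fct_sumE /curve_mx mulmx_sumr.
transitivity (\sum_(j < n) fun_row (m l.+1) (t%:R ^+ j *: shift_op j v l.+1)).
  by apply/rowP => i; rewrite mxE summxE; apply: eq_bigr => j _; rewrite mxE.
apply: eq_bigr => j _; rewrite -[X in fun_row _ X]addr0 fun_row_lin fun_row0 addr0.
by rewrite row_funK scalemxAr.
Qed.

Definition basis_vector i : E := homog (\row_j (j == i :> nat)%:R : 'rV_(m l0)).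

(** In degrees at least l0 the module is generated by the unit vectors of degree
    l0. *)
Lemma homog_generated l (r : 'rV_(m l)) : (l0 <= l)%N ->
  generated shift_op basis_vector (m l0) n
    (homog r).
Proof.
set e := basis_vector.
have [gen_sub gen_stab _] := hilbert_basis shift_opC e (m l0) n.
move=> /subnK; move: (l - l0)%N => d el; case: l / el r.
elim: d => [|d IHd] r.
  apply: span_generated.
  have -> : homog r = \sum_(i < m l0) r 0 i *: e i.
    rewrite [in LHS](row_sum_delta r) homog_sum; apply: eq_bigr => i _.
    rewrite homogZ; congr (_ *: homog _); apply/rowP => j.
    by rewrite !mxE eqxx.
  have := span_upto_sum e (m l0) (row_fun r); congr span_upto.
  by apply: eq_bigr => i _; rewrite /row_fun valK.
have [u ->] := A_gen r (leq_addl _ _).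
rewrite homog_sum; apply: subspace_sum => // j _.
by rewrite -shift_homog; apply: gen_stab.
Qed.

Lemma quasiregular_curve_mx : exists (tau : nat -> nat) c,
  (forall i j, (i < j < n)%N -> (tau i < tau j)%N) /\
  forall i l (u : nat -> 'rV[K]_(m l.+1)) (r : 'rV[K]_(m l.+1)), (i < n)%N -> (c <= l)%N ->
    r *m curve_mx n A (tau i) l.+1 = \sum_(j < i) u j *m curve_mx n A (tau j) l.+1 ->
    exists w : nat -> 'rV[K]_(m l), r = \sum_(j < i) w j *m curve_mx n A (tau j) l.
Proof.
set e := basis_vector.
pose G l (v : E) := exists r : 'rV_(m l), v = homog r.
have [_ _ gen_noeth] := hilbert_basis shift_opC e (m l0) n.
have GN l v : (l0 <= l)%N -> G l v -> generated shift_op e (m l0) n v.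
  by move=> le_l [r ->]; apply: homog_generated.
have G_sub l : linear_subspace (G l).
  split; first by exists 0; rewrite homog0.
  by move=> a _ _ [r ->] [s ->]; exists (a *: r + s); rewrite homog_lin.
have Gz l j v : G l v -> G l.+1 (shift_op j v).
  by move=> [r ->]; eexists; apply: shift_homog.
have prG k l v : G l v -> component k v = if k == l then v else 0.
  move=> [r ->]; apply/funext => l'; rewrite /component /homog.
  by have [->|] := eqVneq k l; case: ifP => // /eqP ->; [case: eqP|move/negPf->].
have pr0z j v : component 0 (shift_op j v) = 0.
  by apply/funext => -[].
have prSz l j v : component l.+1 (shift_op j v) = shift_op j (component l v).
  apply/funext => -[|k] //=; rewrite /component eqSS.
  by case: eqP => // _; rewrite fun_row0 mul0mx row_fun0.
have [tau [c [tau_incr Hc]]] :=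
  quasiregular_curve shift_opC gen_noeth GN G_sub Gz prG pr0z prSz n.
exists tau, c; split=> // i l u r lt_in le_cl Er.
have [||w Hw] := Hc i l.+1 (homog r) lt_in (leqW le_cl); first by exists r.
  exists (fun j => homog (u j)); rewrite curve_form_homog Er homog_sum.
  by apply: eq_bigr => j _; rewrite curve_form_homog.
exists (fun j => fun_row (m l) (w j l)); rewrite -[LHS]homogK Hw.
rewrite fct_sumE; transitivity (\sum_(j < i) fun_row (m l.+1) (curve_form shift_op n (tau j) (w j) l.+1)).
  by apply/rowP => k; rewrite mxE summxE fct_sumE; apply: eq_bigr => j _; rewrite mxE.
by apply: eq_bigr => j _; rewrite curve_form_fun_row.
Qed.
End GradedMatrices.

Lemma mxrank_adds_coker (K : fieldType) p q r (X : 'M[K]_(p, r)) (Y : 'M[K]_(q, r)) :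
  \rank (X + Y)%MS = (\rank X + \rank (Y *m cokermx X))%N.
Proof.
apply/eqP; rewrite -(eqn_add2r (\rank (X :&: Y)%MS)) mxrank_sum_cap.
rewrite -addnA eqn_add2l -(mxrank_mul_ker Y (cokermx X)) eqn_add2l.
rewrite capmxC; apply/eqP.
have kerX : (kermx (cokermx X) :=: X)%MS.
  apply/eqmxP/andP; split; first by rewrite submxE mulmx_ker.
  by apply/sub_kermxP; rewrite mulmx_coker.
by case: (cap_eqmx kerX (eqmx_refl Y)).
Qed.

Section RankCount.
Variables (K : fieldType) (n : nat) (m : nat -> nat).
Variable C : nat -> forall l, 'M[K]_(m l, m l.+1).
Hypothesis C_comm : forall j k l, C j l *m C k l.+1 = C k l *m C j l.+1.
Variable c : nat.
Hypothesis C_gen : forall l (v : 'rV[K]_(m l.+1)), (c <= l)%N ->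
  exists u : nat -> 'rV[K]_(m l), v = \sum_(j < n) u j *m C j l.
Hypothesis C_quasi : forall k l (u : nat -> 'rV[K]_(m l.+1)) (r : 'rV[K]_(m l.+1)),
  (k < n)%N -> (c <= l)%N ->
  r *m C k l.+1 = \sum_(k.+1 <= j < n) u j *m C j l.+1 ->
  exists w : nat -> 'rV[K]_(m l), r = \sum_(k.+1 <= j < n) w j *m C j l.

Definition tail_mx k l : 'M[K]_(m l.+1) := (\sum_(k <= j < n) <<C j l>>)%MS.

Lemma tail_mxP k l (v : 'rV_(m l.+1)) :
  reflect (exists u : nat -> 'rV[K]_(m l), v = \sum_(k <= j < n) u j *m C j l)
          (v <= tail_mx k l)%MS.
Proof.
rewrite /tail_mx big_nat_cond big_mkcond /= -big_mkcond /=.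
apply: (iffP idP) => [|[u ->]]; last first.
  rewrite big_nat_cond; apply: summx_sub => j le_j.
  rewrite (big_rem j) ?mem_index_iota; last by rewrite andbT in le_j.
  by rewrite /= le_j (submx_trans _ (addsmxSl _ _)) // genmxE submxMl.
rewrite -big_nat_cond; elim: {k}(n - k)%N {-2}k (leqnn (n - k)) v => [|d IHd] k.
  rewrite leqn0 subn_eq0 => le_nk v; rewrite big_geq // submx0 => /eqP ->.
  by exists (fun=> 0); rewrite big_geq.
have [le_nk _ v|lt_kn] := leqP n k.
  rewrite big_geq // submx0 => /eqP ->.
  by exists (fun=> 0); rewrite big_geq.
move=> le_kd v.
rewrite big_ltn // => /sub_addsmxP[[x y] /= ->].
have [u Hu] : exists u : nat -> 'rV[K]_(m l),
    y *m (\sum_(k.+1 <= j < n) <<C j l>>)%MS = \sum_(k.+1 <= j < n) u j *m C j l.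
  by apply: IHd; [rewrite subnS; move: le_kd; case: (n - k)%N | apply: submxMl].
have /submxP[x' Ex] : (x *m <<C k l>> <= C k l)%MS.
  by rewrite (submx_trans (submxMl _ _)) // genmxE.
exists (fun j => if j == k then x' else u j); rewrite Hu Ex [RHS]big_ltn // eqxx.
congr (_ + _); apply: eq_big_nat => j /andP[lt_kj _].
by rewrite gtn_eqF.
Qed.

(** Exactness of Q (k + 1)_l -> Q (k + 1)_(l+1) -> Q k_(l+1) -> 0 for
    Q k = M / (C k, ..., C (n - 1)) M, with the first map, the multiplication by
    C k, injective by quasiregularity. *)
Lemma rank_tail k l : (k < n)%N -> (c <= l)%N ->
  \rank (tail_mx k l.+1) = (\rank (tail_mx k.+1 l.+1) + (m l.+1 - \rank (tail_mx k.+1 l)))%N.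
Proof.
move=> lt_kn le_cl; rewrite {1}/tail_mx big_ltn //.
rewrite addsmxC -/(tail_mx k.+1 l.+1) (adds_eqmx (eqmx_refl _) (genmxE _)).
rewrite mxrank_adds_coker; congr addn.
rewrite -mxrank_ker; set Q := C k l.+1 *m _; rewrite -(subKn (rank_leq_row Q)).
rewrite mxrank_ker; congr (_ - _)%N; rewrite -mxrank_ker.
apply/eqmx_rank/andP; split; apply/row_subP => i.
  set r := row i _; have : r *m Q = 0 by rewrite -row_mul mulmx_ker row0.
  rewrite mulmxA => /eqP; rewrite -submxE => /tail_mxP[u /C_quasi[//|//|w ->]].
  by apply/tail_mxP; exists w.
have /tail_mxP[u ->] := row_sub i (tail_mx k.+1 l).
apply/sub_kermxP; rewrite mulmxA; apply/eqP; rewrite -submxE.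
apply/tail_mxP; exists (fun j => u j *m C k l).
by rewrite mulmx_suml; apply: eq_bigr => j _; rewrite -!mulmxA C_comm.
Qed.

Definition cogens k : 'M[K]_(\rank (tail_mx k c)^C, m c.+1) := row_base (tail_mx k c)^C%MS.

(** That the complement and the ideal generate is recorded as a matrix identity with
    explicit coefficients X and Y: lifted to functions near the point, the left
    hand side remains invertible. *)
Lemma cogens_gen k : exists X (Y : nat -> 'M[K]_(m c.+1, m c)),
  X *m cogens k + \sum_(k <= i < n) Y i *m C i c = 1%:M.
Proof.
have full i : exists (x : 'rV_(\rank (tail_mx k c)^C%MS)) (y : nat -> 'rV[K]_(m c)),
    row i 1%:M = x *m cogens k + \sum_(k <= i < n) y i *m C i c.
  have : (row i (1%:M : 'M[K]_(m c.+1)) <= (tail_mx k c)^C + tail_mx k c)%MS.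
    by rewrite addsmxC (submx_trans (submx1 _)) // sub1mx addsmx_compl_full.
  case/sub_addsmxP => -[a b] /= ->.
  have /tail_mxP[y ->] : (b *m tail_mx k c <= tail_mx k c)%MS by apply: submxMl.
  have /submxP[x ->] : (a *m (tail_mx k c)^C <= cogens k)%MS.
    by rewrite eq_row_base submxMl.
  by exists x, y.
have /fin_all_exists[x /fin_all_exists[y Hxy]] := full.
exists (\matrix_i x i), (fun j => \matrix_i y i j); apply/row_matrixP => i.
rewrite Hxy linearD /= row_mul rowK linear_sum; congr (_ + _).
by apply: eq_bigr => j _; rewrite /= row_mul rowK.
Qed.

Lemma tail_mx_full l : (c <= l)%N -> \rank (tail_mx 0 l) = m l.+1.
Proof.
move=> le_cl; apply/eqP; rewrite -/(row_full _) -sub1mx; apply/row_subP => i.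
by apply/tail_mxP; have [u ->] := C_gen (row i 1%:M) le_cl; exists u; rewrite big_mkord.
Qed.

(** Quasiregularity makes the expected ranks the true ones at the point. *)
Lemma dims_rank t k : (k <= n)%N ->
  dims (fun k => \rank (tail_mx k c)^C%MS) t k = (m (t + c).+1 - \rank (tail_mx k (t + c)))%N.
Proof.
elim: t k => [|t IHt] k; first by rewrite /= mxrank_compl.
elim: k => [_|k IHk lt_kn]; first by rewrite tail_mx_full ?subnn // leq_addl.
rewrite dimsS IHt // IHk 1?ltnW // [(t.+1 + c)%N]addSn.
have := rank_leq_row (tail_mx k (t + c).+1).
rewrite rank_tail ?leq_addl //; move: (_ - _)%N => a le_m.
by rewrite subnDA subnKC // leq_subRL // (leq_trans (leq_addr _ _) le_m).
Qed.

Lemma dims_rank_total t :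
  dims (fun k => \rank (tail_mx k c)^C%MS) t.+1 n = m (t.+1 + c).+1.
Proof. by rewrite dims_rank // /tail_mx big_geq // mxrank0 subn0. Qed.
End RankCount.

Section Point.
Variables (K : numFieldType) (m : nat -> nat) (n l0 : nat).
Variable M : nat -> forall l, 'M[K]_(m l, m l.+1).
Hypothesis M_comm : forall j k l, M j l *m M k l.+1 = M k l *m M j l.+1.
Hypothesis M_gen : forall l (v : 'rV[K]_(m l.+1)), (l0 <= l)%N ->
  exists u : nat -> 'rV[K]_(m l), v = \sum_(j < n) u j *m M j l.

(** The forms are numbered backwards, so that the ideal of the first n - k ones is
    the tail ideal of index k. *)
Definition rev_curve (A : comPzRingType) (M' : nat -> forall l, 'M[A]_(m l, m l.+1))
  (tau : nat -> nat) k l := curve_mx n M' (tau (n - k.+1)%N) l.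

(** What is kept of quasiregularity at the point is finite: a condition of
    invertibility in the single degree c + 1, and numerical identities between the
    ranks in all degrees. *)
Theorem quasiregular_point : exists (tau : nat -> nat) (c : nat) (d0 : nat -> nat)
    (S : forall k, 'M[K]_(d0 k, m c.+1)) (X : forall k, 'M[K]_(m c.+1, d0 k))
    (Y : nat -> nat -> 'M[K]_(m c.+1, m c)),
  [/\ forall i j, (i < j < n)%N -> tau i != tau j, (l0 <= c)%N,
      forall k, X k *m S k + \sum_(k <= i < n) Y k i *m rev_curve M tau i c = 1%:M &
      forall t, dims d0 t.+1 n = m (t.+1 + c).+1].
Proof.
have [tau [c0 [tau_incr quasi]]] := quasiregular_curve_mx M_comm M_gen.
have tau_inj i j : (i < j < n)%N -> tau i != tau j by move=> /tau_incr/ltn_eqF->.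
have [q [qP _]] := Vandermonde_inverse K tau_inj.
pose c := maxn c0 l0; pose C := rev_curve M tau.
have le_l0c : (l0 <= c)%N by rewrite leq_maxr.
have C_comm j k l : C j l *m C k l.+1 = C k l *m C j l.+1 by apply: curve_mx_comm.
have C_gen l (v : 'rV[K]_(m l.+1)) : (c <= l)%N ->
    exists u : nat -> 'rV[K]_(m l), v = \sum_(j < n) u j *m C j l.
  move=> le_cl; have [u Hu] := M_gen v (leq_trans le_l0c le_cl).
  have [w ->] := curve_mx_gen qP Hu; exists (fun i => w (n - i.+1)%N).
  rewrite -(big_mkord xpredT (fun i => w (n - i.+1)%N *m C i l)).
  by rewrite (sum_tail_rev (fun j => w j *m curve_mx n M (tau j) l)) // subn0.
have C_quasi k l (u : nat -> 'rV[K]_(m l.+1)) (r : 'rV[K]_(m l.+1)) :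
    (k < n)%N -> (c <= l)%N ->
    r *m C k l.+1 = \sum_(k.+1 <= j < n) u j *m C j l.+1 ->
    exists w : nat -> 'rV[K]_(m l), r = \sum_(k.+1 <= j < n) w j *m C j l.
  move=> lt_kn le_cl; rewrite (sum_tail_rev_mx u (fun j => curve_mx n M (tau j) l.+1)) //.
  have lt_i : (n - k.+1 < n)%N by rewrite ltn_subrL (leq_ltn_trans _ lt_kn).
  have le_c0l : (c0 <= l)%N by rewrite (leq_trans _ le_cl) // leq_maxl.
  case/(quasi _ _ (fun j => u (n - j.+1)%N) _ lt_i le_c0l) => w ->.
  exists (fun j => w (n - j.+1)%N).
  by rewrite (sum_tail_rev (fun j => w j *m curve_mx n M (tau j) l)).
pose X k := projT1 (cid (cogens_gen n C c k)).
have /choice[Y HXY] k := projT2 (cid (cogens_gen n C c k)).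
exists tau, c, (fun k => \rank (tail_mx n C k c)^C%MS), (cogens n C c), X, Y.
by split=> // t; apply: dims_rank_total.
Qed.
End Point.

(** * Quasiregularity over a ring *)

Section QuasiregularRing.
Variables (A : comPzRingType) (m : nat -> nat) (n l0 : nat).
Variable M : nat -> forall l, 'M[A]_(m l, m l.+1).
Hypothesis M_comm : forall j k l, M j l *m M k l.+1 = M k l *m M j l.+1.
Hypothesis M_gen : forall l (v : 'rV[A]_(m l.+1)), (l0 <= l)%N ->
  exists u : nat -> 'rV[A]_(m l), v = \sum_(j < n) u j *m M j l.
Variables (tau : nat -> nat) (q : 'M[A]_n).
Hypothesis qP : forall j k : 'I_n, \sum_(i < n) q i j * (tau i)%:R ^+ k = (j == k)%:R.
Local Notation C := (rev_curve n M tau).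
Local Notation B := (fun j l => curve_mx n M (tau j) l).

Variables (c : nat) (d0 : nat -> nat) (S : forall k, 'M[A]_(d0 k, m c.+1))
  (X : forall k, 'M[A]_(m c.+1, d0 k)) (Y : nat -> nat -> 'M[A]_(m c.+1, m c))
  (W : nat -> 'M[A]_(m c.+1)).
Hypothesis le_l0c : (l0 <= c)%N.
Hypothesis W_inv : forall k, (k <= n)%N ->
  W k *m (X k *m S k + \sum_(k <= i < n) Y k i *m C i c) = 1%:M.
Hypothesis dims_total : forall t, dims d0 t.+1 n = m (t.+1 + c).+1.

(** The finite information of [quasiregular_point], once it holds over the ring A,
    gives injectivity in every degree from c + 1 on, by
    [quasiregular_propagation] with degrees shifted by c + 1. *)
Theorem quasiregular_ring i l (v : 'rV[A]_(m l.+1)) (u : nat -> 'rV[A]_(m l.+1)) :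
  (i < n)%N -> (c <= l)%N ->
  v *m B i l.+1 = \sum_(j < i) u j *m B j l.+1 ->
  exists w : nat -> 'rV[A]_(m l), v = \sum_(j < i) w j *m B j l.
Proof.
move=> lt_in /subnK; move: (l - c)%N => t el; case: l / el v u => v u Hv.
pose m' t := m (t + c).+1.
pose C' k t : 'M[A]_(m' t, m' t.+1) := C k (t + c).+1.
pose J0 k (v : 'rV[A]_(m' 0%N)) := exists u : nat -> 'rV[A]_(m c),
  v = \sum_(k <= i < n) u i *m C i c.
have C_comm j k l : C j l *m C k l.+1 = C k l *m C j l.+1 by apply: curve_mx_comm.
have C'_comm j k t1 : C' j t1 *m C' k t1.+1 = C' k t1 *m C' j t1.+1 by apply: C_comm.
have C'_gen t1 (v1 : 'rV[A]_(m' t1.+1)) :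
    exists u1 : nat -> 'rV[A]_(m' t1), v1 = \sum_(j < n) u1 j *m C' j t1.
  have le_l : (l0 <= (t1 + c).+1)%N by rewrite (leq_trans le_l0c) // leqW ?leq_addl.
  have [u1 Hu1] := @M_gen (t1 + c).+1 v1 le_l; have [w ->] := @curve_mx_gen A m n M tau q (t1 + c).+1 v1 u1 qP Hu1.
  exists (fun i => w (n - i.+1)%N).
  rewrite -(big_mkord xpredT (fun i => w (n - i.+1)%N *m C' i t1)).
  by rewrite (sum_tail_rev (fun j => w j *m B j _)) // subn0.
have J0_mul k j v1 : J0 k v1 -> exists u1 : nat -> 'rV[A]_(m' 0%N),
    v1 *m C' j 0%N = \sum_(k <= i < n) u1 i *m C' i 0%N.
  move=> [u1 ->]; exists (fun i => u1 i *m C j c); rewrite mulmx_suml.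
  by apply: eq_bigr => i' _; rewrite -!mulmxA; congr (_ *m _); apply: C_comm.
have J0_add k v1 v2 : J0 k v1 -> J0 k v2 -> J0 k (v1 + v2).
  move=> [u1 ->] [u2 ->]; exists (fun i => u1 i + u2 i).
  by rewrite -big_split; apply: eq_bigr => i' _; rewrite mulmxDl.
have S_gen k : (k <= n)%N -> forall v1 : 'rV[A]_(m' 0%N),
    exists a : 'rV_(d0 k), J0 k (v1 - a *m S k).
  move=> le_kn v1; exists (v1 *m W k *m X k); exists (fun i => v1 *m W k *m Y k i).
  have E : v1 = v1 *m W k *m X k *m S k + \sum_(k <= i < n) v1 *m W k *m Y k i *m C i c.
    rewrite -{1}[v1]mulmx1 -(W_inv le_kn) mulmxA mulmxDr mulmxA mulmx_sumr.
    by congr (_ + _); apply: eq_bigr => i' _; rewrite mulmxA.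
  by rewrite {1}E addrAC subrr add0r.
pose k := (n - i.+1)%N; have lt_kn : (k < n)%N by rewrite ltn_subrL (leq_ltn_trans _ lt_in).
have Ei : (n - k.+1)%N = i by rewrite rev_index.
have tailE t1 v1 : @tail_ideal A n m' C' J0 k.+1 t1 v1 <->
    exists u1 : nat -> 'rV[A]_(m (t1 + c)), v1 = \sum_(k.+1 <= i < n) u1 i *m C i (t1 + c)%N.
  by case: t1 v1.
have := @quasiregular_propagation A n m' C' C'_comm C'_gen J0 J0_mul d0 S S_gen
  dims_total J0_add t k v lt_kn.
rewrite !tailE => -[|w ->].
  exists (fun j => u (n - j.+1)%N); rewrite (sum_tail_rev (fun j => u j *m B j _)) //.
  by rewrite Ei -Hv /C' /rev_curve Ei.
exists (fun j => w (n - j.+1)%N).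
by rewrite (sum_tail_rev_mx w (fun j => B j (t + c)%N)) // Ei.
Qed.
End QuasiregularRing.

(** * Involutivity of the filtration of a frame *)

Section Involutive.
Context {R : realType}.
Variable V : open_set R.
Local Notation F := (smoothfn V).
Local Notation vec := (nat -> F^o).
Local Notation d := (partials V).
Implicit Types v w Z : vec.
Variables (m : nat -> nat) (f g : nat -> nat -> vec).
Hypothesis Fr : frame m f g.
Hypothesis lie_frame : forall l j k, (j < m 0)%N -> (k < m l.+1)%N ->
  filt m g l.+1 (lieF d (g 0 j) (f l.+1 k)).

Definition image_of (P : vec -> Prop) : set (coefs R) := [set ofF w | w in P].
Definition filt_set l : set (coefs R) := image_of (filt m g l).
Definition contact_set : set (coefs R) := image_of (contact m g).
Local Notation H := (perp V contact_set).

Lemma image_ofP P w : image_of P (ofF w) <-> P w.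
Proof. by split=> [[w' Pw' /ofF_inj <-]|Pw]; last exists w. Qed.

Lemma submodule_image P : (forall w, P w -> fin w) -> P 0 ->
  (forall v w, P v -> P w -> P (v + w)) -> (forall a w, P w -> P (a *: w)) ->
  submodule V (image_of P).
Proof.
move=> Pf P0 PD PZ; split.
- by move=> _ [w /Pf fw <-]; apply/formsP; exists w.
- by exists 0.
- by move=> _ _ [v Pv <-] [w Pw <-]; exists (v + w); first exact: PD.
- move=> a _ Va [w Pw <-]; have [b {Va}->] := smoothfn_of Va.
  by exists (b *: w); first exact: PZ.
Qed.

Lemma filt_set_submodule l : submodule V (filt_set l).
Proof.
apply: submodule_image; [exact: filt_fin|exact: filt0| |].
  by move=> v w; apply: filtD.
by move=> a w; apply: filtZ.
Qed.

Lemma forms_submodule : submodule V (forms V).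
Proof.
have -> : forms V = image_of (@fin F).
  by apply/seteqP; split=> W; [move=> /formsP[w fw ->]; exists w|move=> [w fw <-]; apply/formsP; exists w].
apply: submodule_image => //; [exact: fin0|exact: finD|exact: finZ].
Qed.

Lemma Fspan_submodule S : S `<=` forms V -> submodule V (Fspan V S).
Proof.
move=> Sf; split.
- by move=> W; apply: smallest_sub => //; apply: forms_submodule.
- by move=> T [[_ T0 _ _] _].
- by move=> v w Sv Sw T TS; have [[_ _ TD _] _] := TS; apply: TD; [apply: Sv|apply: Sw].
- by move=> a w Va Sw T TS; have [[_ _ _ TZ] _] := TS; apply: TZ => //; apply: Sw.
Qed.

Lemma contact_set_filt W : contact_set W <-> exists l, filt_set l W.
Proof.
split=> [[w /(contact_filt Fr)[l fw] <-]|[l [w fw <-]]].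
  by exists l, w.
by exists w => //; apply: filt_contact fw.
Qed.

Lemma contact_set_submodule : submodule V contact_set.
Proof.
have le_max l l' w : filt m g l w -> filt m g (maxn l l') w.
  exact/filt_leW/leq_maxl.
apply: submodule_image; [by move=> w []| | |].
- exact: (filt_contact (filt0 m g 0)).
- move=> v w /(contact_filt Fr)[l fv] /(contact_filt Fr)[l' fw].
  apply: filt_contact; apply: filtD; first exact: le_max fv.
  by rewrite maxnC; apply: le_max fw.
- by move=> a w /(contact_filt Fr)[l fw]; apply: filt_contact; apply: filtZ fw.
Qed.

Lemma HP Z : H (ofF Z) <-> annih m f Z.
Proof.
apply: (perp_annih contact_set_submodule Fr) => w; exact: image_ofP.
Qed.

Lemma H_vec Y : H Y -> exists2 Z, Y = ofF Z & annih m f Z.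
Proof.
move=> HY; have /vfieldsP[Z EZ] := HY.1; exists Z => //.
by apply/HP; rewrite -EZ.
Qed.

Lemma lie_filt_set l Y W : H Y -> filt_set l W -> filt_set l.+1 (lie V Y W).
Proof.
move=> /H_vec[Z -> aZ] [w fw <-]; rewrite lie_ofF; last exact: filt_fin fw.
by exists (lieF d Z w) => //; apply: (lie_filt Fr lie_frame aZ fw).
Qed.

Lemma lie_module_sub l : lie_module V H (filt_set l) `<=` filt_set l.+1.
Proof.
apply: smallest_sub; first exact: filt_set_submodule.
by move=> _ [Y HY [W fW <-]]; apply: lie_filt_set.
Qed.

Definition free_basis (P : vec -> Prop) : Prop := exists k (e : 'I_k -> vec),
  [/\ forall i, P (e i), forall w, P w -> exists a : 'I_k -> F, w = \sum_i a i *: e i &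
      forall a : 'I_k -> F, \sum_i a i *: e i = 0 -> forall i, a i = 0].

Lemma free_basis_finite_rank P : free_basis P -> finite_rank V (image_of P).
Proof.
move=> [k [e [Pe e_span e_free]]]; exists k, (fun i => ofF (e i)).
have comb (a : 'I_k -> fn R) (Va : forall i, functions_on V (a i)) :
    \sum_i fscale (a i) (ofF (e i)) = ofF (\sum_i mk_smoothfn (Va i) *: e i).
  by rewrite ofF_sum.
split=> [i|_ [w Pw <-]|a Va]; first by apply/image_ofP.
- have [a ->] := e_span w Pw; exists (fun i => val (a i)) => [i|]; first exact: smoothfnP.
  by rewrite ofF_sum /set1 /= subrr.
rewrite (comb a Va) => e0 i.
have /e_free/(_ i)/(congr1 val) := @ofF_inj R V _ 0 e0.
by [].
Qed.

(** Each step of the filtration splits: a basis is extended by the frame elements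
    of the next level. *)
Lemma free_basis_filt l : free_basis (filt_pred m g l) -> free_basis (filt m g l).
Proof.
move=> [k [e [Pe e_span e_free]]].
exists (k + m l.+1)%N, (fun i : 'I_(k + m l.+1) => match fintype.split i with inl j => e j | inr j => f l.+1 j end).
have comb (a : 'I_(k + m l.+1) -> F) :
    \sum_i a i *: match fintype.split i with inl j => e j | inr j => f l.+1 j end =
    \sum_i a (lshift _ i) *: e i + unsymbol f (\row_j a (rshift k j)).
  rewrite big_split_ord; congr (_ + _); apply: eq_bigr => i _.
    by rewrite (unsplitK (inl i)).
  by rewrite (unsplitK (inr i)) mxE.
split.
- move=> i; case: fintype.split => j; first exact/filt_pred_sub.
  exact: (filt_frame Fr).
- move=> w fw; have [a Ea] := e_span _ (filt_rest Fr fw).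
  exists (fun i : 'I_(k + m l.+1) => match fintype.split i with inl j => a j | inr j => symbol m g l w 0 j end).
  rewrite comb -[LHS](subrK (unsymbol f (symbol m g l w))) Ea; congr (_ + _).
    by apply: eq_bigr => i _; rewrite (unsplitK (inl i)).
  by congr unsymbol; apply/rowP => j; rewrite [RHS]mxE (unsplitK (inr j)).
move=> a; rewrite comb => E0.
have fp : filt_pred m g l (\sum_i a (lshift _ i) *: e i).
  case: l e Pe a {comb e_span e_free E0} => [|l] e Pe a /=.
    by rewrite big1 // => i _; rewrite (Pe i : _ = 0) scaler0.
  by apply: filt_sum => i _; apply/filtZ/Pe.
have row0 : \row_j a (rshift k j) = 0.
  rewrite -(unsymbolK Fr (\row_j a (rshift k j))).
  move/eqP: E0; rewrite addrC addr_eq0 => /eqP ->; rewrite -scaleN1r.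
  rewrite symbolZ ?(symbol_pred fp) ?scaler0 //.
  exact: filt_fin (filt_pred_sub fp).
move=> i; case: (split_ordP i) => j ->; last by have /rowP/(_ j) := row0; rewrite !mxE.
apply: (e_free (fun i => a (lshift _ i))); move: E0; rewrite row0.
by rewrite /unsymbol [X in _ + X]big1 ?addr0 // => i' _; rewrite mxE scale0r.
Qed.

Lemma filt_free_basis l : free_basis (filt m g l).
Proof.
elim: l => [|l IHl]; apply: free_basis_filt; last exact: IHl.
exists 0%N, (fun _ => 0); split=> [i //|w ->|a _ []//].
by exists (fun _ => 0); rewrite big_ord0.
Qed.

Variable l0 : nat.
Hypothesis frame_gen : forall l k, (l0 <= l)%N -> (k < m l.+2)%N ->
  exists2 u : nat -> vec, forall j, filt m g l (u j) &
    filt m g l (f l.+2 k - \sum_(j < m 0) lieF d (g 0 j) (u j)).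

Lemma filt_set_gen l : (l0 <= l)%N ->
  sum_modules (filt_set l) (lie_module V H (filt_set l)) = filt_set l.+1.
Proof.
move=> le_l; apply/seteqP; split=> [_ [_ [v fv <-] [W /lie_module_sub[w fw <-] <-]]|_ [w fw <-]].
  by exists (v + w) => //; apply: filtD fw; apply: (filt_leW (leqnSn l)).
have [u fu fr] := filt_gen Fr lie_frame frame_gen le_l fw.
exists (ofF (w - \sum_(j < m 0) lieF d (g 0 j) (u j))); first exact/image_ofP.
exists (ofF (\sum_(j < m 0) lieF d (g 0 j) (u j))); last by rewrite -ofFD subrK.
have gens_f : [set lie V Z w | Z in H & w in filt_set l] `<=` forms V.
  move=> _ [Y HY [W fW <-]]; have [Wf _ _ _] := filt_set_submodule l.+1.
  exact/Wf/lie_filt_set.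
apply: submodule_sum; first exact: Fspan_submodule.
move=> j _; apply: sub_gen_smallest; exists (ofF (g 0%N j)).
  exact/HP/(annih_dual Fr).
exists (ofF (u j)); first exact/image_ofP.
by rewrite lie_ofF //; apply: filt_fin (fu j).
Qed.

Lemma filt_set_le l l' : (l <= l')%N -> filt_set l `<=` filt_set l'.
Proof. by move=> le_l _ [w fw <-]; exists w => //; apply: filt_leW fw. Qed.

Lemma clift_good c : good_filtration V contact_set (clift c filt_set).
Proof.
split.
- move=> l; split; first exact: filt_set_submodule.
  exact/free_basis_finite_rank/filt_free_basis.
- by move=> l; apply: filt_set_le.
- apply/seteqP; split=> [W /contact_set_filt[l fW]|W [l _ fW]].
    by exists l => //; apply: filt_set_le fW; apply: leq_addr.
  by apply/contact_set_filt; exists (l + c)%N.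
- by move=> l; apply: lie_module_sub.
exists l0 => l le_l; apply: filt_set_gen; exact: leq_trans (leq_addr _ _).
Qed.

Variables (tau : nat -> nat) (q : 'M[F]_(m 0)).
Hypothesis qP : forall j k : 'I_(m 0), \sum_(i < m 0) q i j * (tau i)%:R ^+ k = (j == k)%:R.
Hypothesis qP' : forall i j : 'I_(m 0), \sum_(k < m 0) (tau i)%:R ^+ k * q j k = (i == j)%:R.

(** The vector field whose action on symbols is [curve_mx]. *)
Definition curve_field t : vec := \sum_(j < m 0) t%:R ^+ j *: base_field m g j.

Lemma annih_curve t : annih m f (curve_field t).
Proof.
rewrite /curve_field; elim/big_ind: _ => [|Y Z aY aZ|j _]; first exact: annih0.
  exact: (annihD Fr).
by apply: (annihZ Fr); apply: (annih_base Fr).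
Qed.

Definition curve_basis (i : 'I_(m 0)) : coefs R := ofF (curve_field (tau i)).

Lemma curve_fieldE t : curve_field t = \sum_(j < m 0) t%:R ^+ j *: g 0 j.
Proof. by apply: eq_bigr => j _; rewrite /base_field ltn_ord. Qed.

(** The transition matrix to the dual fields is a Vandermonde matrix, with inverse
    q. *)
Lemma curve_is_basis : is_basis V H curve_basis.
Proof.
have dual_curve (j : 'I_(m 0)) t : pair (f 0 j) (curve_field t) = t%:R ^+ j.
  have fj := frame_fin Fr 0 j.
  rewrite curve_fieldE pair_sumr // (bigD1 j) //= pairZr // (frame_dual Fr) // !eqxx mulr1.
  rewrite big1 ?addr0 // => k; rewrite -val_eqE eq_sym => /negPf /= nk.
  by rewrite pairZr // (frame_dual Fr) // nk mulr0.
split.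
- by move=> i; apply/HP/annih_curve.
- move=> _ /H_vec[Z -> aZ].
  pose a (i : 'I_(m 0)) : F := \sum_(j < m 0) pair (f 0 j) Z * q i j.
  exists (fun i => val (a i)) => [i|]; first exact: smoothfnP.
  suff -> : Z = \sum_i a i *: curve_field (tau i) by rewrite ofF_sum /set1 /= subrr.
  rewrite {1}(annih_decomp Fr aZ).
  transitivity (\sum_(j < m 0) \sum_(k < m 0) (pair (f 0 j) Z * (j == k)%:R) *: g 0 k).
    apply: eq_bigr => j _; rewrite (bigD1 j) //= eqxx mulr1 big1 ?addr0 // => k.
    by rewrite eq_sym => /negPf->; rewrite mulr0 scale0r.
  rewrite exchange_big; under [RHS]eq_bigr => i _ do rewrite curve_fieldE scaler_sumr.
  rewrite [RHS]exchange_big; apply: eq_bigr => k _ /=.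
  under [RHS]eq_bigr do rewrite scalerA; rewrite -!scaler_suml; congr (_ *: _).
  under [RHS]eq_bigr do rewrite mulr_suml; rewrite [RHS]exchange_big.
  apply: eq_bigr => j _ /=; rewrite -qP mulr_sumr; apply: eq_bigr => i _.
  by rewrite mulrA.
move=> a Va; pose b i := mk_smoothfn (Va i).
have -> : \sum_i fscale (a i) (curve_basis i) = ofF (\sum_i b i *: curve_field (tau i)).
  by rewrite ofF_sum.
move=> e0; have {}e0 := @ofF_inj R V _ 0 e0.
have coord j : \sum_i b i * (tau i)%:R ^+ (j : 'I_(m 0)) = 0.
  have fj := frame_fin Fr 0 j.
  have := congr1 (pair (f 0 j)) e0; rewrite pair0r pair_sumr // => e1; rewrite -[RHS]e1.
  by apply: eq_bigr => i _; rewrite pairZr // dual_curve.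
move=> i; suff /(congr1 val) : b i = 0 by [].
transitivity (\sum_(i' < m 0) b i' * (i' == i)%:R).
  rewrite (bigD1 i) //= eqxx mulr1 big1 ?addr0 // => i' /negPf->; exact: mulr0.
under eq_bigr => i' _ do rewrite -qP' mulr_sumr; rewrite exchange_big big1 // => k _ /=.
under eq_bigr do rewrite mulrA; by rewrite -mulr_suml coord mul0r.
Qed.
End Involutive.

(** * Quasiregularity of the basis on the curve *)

Section Quasi.
Context {R : realType}.
Variable V : open_set R.
Local Notation F := (smoothfn V).
Local Notation vec := (nat -> F^o).
Local Notation d := (partials V).
Implicit Types v w Z : vec.
Variables (m : nat -> nat) (f g : nat -> nat -> vec).
Hypothesis Fr : frame m f g.
Hypothesis lie_frame : forall l j k, (j < m 0)%N -> (k < m l.+1)%N ->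
  filt m g l.+1 (lieF d (g 0 j) (f l.+1 k)).
Variables (tau : nat -> nat) (c0 c : nat).
Local Notation n := (m 0).
Local Notation M := (fun j l => mult_mx d m f g (base_field m g j) l).
Local Notation B j l := (curve_mx n M (tau j) l).
Hypothesis le_c0c : (c0 <= c)%N.
Hypothesis quasi : forall i l (v : 'rV[F]_(m l.+2)) (u : nat -> 'rV[F]_(m l.+2)),
  (i < n)%N -> (c0 <= l)%N -> v *m B i l.+1 = \sum_(j < i) u j *m B j l.+1 ->
  exists w : nat -> 'rV[F]_(m l.+1), v = \sum_(j < i) w j *m B j l.

Local Notation Om := (clift c (filt_set m g)).
Local Notation Omega := (contact_set m g).
Local Notation H := (perp V Omega).
Local Notation Zb := (fun i : 'I_n => curve_basis g tau i).

Lemma filt_set0 l : filt_set m g l 0.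
Proof. by exists 0; first exact: filt0. Qed.
Lemma filt_setD l X Y : filt_set m g l X -> filt_set m g l Y -> filt_set m g l (X + Y).
Proof. by move=> [v fv <-] [w fw <-]; exists (v + w); first exact: filtD. Qed.
Lemma filt_setZ l (a : F) X : filt_set m g l X -> filt_set m g l (fscale (val a) X).
Proof. by move=> [w fw <-]; exists (a *: w); first exact: filtZ. Qed.

Lemma mult_mx_curve t l : mult_mx d m f g (curve_field m g t) l = curve_mx n M t l.
Proof.
rewrite /curve_field (mult_mx_comb d Fr) // => j; exact: (annih_base Fr).
Qed.

(** The module A(i)M is defined as the smallest one containing certain products;
    an upper bound for it, by a condition on the symbol in each degree, is what
    the injectivity statement needs. *)
Definition ideal_bound i : set (nat -> coefs R) :=
  [set x | [/\ gr_module Om x, x 0%N = 0 & forall l, exists w,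
     [/\ x l.+1 = ofF w, filt m g (l + c).+1 w & exists u : nat -> 'rV[F]_(m (l + c).+1),
         symbol m g (l + c).+1 w = \sum_(j < i) u j *m B j (l + c)%N]]].

Lemma gr_module_vec x l : gr_module Om x -> exists2 w, x l = ofF w & filt m g (l + c)%N w.
Proof. by move=> [/(_ l)[w fw <-] _]; exists w. Qed.

Lemma gr_module_mul Y x : H Y -> gr_module Om x -> gr_module Om (gr_mul V Y x).
Proof.
move=> HY [xOm [L xL]]; split=> [[|l]|].
- exact: filt_set0.
- exact: (lie_filt_set Fr lie_frame HY (xOm l)).
exists L.+1 => -[|l] //= le_l; rewrite xL //.
have [Z -> _] := H_vec Fr HY.
by rewrite -[0]/(ofF (0 : vec)) lie_ofF ?lieF0 //; apply: fin0.
Qed.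

(** Stability under multiplication by the fields of H uses that the multiplication
    matrices commute. *)
Lemma ideal_bound_submodule i : A_submodule V Omega Om (ideal_bound i).
Proof.
split.
- by move=> x [].
- move=> x x' [xM x0 xl] x'M e; split=> //.
    have e0 : - x' 0%N = 0 by have := e 0%N; rewrite /= x0 sub0r.
    by rewrite -[x' 0%N]opprK e0 oppr0.
  move=> l; have [w [Ew fw [u Eu]]] := xl l.
  have [w' Ew' fw'] := gr_module_vec l.+1 x'M; exists w'; split=> //; exists u.
  have [v fv Ev] := e l.+1; move: Ev; rewrite Ew Ew' -ofFB => /ofF_inj Ev.
  rewrite -Eu; apply/eqP; rewrite eq_sym -subr_eq0 -symbolB; [|exact: filt_fin fw|exact: filt_fin fw'].
  by rewrite -Ev (symbol_out fv).
- split.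
    split=> //; first by split=> [l|]; [apply: filt_set0|exists 0%N].
    move=> l; exists 0; split=> //; first exact: filt0.
    by exists (fun=> 0); rewrite symbol0 big1 // => j _; rewrite mul0mx.
  move=> x y [[xM [L xL]] x0 xl] [[yM [L' yL]] y0 yl]; split.
  - split=> [l|]; first by apply: filt_setD; [apply: xM|apply: yM].
    exists (maxn L L') => l; rewrite geq_max => /andP[/xL ex /yL ey].
    by rewrite fctE ex ey addr0.
  - by rewrite fctE x0 y0 addr0.
  move=> l; have [w [Ew fw [u Eu]]] := xl l; have [w' [Ew' fw' [u' Eu']]] := yl l.
  exists (w + w'); split; [by rewrite fctE Ew Ew'|exact: filtD|].
  exists (fun j => u j + u' j); rewrite symbolD; [|exact: filt_fin fw|exact: filt_fin fw'].
  by rewrite Eu Eu' -big_split; apply: eq_bigr => j _; rewrite mulmxDl.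
- move=> a x Va [[xM [L xL]] x0 xl]; have [b {Va}->] := smoothfn_of Va; split.
  - split=> [l|]; first exact/filt_setZ/xM.
    by exists L => l /xL ex; rewrite /gr_scale ex; apply/funext => k; apply: mulr0.
  - by rewrite /gr_scale x0; apply/funext => k; apply: mulr0.
  move=> l; have [w [Ew fw [u Eu]]] := xl l; exists (b *: w).
  split; [by rewrite /gr_scale Ew|exact: filtZ|].
  exists (fun j => b *: u j); rewrite symbolZ; last exact: filt_fin fw.
  by rewrite Eu scaler_sumr; apply: eq_bigr => j _; rewrite scalemxAl.
move=> Y x HY [xM x0 xl]; split=> //; first exact: gr_module_mul.
have [Z EY aZ] := H_vec Fr HY.
case=> [|l] /=.
  exists 0; rewrite x0 EY -[0 in LHS]/(ofF (0 : vec)) lie_ofF ?lieF0; last exact: fin0.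
  split=> //; first exact: filt0.
  by exists (fun=> 0); rewrite symbol0 big1 // => j _; rewrite mul0mx.
have [w [Ew fw [u Eu]]] := xl l; exists (lieF d Z w).
split; [by rewrite Ew EY lie_ofF //; apply: filt_fin fw|exact: (lie_filt Fr lie_frame aZ fw)|].
exists (fun j => u j *m mult_mx d m f g Z (l + c)%N).
rewrite (symbol_lie Fr lie_frame aZ fw) Eu mulmx_suml; apply: eq_bigr => j _.
rewrite -!mulmxA; congr (_ *m _); rewrite -!mult_mx_curve.
by apply: (mult_mxC Fr lie_frame) => //; apply: annih_curve.
Qed.

Lemma ideal_bound_gens i (j : 'I_n) x : (j < i)%N -> gr_module Om x ->
  ideal_bound i (gr_mul V (Zb j) x).
Proof.
move=> lt_ji xM; have aZ := annih_curve Fr (tau j).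
split=> //; first by apply: gr_module_mul xM; apply/(HP Fr).
move=> l; have [w Ew fw] := gr_module_vec l xM.
exists (lieF d (curve_field m g (tau j)) w).
split; [by rewrite /= Ew lie_ofF //; apply: filt_fin fw|exact: (lie_filt Fr lie_frame aZ fw)|].
exists (fun k => if k == j :> nat then symbol m g (l + c)%N w else 0).
rewrite (symbol_lie Fr lie_frame aZ fw) (bigD1 (Ordinal lt_ji)) //= eqxx mult_mx_curve.
rewrite big1 ?addr0 // => k; rewrite -val_eqE /= => /negPf->.
by rewrite mul0mx.
Qed.

Lemma ideal_mul_bound i x : ideal_mul V Omega Om Zb i x -> ideal_bound i x.
Proof.
move=> Ix; apply: Ix; split; first exact: ideal_bound_submodule.
by move=> _ [j [y [lt_ji yM ->]]]; apply: ideal_bound_gens.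
Qed.

(** The bound on A(i)M turns the hypothesis into an identity of symbols, matrix
    quasiregularity solves it, and lifts of the solution exhibit v - v' modulo lower
    terms as an element of A(i)M.  The c-lift changes the graded module only in
    degree 0, and quasiregularity is required from degree 1 on. *)
Theorem quasiregular_curve_basis : quasiregular V Omega Om Zb.
Proof.
move=> [//|l] i _ _ _ [v fv <-] [v' fv' <-].
have [finv finv'] := (filt_fin fv, filt_fin fv').
have aZ := annih_curve Fr (tau i).
have fvv : filt m g (l.+1 + c)%N (v - v') by apply: filtB.
rewrite /quot_eq !lie_ofF // -!ofFB.
have lieB : lieF d (curve_field m g (tau i)) v - lieF d (curve_field m g (tau i)) v' =
    lieF d (curve_field m g (tau i)) (v - v').
  by rewrite lieFD ?lieF_N //; apply: finN.
rewrite lieB => /ideal_mul_bound[_ _ /(_ l.+1)[w [Ew fw [u Eu]]]].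
move: Ew; rewrite /gr_hom eqxx => /ofF_inj Ew.
move: Eu; rewrite -Ew (symbol_lie Fr lie_frame aZ fvv) mult_mx_curve.
have le_c0l : (c0 <= l + c)%N by apply: leq_trans le_c0c (leq_addl _ _).
case/(quasi (ltn_ord i) le_c0l) => r Er.
(* y j is the homogeneous element of degree l that the form of index j multiplies. *)
pose y (j : 'I_n) := gr_hom l (ofF (unsymbol f (r j))).
have yM j : gr_module Om (y j).
  split=> [k|]; last by exists l.+1 => k; rewrite /y /gr_hom => lt_lk; rewrite gtn_eqF.
  rewrite /y /gr_hom; case: eqP => [->|_]; last exact: filt_set0.
  by exists (unsymbol f (r j)) => //; apply: filt_unsymbol.
move=> T [[T_sub T_eq [T0 TD] _ _] T_gens].
pose x := \sum_(j < n | (j < i)%N) gr_mul V (Zb j) (y j).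
have Tx : T x.
  apply: big_ind => // j lt_ji; apply: T_gens; exists j, (y j); split=> //.
apply: (T_eq x) => //.
  split=> [k|]; last by exists l.+2 => k; rewrite /gr_hom => lt_lk; rewrite gtn_eqF.
  by rewrite /gr_hom; case: eqP => [->|_]; [exists (v - v')|apply: filt_set0].
have x_out k : k != l.+1 -> x k = 0.
  move=> nk; rewrite /x fct_sumE big1 // => j _; case: k nk => [|k] //.
  rewrite eqSS /= /y /gr_hom => /negPf->; rewrite -[0 in LHS]/(ofF (0 : vec)).
  by rewrite lie_ofF ?lieF0 //; apply: fin0.
have x_in : x l.+1 = ofF (\sum_(j < n | (j < i)%N)
    lieF d (curve_field m g (tau j)) (unsymbol f (r j))).
  rewrite /x fct_sumE ofF_sum; apply: eq_bigr => j _; rewrite /= /y /gr_hom eqxx.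
  by rewrite lie_ofF //; apply/filt_fin/(filt_unsymbol Fr).
move=> k; have [->|nk] := eqVneq k l.+1; last first.
  rewrite x_out // subr0.
  by case: k {nk} => [|k] //=; apply: filt_set0.
rewrite x_in -ofFB /=; eexists; last by [].
set s := \sum_(j < n | _) _.
have fs : filt m g (l.+1 + c)%N s.
  by apply: filt_sum => j _; apply: (lie_filt Fr lie_frame (annih_curve Fr _)); apply: filt_unsymbol.
apply: (filt_predP (l := (l + c).+1) Fr); first exact: filtB.
rewrite symbolB; [|exact: filt_fin fs|exact: filt_fin fvv].
apply/eqP; rewrite subr_eq0 Er /s symbol_sum => [|j _]; last first.
  by apply/fin_lieF/filt_fin/(filt_unsymbol Fr).
rewrite (big_ord_narrow (ltnW (ltn_ord i))) /=; apply/eqP.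
apply: eq_bigr => j _; rewrite /= (symbol_lie Fr lie_frame (annih_curve Fr _)); last exact: filt_unsymbol.
by rewrite (unsymbolK Fr) mult_mx_curve.
Qed.
End Quasi.

(** * Passage to a neighbourhood *)

Section Constants.
Context {R : realType}.
Variable V : open_set R.

Definition const_fn (r : R) : smoothfn V := mk_smoothfn (functions_on_cst (carrier_open V) r).

Lemma const_fnE r x : carrier V x -> val (const_fn r) x = r.
Proof. exact: zero_ext_in. Qed.

Fact const_fn_additive : zmod_morphism const_fn.
Proof.
move=> a b; apply: smoothfn_ext => x Vx; rewrite const_fnE //.
have -> : val (const_fn a - const_fn b) x = val (const_fn a) x - val (const_fn b) x by [].
by rewrite !const_fnE.
Qed.
HB.instance Definition _ :=
  GRing.isZmodMorphism.Build R (smoothfn V) const_fn const_fn_additive.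
Fact const_fn_multiplicative : monoid_morphism const_fn.
Proof.
split=> [|a b] //; apply: smoothfn_ext => x Vx; rewrite const_fnE //.
have -> : val (const_fn a * const_fn b) x = val (const_fn a) x * val (const_fn b) x by [].
by rewrite !const_fnE.
Qed.
HB.instance Definition _ :=
  GRing.isMonoidMorphism.Build R (smoothfn V) const_fn const_fn_multiplicative.

Lemma open_nonvanishing (a : smoothfn V) : open [set x | carrier V x /\ val a x != 0].
Proof.
rewrite openE => x [Vx ax0]; have [_ Ca _] := (functions_onP _ _).1 (smoothfnP a).
have ca : {for x, continuous (val a)} := (Ca 0%N).1 x Vx.
have n0 : nbhs (val a x) [set r : R | r != 0].
  by apply: open_nbhs_nbhs; split=> //; apply: open_neq.
have nV : nbhs x (carrier V) by apply: open_nbhs_nbhs; split=> //; apply: carrier_open.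
exact: filterI nV (ca _ n0).
Qed.
End Constants.

Lemma eval_const (R : realType) (U : open_set R) P (PU : carrier U P) (r : R) :
  eval_at PU (const_fn U r) = r.
Proof. exact: const_fnE. Qed.

Lemma restr_fn_const (R : realType) (U V : open_set R) (VU : carrier V `<=` carrier U) (r : R) :
  restr_fn VU (const_fn U r) = const_fn V r.
Proof.
apply: smoothfn_ext => x Vx; rewrite restr_fnE // !const_fnE //; exact: VU.
Qed.

Section RestrictedFiltration.
Context {R : realType}.
Variables U V : open_set R.
Hypothesis VU : carrier V `<=` carrier U.
Local Notation rho := (restr_fn VU).
Variables (m : nat -> nat) (f g : nat -> nat -> nat -> (smoothfn U)^o).
Hypothesis Fr : frame m f g.
Local Notation rf := (fun l k => map_vec rho (f l k)).
Local Notation rg := (fun l k => map_vec rho (g l k)).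
Let Fr' : frame m rf rg := map_frame rho Fr.

(** A restricted module is defined by generators and its description in the
    restricted frame by coordinates; it is enough that the restricted coordinates
    hold for restrictions and that the described forms are combinations of
    restricted frame elements. *)
Lemma restr_module_image (P : (nat -> (smoothfn U)^o) -> Prop)
    (Q : (nat -> (smoothfn V)^o) -> Prop) (W : set (coefs R)) :
  W `<=` forms U -> (forall w, W (ofF w) <-> P w) -> submodule V (image_of Q) ->
  (forall w, P w -> Q (map_vec rho w)) ->
  (forall T, submodule V T -> (forall w, P w -> T (ofF (map_vec rho w))) ->
     forall w, Q w -> T (ofF w)) ->
  restr_module V W = image_of Q.
Proof.
move=> Wf WP Q_sub PQ Q_gen.
have gens : [set restr V w | w in W] `<=` image_of Q.
  move=> _ [w Ww <-]; have /formsP[w' fw' Ew] := Wf w Ww.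
  rewrite Ew restr_ofF; apply/image_ofP/PQ/WP; by rewrite -Ew.
apply/seteqP; split; first exact: smallest_sub.
move=> _ [w Qw <-]; apply: Q_gen => //.
  by apply: Fspan_submodule => // X /gens; have [Qf _ _ _] := Q_sub; apply: Qf.
move=> v Pv; apply: sub_gen_smallest; exists (ofF v); last exact: restr_ofF.
exact/WP.
Qed.

Lemma restr_filt (W : set (coefs R)) l : W `<=` forms U ->
  (forall w, W (ofF w) <-> filt m g l w) -> restr_module V W = filt_set m rg l.
Proof.
move=> Wf WP; apply: (restr_module_image Wf WP).
- exact: filt_set_submodule.
- by move=> w; apply: map_filt.
move=> T T_sub Tf w; apply: (filt_in_submodule Fr' T_sub) => l' k le_l' lt_k.
by apply/Tf/(filt_leW le_l')/(filt_frame Fr).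
Qed.

Lemma restr_contact (W : set (coefs R)) : W `<=` forms U ->
  (forall w, W (ofF w) <-> contact m g w) -> restr_module V W = contact_set m rg.
Proof.
move=> Wf WP; apply: (restr_module_image Wf WP).
- exact: (contact_set_submodule Fr').
- move=> w /(contact_filt Fr)[l fw]; apply: filt_contact; exact: map_filt fw.
move=> T T_sub Tf w /(contact_filt Fr')[l]; apply: (filt_in_submodule Fr' T_sub) => l' k _ lt_k.
by apply/Tf/filt_contact/(filt_frame Fr).
Qed.
End RestrictedFiltration.

Section Assembly.
Context {R : realType}.
Variables (U : open_set R) (P : pt R).
Hypothesis PU : carrier U P.
Local Notation d := (partials U).
Variables (m : nat -> nat) (f g : nat -> nat -> nat -> (smoothfn U)^o).
Hypothesis Fr : frame m f g.
Hypothesis lie_frame : forall l j k, (j < m 0)%N -> (k < m l.+1)%N ->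
  filt m g l.+1 (lieF d (g 0 j) (f l.+1 k)).
Variable l0 : nat.
Hypothesis frame_gen : forall l k, (l0 <= l)%N -> (k < m l.+2)%N ->
  exists2 u : nat -> nat -> (smoothfn U)^o, forall j, filt m g l (u j) &
    filt m g l (f l.+2 k - \sum_(j < m 0) lieF d (g 0 j) (u j)).
Local Notation n := (m 0).
Local Notation m' := (fun l => m l.+1).
Local Notation evP := (eval_at PU).
Let M j l : 'M[smoothfn U]_(m' l, m' l.+1) := mult_mx d m f g (base_field m g j) l.

Let M_comm j k l : M j l *m M k l.+1 = M k l *m M j l.+1.
Proof. by apply: (mult_mxC Fr lie_frame); apply: (annih_base Fr). Qed.

Let MP j l : 'M[R]_(m' l, m' l.+1) := map_mx evP (M j l).

Lemma MP_comm j k l : MP j l *m MP k l.+1 = MP k l *m MP j l.+1.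
Proof. by rewrite /MP -!map_mxM M_comm. Qed.

Lemma MP_gen l (v : 'rV[R]_(m' l.+1)) : (l0 <= l)%N ->
  exists u : nat -> 'rV[R]_(m' l), v = \sum_(j < n) u j *m MP j l.
Proof.
move=> le_l; pose v' : 'rV[smoothfn U]_(m' l.+1) := map_mx (const_fn U) v.
have [u Hu] := mult_mx_gen Fr lie_frame frame_gen v' le_l.
exists (fun j => map_mx evP (u j)).
transitivity (map_mx evP v').
  by apply/rowP => i; rewrite !mxE eval_const.
rewrite Hu map_mx_sum; apply: eq_bigr => j _; exact: map_mxM.
Qed.

(** The constant matrices that express quasiregularity at P are extended to U as
    constant functions, and V is the open set where the determinants of the
    resulting matrices T k, which are the identity at P, do not vanish. *)
Theorem local_involutive : exists (V : open_set R) (VU : carrier V `<=` carrier U),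
  carrier V P /\ exists c0, forall c, (c0 <= c)%N ->
    involutive_filtration V
      (contact_set m (fun l k => map_vec (restr_fn VU) (g l k)))
      (clift c (filt_set m (fun l k => map_vec (restr_fn VU) (g l k)))) n.
Proof.
have [tau [c0 [d0 [S [X [Y [tau_inj le_l0c XS dims_total]]]]]]] :=
  quasiregular_point MP_comm MP_gen.
have [q [qP qP']] := Vandermonde_inverse R tau_inj.
pose T (k : nat) : 'M[smoothfn U]_(m' c0.+1) :=
  map_mx (const_fn U) (X k) *m map_mx (const_fn U) (S k)
  + \sum_(k <= i < n) map_mx (const_fn U) (Y k i) *m rev_curve n M tau i c0.
pose a := \prod_(k < n.+1) \det (T k).
pose V := OpenSet (open_nonvanishing a).
have VU : carrier V `<=` carrier U by move=> x [].
exists V, VU; split.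
  split=> //; rewrite -[val a P]/(evP a) rmorph_prod; apply/prodf_neq0 => k _.
  rewrite -det_map_mx (_ : map_mx _ _ = 1%:M) ?det1 ?oner_eq0 // -(XS k).
  have constK p1 q1 (Z : 'M[R]_(p1, q1)) : map_mx evP (map_mx (const_fn U) Z) = Z.
    by apply/matrixP => i j; rewrite !mxE eval_const.
  rewrite map_mxD map_mxM !constK map_mx_sum; congr (_ + _); apply: eq_bigr => i _.
  by rewrite map_mxM constK /rev_curve map_curve_mx.
pose rho := restr_fn VU.
pose rf l k := map_vec rho (f l k); pose rg l k := map_vec rho (g l k).
have Fr' : frame m rf rg := map_frame rho Fr.
have lie_frame' := map_lie_frame (restr_fn_der VU) Fr lie_frame.
have frame_gen' := map_frame_gen (restr_fn_der VU) frame_gen.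
pose M' j l : 'M[smoothfn V]_(m' l, m' l.+1) := mult_mx (partials V) m rf rg (base_field m rg j) l.
have M'E j l : M' j l = map_mx rho (M j l).
  by rewrite /M' map_base_field (map_mult_mx (restr_fn_der VU)).
have M'_comm j k l : M' j l *m M' k l.+1 = M' k l *m M' j l.+1.
  by rewrite !M'E -!map_mxM M_comm.
have M'_gen l (v : 'rV[smoothfn V]_(m' l.+1)) : (l0 <= l)%N ->
    exists u : nat -> 'rV[smoothfn V]_(m' l), v = \sum_(j < n) u j *m M' j l.
  exact: (mult_mx_gen Fr' lie_frame' frame_gen').
pose qV : 'M[smoothfn V]_n := map_mx (const_fn V) q.
have qVP (j k : 'I_n) : \sum_(i < n) qV i j * (tau i)%:R ^+ k = (j == k)%:R.
  rewrite -[RHS](rmorph_nat (const_fn V)) -qP rmorph_sum; apply: eq_bigr => i _.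
  by rewrite mxE rmorphM rmorphXn rmorph_nat.
have qVP' (i j : 'I_n) : \sum_(k < n) (tau i)%:R ^+ k * qV j k = (i == j)%:R.
  rewrite -[RHS](rmorph_nat (const_fn V)) -qP' rmorph_sum; apply: eq_bigr => k _.
  by rewrite mxE rmorphM rmorphXn rmorph_nat.
pose cV p1 q1 (Z : 'M[R]_(p1, q1)) : 'M[smoothfn V]_(p1, q1) := map_mx (const_fn V) Z.
have rho_cst p1 q1 (Z : 'M[R]_(p1, q1)) : map_mx rho (map_mx (const_fn U) Z) = cV _ _ Z.
  by apply/matrixP => i j; rewrite !mxE; apply: restr_fn_const.
have TE k : map_mx rho (T k) = cV _ _ (X k) *m cV _ _ (S k)
    + \sum_(k <= i < n) cV _ _ (Y k i) *m rev_curve n M' tau i c0.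
  rewrite map_mxD map_mxM !rho_cst map_mx_sum; congr (_ + _); apply: eq_bigr => i _.
  rewrite map_mxM rho_cst /rev_curve map_curve_mx; congr (_ *m _).
  by apply: eq_bigr => j _; rewrite M'E.
have T_inv k : exists W, (k <= n)%N -> W *m map_mx rho (T k) = 1%:M.
  have [le_kn|lt_nk] := leqP k n; last by exists 0.
  have [|b Eb] := @smoothfn_unit _ V (\det (map_mx rho (T k))).
    move=> x Vx; have [Ux ax0] := Vx.
    rewrite det_map_mx -[ev _ _]/(val (rho (\det (T k))) x) restr_fnE //.
    move: ax0; rewrite -[val a x]/(eval_at Ux a) rmorph_prod => /prodf_neq0.
    by move/(_ (Ordinal (le_kn : (k < n.+1)%N)) isT).
  by exists (b *: \adj (map_mx rho (T k))) => _; rewrite -scalemxAl mul_adj_mx scale_scalar_mx Eb.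
have {T_inv} /choice[W W_inv] := T_inv.
have {}W_inv k : (k <= n)%N -> W k *m (cV _ _ (X k) *m cV _ _ (S k)
    + \sum_(k <= i < n) cV _ _ (Y k i) *m rev_curve n M' tau i c0) = 1%:M.
  by move=> /W_inv; rewrite TE.
have quasi := quasiregular_ring M'_comm M'_gen qVP le_l0c W_inv dims_total.
exists c0 => c le_c; split.
- exact: (clift_good Fr' lie_frame' frame_gen').
- exists (curve_basis rg tau); first exact: (curve_is_basis Fr' qVP qVP').
  exact: (quasiregular_curve_basis Fr' lie_frame' le_c quasi).
move=> l; apply: (filt_set_gen Fr' lie_frame' frame_gen').
by rewrite (leq_trans le_l0c) // (leq_trans le_c) ?leq_addl.
Qed.
End Assembly.

Theorem theorem4p4 (R : realType) (U : set (pt R)) (n : nat)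
    (Omega : set (coefs R)) (Om : nat -> set (coefs R))
    (U_open : open U) (n_ge1 : (1 <= n)%N)
    (Omega_diffiety : diffiety U n Omega)
    (Om_good : good_filtration U Omega Om)
    (M_bases : forall l, finite_rank_mod U (Om l) (pred_filt Om l))
    (P : pt R) (PU : U P) :
  exists V : set (pt R),
    [/\ open V, V P, V `<=` U &
        exists c0 : nat, forall c : nat, (c0 <= c)%N ->
          involutive_filtration V (restr_module V Omega)
            (clift c (fun l => restr_module V (Om l))) n].
Proof.
have [contact_sub contact_codim _] := Omega_diffiety.
pose U' := OpenSet U_open.
have [m [f [g [m0 Fr OmP OmegaP]]]] :=
  @adapted_frame _ U' n Omega Om contact_sub contact_codim Om_good M_bases.
have lie_frame := adapted_lie_frame (U := U') contact_sub Om_good Fr OmP OmegaP.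
have [l0 frame_gen] := adapted_frame_gen (U := U') contact_sub Om_good Fr OmP OmegaP.
have [V [VU [VP [c0 Hc0]]]] := local_involutive (PU : carrier U' P) Fr lie_frame frame_gen.
exists V; split=> //; first exact: carrier_open.
exists c0 => c le_c; have := Hc0 c le_c; rewrite m0.
have [contact_f _ _ _] := contact_sub.
rewrite -(restr_contact VU Fr contact_f OmegaP).
have -> : filt_set m (fun l k => map_vec (restr_fn VU) (g l k)) =
    (fun l => restr_module V (Om l)); last by [].
apply/funext => l; apply/esym/(restr_filt VU Fr) => //.
have [Om_fin _ _ _ _] := Om_good; have [[Om_f _ _ _] _] := Om_fin l; exact: Om_f.
Qed.
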